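(* Let $G=\langle A,B\rangle\subset PSL(2,\mathbb{C})$ be a non-elementary geometrically finite group with core geodesic $\mathbf{L}$. Let $\mathbf{I}$ be the intersection of $\mathbf{L}$ with $\mathcal{C}$, the convex hull of the limit set of $G$, and let $Q_1$ and $Q_2$ be the endpoints of $\mathbf{I}$. Let $(\partial\mathcal{C},PL)$ be the corresponding pleated surface, and let $|PL|$ be the support of the image of the pleating locus of $\partial\mathcal{C}$. Then one of the following occurs: (1) There is a leaf of $|PL|$ intersecting $\mathbf{I}$ orthogonally at one of its endpoints, and this leaf is an accumulation of axes of palindromes in $A$ and $B$. (This leaf may intersect $\mathbf{I}$ at both $Q_1$ and $Q_2$, or there may be two such distinct leaves, one intersecting $\mathbf{I}$ at $Q_1$ and the other at $Q_2$.) (2) Every leaf of $|PL|$ is disjoint from $\mathbf{I}$, and $Q_1$ and $Q_2$ lie in complementary components of $\partial\mathcal{C}$. In this case the pleating is not maximal.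
   Context: $PSL(2,\mathbb{C})$ acts on hyperbolic 3-space $\mathbb{H}^3$ with $\partial\mathbb{H}^3=\hat{\mathbb{C}}$. A subgroup is elementary if some point of $\hat{\mathbb{C}}$ has finite orbit. A discrete group of isometries of $\mathbb{H}^3$ is geometrically finite if it has a convex fundamental polyhedron with finitely many faces (geometrically finite groups are discrete by definition; parabolics and elliptics are allowed). Axes: for $X$ loxodromic or elliptic with fixed points $x,y\in\hat{\mathbb{C}}$, $Ax_X$ is the geodesic in $\mathbb{H}^3$ with ends $x,y$; for $X$ parabolic with fixed point $p$, $Ax_X$ is the degenerate line $[p,p]$. The core geodesic $\mathbf{L}$ is the unique common perpendicular to $Ax_A$ and $Ax_B$ (through the intersection point if they intersect in $\mathbb{H}^3$; a line is perpendicular to $[p,p]$ if $p$ is one of its ends). A palindrome is a word $W(A,B)$ in the generators that reads the same forwards and backwards. Convex hull boundary: $\Lambda=\Lambda(G)$ is the limit set, $\Omega=\Omega(G)$ the ordinary (regular) set, and $\mathcal{C}=\mathcal{C}(\Lambda)\subset\mathbb{H}^3$ the convex hull of $\Lambda$ (for $G$ Fuchsian, $\partial\mathcal{C}$ is interpreted as the double of the planar Nielsen convex region). Support planes are hyperbolic planes in $\mathbb{H}^3$ whose horizons contain points of $\Lambda$ and which have the property that one of the disks in $\hat{\mathbb{C}}$ they bound contains no points of $\Lambda$; $\mathcal{C}$ is the intersection of the half-spaces they bound. The boundary $\partial\mathcal{C}$ carries a complete hyperbolic structure obtained by gluing the structures on the support planes. Pleated surface: a pleated surface is a pair $(X,\mathfrak{pl})$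 where $X$ is a complete hyperbolic surface and $\mathfrak{pl}$ is an immersion and hyperbolic isometry of $X$ into a hyperbolic manifold such that every point of $X$ is in the interior of some geodesic arc mapped to a geodesic; its pleating locus is the set of points contained in the interior of exactly one such arc. Here $X=\tilde\Omega$ is the infinitely connected planar hyperbolic surface homeomorphic to $\Omega$ obtained by gluing together the complementary regions of the pleating lines of $\partial\mathcal{C}$ along their boundaries, and $PL:\tilde\Omega\to\mathbb{H}^3$ is the pleating map with image $\partial\mathcal{C}$. The support $|PL|$ (identified with its image in $\mathbb{H}^3$) is the pleating lamination of $\partial\mathcal{C}$: the closed set of pairwise disjoint hyperbolic geodesics (leaves, or pleating lines) lying on $\partial\mathcal{C}$ that are intersections of support planes or limits of such. The complementary components are the connected components of $\partial\mathcal{C}\setminus|PL|$; each is a hyperbolic polygon lying in a support plane with vertices on its horizon. The pleating locus is maximal if all of its complementary components are hyperbolic triangles.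
   Formalization: The endpoints Q1, Q2 of I are taken in hyperbolic space and at least one is assumed to exist, i.e. L is not contained in C (otherwise, as for the figure-eight knot group, neither case can hold); if I has only one endpoint there, Q1 = Q2. *)

(* Defs.v *)
From HB Require Import structures.
From mathcomp Require Import all_boot all_order all_algebra.
From mathcomp Require Import all_classical all_reals all_analysis.
From mathcomp Require Export complex.

Set Implicit Arguments.
Unset Strict Implicit.
Unset Printing Implicit Defensive.
Import Order.TTheory GRing.Theory Num.Theory.
Import numFieldNormedType.Exports.
Local Open Scope classical_set_scope.
Local Open Scope ring_scope.
Local Open Scope complex_scope.

(* The alias ^o gives R[i] the topology of its norm. *)
Notation Cplx R := ((complex R)^o).

(* The Riemann sphere; None is the point at infinity. *)
Notation Chat R := (one_point_compactification (Cplx R)).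

(* Ambient type of the upper half-space model: (z, t) with height t. *)
Notation Pt R := (Cplx R * R)%type.

Section HyperbolicSpace.
Context {R : realType}.
Implicit Types (g : 'M[Cplx R]_2) (G : set 'M[Cplx R]_2) (x y xi : Chat R)
  (p q : Pt R) (K : set (Chat R)) (S : set (Pt R)).

Definition H3 : set (Pt R) := [set p | 0 < p.2].

(* |z|^2 as an element of R *)
Definition sqn (z : Cplx R) : R := complex.Re z ^+ 2 + complex.Im z ^+ 2.

(* An element of PSL(2,C) is represented by a matrix g of determinant 1, up to
   sign; g and - g have the same action below. *)

Definition mobius g xi : Chat R :=
  let a := g 0 0 in let b := g 0 1 in let c := g 1 0 in let d := g 1 1 in
  match xi with
  | Some z => if c * z + d == 0 then None else Some ((a * z + b) / (c * z + d))
  | None => if c == 0 then None else Some (a / c)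
  end.

(* Poincare extension of the Moebius action to the upper half-space *)
Definition act g p : Pt R :=
  let a := g 0 0 in let b := g 0 1 in let c := g 1 0 in let d := g 1 1 in
  let z := p.1 in let t := p.2 in
  let m := sqn (c * z + d) + sqn c * t ^+ 2 in
  (((a * z + b) * conjc (c * z + d) + a * conjc c * (t ^+ 2)%:C) / m%:C,
   t / m).

(* The geodesic with ends x and y, for x <> y: a half-circle orthogonal to the
   boundary plane, or a vertical half-line. It is empty when x = y. *)
Definition geodesic x y : set (Pt R) :=
  match x, y with
  | Some u, Some v => [set p | H3 p /\ exists s : R,
      p.1 = u + s%:C * (v - u) /\ p.2 ^+ 2 = s * (1 - s) * sqn (v - u)]
  | Some u, None | None, Some u => [set p | H3 p /\ p.1 = u]
  | None, None => set0
  end.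

(* A tangent vector at p to geodesic x y. For finite ends it is the derivative
   in s of the parametrization above, where
   (1 - 2 s) |v - u|^2 = |z - v|^2 - |z - u|^2. *)
Definition tangent x y p : Pt R :=
  match x, y with
  | Some u, Some v => (v - u, (sqn (p.1 - v) - sqn (p.1 - u)) / (2 * p.2))
  | _, _ => (0, 1)
  end.

Definition dot p q : R := complex.Re (p.1 * conjc q.1) + p.2 * q.2.

(* The upper half-space metric is conformal to the Euclidean one, hence
   orthogonality is that of the Euclidean inner product. *)
Definition orthogonal_at x y x' y' p :=
  [/\ geodesic x y p, geodesic x' y' p & dot (tangent x y p) (tangent x' y' p) = 0].

(* The hyperbolic plane a (|z|^2 + t^2) + 2 Re (conj b z) + c = 0, that is, a
   hemisphere or a vertical half-plane; a c < |b|^2 says that it is nonempty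
   and not reduced to a point. *)
Record hplane := HPlane {
  pl_a : R; pl_b : Cplx R; pl_c : R;
  _ : pl_a * pl_c < sqn pl_b }.
Implicit Types h : hplane.

Definition side h p : R :=
  pl_a h * (sqn p.1 + p.2 ^+ 2) + 2 * complex.Re (conjc (pl_b h) * p.1) + pl_c h.

(* The horizon of h is the zero set of side_bd h, and 0 < side_bd h is one of
   the two open disks that it bounds; reversing the signs of the coefficients
   of h gives the other one. *)
Definition side_bd h xi : R :=
  match xi with
  | Some z => side h (z, 0)
  | None => pl_a h
  end.

Definition half_space h : set (Pt R) := [set p | H3 p /\ side h p <= 0].

(* h, cooriented so that the disk 0 < side_bd h is the one disjoint from K *)
Definition support_plane K h :=
  (exists2 xi, K xi & side_bd h xi = 0) /\
  (forall xi, K xi -> ~ (0 < side_bd h xi)).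

Definition hull K : set (Pt R) :=
  [set p | H3 p /\ forall h, support_plane K h -> half_space h p].

(* S is meant to be closed in H3. If S lies in a plane, this is S itself. *)
Definition frontier S : set (Pt R) := H3 `&` (closure S `\` S°).

(* The letter (true, e) is A or its inverse, (false, e) is B or its inverse;
   e = true stands for the inverse. *)
Definition letter (A B : 'M[Cplx R]_2) (l : bool * bool) : 'M[Cplx R]_2 :=
  let X := if l.1 then A else B in if l.2 then invmx X else X.

Definition word_val (A B : 'M[Cplx R]_2) (w : seq (bool * bool)) :
  'M[Cplx R]_2 := \prod_(l <- w) letter A B l.

Definition generated (A B : 'M[Cplx R]_2) : set 'M[Cplx R]_2 :=
  range (word_val A B).

Definition elementary G :=
  exists xi, finite_set [set mobius g xi | g in G].

Definition discrete_group G := isolated G 1%:M.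

Definition polyhedron n (hs : 'I_n -> hplane) : set (Pt R) :=
  [set p | H3 p /\ forall k, half_space (hs k) p].

(* P is the closure of a locally finite fundamental domain P° *)
Definition fundamental_polyhedron G (P : set (Pt R)) :=
  [/\ P° !=set0,
      (forall g, G g -> g <> 1%:M -> g <> - 1%:M ->
         (act g @` P°) `&` P° = set0),
      (forall p, H3 p -> exists2 g, G g & (act g @` P) p) &
      (forall p, H3 p -> exists2 U, nbhs p U &
         finite_set [set Q | exists2 g, G g &
           Q = act g @` P /\ Q `&` U !=set0])].

Definition geometrically_finite G :=
  discrete_group G /\
  exists n (hs : 'I_n -> hplane), fundamental_polyhedron G (polyhedron hs).

(* The boundary of H3 in the one-point compactification of C x R *)
Definition to_boundary xi : one_point_compactification (Pt R) :=
  match xi with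
  | Some z => Some (z, 0)
  | None => None
  end.

(* Accumulation points on the sphere of the orbits in H3 *)
Definition limit_set G : set (Chat R) :=
  [set xi | exists2 p, H3 p &
    closure [set (Some (act g p) : one_point_compactification (Pt R)) | g in G]
      (to_boundary xi)].

(* x = y iff g is parabolic; the axis is then the degenerate line [x, x].
   There are no such x and y if g acts trivially. *)
Definition axis_ends g x y := [set xi | mobius g xi = xi] = [set x; y].

(* The line with ends l1 <> l2 is perpendicular to the, possibly degenerate,
   line with ends x, y. *)
Definition perpendicular l1 l2 x y :=
  (x = y /\ (l1 = x \/ l2 = x)) \/
  (x <> y /\ exists p, orthogonal_at l1 l2 x y p).

Definition core_geodesic (A B : 'M[Cplx R]_2) l1 l2 :=
  l1 <> l2 /\
  exists a1 a2 b1 b2,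
    [/\ axis_ends A a1 a2, axis_ends B b1 b2,
        perpendicular l1 l2 a1 a2, perpendicular l1 l2 b1 b2 &
        geodesic a1 a2 `&` geodesic b1 b2 `<=` geodesic l1 l2].

(* The endpoints in H3 of a convex subset I of a geodesic L: the frontier of I
   relative to L. There are two of them if I is a nondegenerate segment, and one
   if I is a ray or a single point. *)
Definition endpoints (L I : set (Pt R)) : set (Pt R) :=
  L `&` closure I `&` closure (L `\` I).

(* Ends, in both orders, of the nondegenerate axes of palindromes *)
Definition palindrome_axes (A B : 'M[Cplx R]_2) : set (Chat R * Chat R) :=
  [set e | e.1 <> e.2 /\
    exists2 w, rev w = w & axis_ends (word_val A B w) e.1 e.2].

(* an open arc around p of geodesic x y is contained in S *)
Definition arc_through S p x y :=
  geodesic x y p /\ exists2 U, nbhs p U & geodesic x y `&` U `<=` S.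

(* For S the boundary of a convex hull: the points of S in the interior of exactly one geodesic arc of S, up to the
   choice of the length of the arc. A geodesic arc of H3 contained in S is the
   same as an arc of the pleated surface mapped to a geodesic. If the hull is
   planar, the pleated surface is its double, and the image of the pleating
   locus is again this set: the boundary lines of the hull. *)
Definition pleating_locus S : set (Pt R) :=
  [set p | exists x y, arc_through S p x y /\
    forall x' y', arc_through S p x' y' -> geodesic x' y' = geodesic x y].

Definition leaf S x y := x <> y /\ geodesic x y `<=` pleating_locus S.

Definition complementary_component S (D : set (Pt R)) :=
  exists2 p, (S `\` pleating_locus S) p &
    D = connected_component (S `\` pleating_locus S) p.

(* open ideal triangle *)
Definition ideal_triangle (D : set (Pt R)) :=
  exists u v w, [/\ u <> v, v <> w, w <> u &
    D = hull [set u; v; w] `\`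
        (geodesic u v `|` geodesic v w `|` geodesic w u)].

Definition maximal_pleating S :=
  forall D, complementary_component S D -> ideal_triangle D.

End HyperbolicSpace.

(* Main.v *)
Require Import Defs.
From mathcomp Require Import all_boot all_order all_algebra.
From mathcomp Require Import all_classical all_reals all_analysis.
From mathcomp Require Import ring lra.
Set Implicit Arguments.
Unset Strict Implicit.
Unset Printing Implicit Defensive.
Import Order.TTheory GRing.Theory Num.Theory.
Import numFieldNormedType.Exports.
Local Open Scope classical_set_scope.
Local Open Scope ring_scope.
Local Open Scope complex_scope.

(* The common perpendicular L carries a half-turn E with E A E^-1 = A^-1 and
   E B E^-1 = B^-1, so E preserves the limit set K, its hull C and the pleating.
   Normalise L to the vertical line over 0, so that E is z |-> - z. By symmetry C
   meets L exactly in the heights between the least and the greatest |z| with z in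
   K. At an endpoint Q of height t0 the hemisphere |z| = t0 is therefore a support
   plane touching K at some z and - z, and the geodesic from z to - z lies in the
   boundary of C, passes through Q and is orthogonal to L. If Q is on the pleating
   locus, this geodesic must be the leaf. If Q is not, its complementary component
   is invariant under E, which an ideal triangle on the hemisphere cannot be.

   For the axes, let g in G contract the ends of L to z. Up to sign g E g^-1 E is
   the value of a palindrome, and its fixed points are the square roots of
   g(0) g(oo), hence close to z and - z; the half-turns A E and B E can replace the
   first E. If all three words fixed z and - z exactly, then G would fix a point,
   against non-elementarity.

   Points of hyperbolic space and of the sphere at infinity are lifted to hermitian
   forms, where geodesics, half-spaces and the action g X g^* are linear. *)

(** * The hermitian model *)

(** With L the vertical line over 0, perpendicularity of L to the axis of a generator says that its
    matrix has equal diagonal entries. For any M of determinant 1, E M^-1 E^-1 is M with its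
    diagonal entries exchanged; this operation reverses products and fixes both generators, so it
    computes the value of a reversed word, and up to sign g E g^-1 E is g times the flip of g. For J
    among 1, A, B, the off-diagonal entries of g J (flip g) are the values at the two rows of g of
    one quadratic form, which splits into linear factors given by the fixed points of J E. With J =
    1 these are 0 and oo. Non-elementarity enters a second time in the choice of g: finitely many
    points must be kept away from the point near which g fails to contract. For the leaf, the
    difficulty is that the pleating locus is known only at Q and has to be propagated along the
    whole diameter; any competing arc elsewhere is moved to the top of the hemisphere, where
    uniqueness is known. *)

Lemma det_mx22 (T : comNzRingType) (M : 'M[T]_2) :
  \det M = M 0 0 * M 1 1 - M 0 1 * M 1 0.
Proof.
have l0 (i : 'I_1) : fintype.lift (0 : 'I_2) i = 1 by apply/val_inj; rewrite /= ord1.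
have l1 (i : 'I_1) : fintype.lift (1 : 'I_2) i = 0 by apply/val_inj; rewrite /= ord1.
rewrite (expand_det_row M 0) !big_ord_recl big_ord0 addr0 l0.
by rewrite /cofactor !det_mx11 !mxE !l0 !l1 /= expr0 expr1 mul1r mulN1r mulrN.
Qed.

Lemma mul_mx22 (T : pzRingType) (M N : 'M[T]_2) i j : (M *m N) i j = M i 0 * N 0 j + M i 1 * N 1 j.
Proof.
rewrite mxE !big_ord_recl big_ord0 addr0.
by congr (_ + M i _ * N _ j); apply/val_inj.
Qed.

Section Model.
Context {R : realType}.
Implicit Types (g : 'M[Cplx R]_2) (xi : Chat R) (p q : Pt R) (z : Cplx R).

(* The hermitian form [[al, x + iy], [x - iy, ga]]. *)
Record herm := Herm { h_al : R; h_x : R; h_y : R; h_ga : R }.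
Implicit Types P X Y : herm.

Definition lc (l : R) X (m : R) Y : herm :=
  Herm (l * h_al X + m * h_al Y) (l * h_x X + m * h_x Y)
       (l * h_y X + m * h_y Y) (l * h_ga X + m * h_ga Y).

Definition scal (k : R) X : herm := Herm (k * h_al X) (k * h_x X) (k * h_y X) (k * h_ga X).

(* The polarization of twice the determinant [quad]. *)
Definition hpair X Y : R :=
  h_al X * h_ga Y + h_ga X * h_al Y - 2 * (h_x X * h_x Y + h_y X * h_y Y).

Definition quad X : R := h_al X * h_ga X - h_x X ^+ 2 - h_y X ^+ 2.

(** Normalised by [h_ga] equal to 1 and not by determinant 1, so that the lift is polynomial in the
    coordinates. Its determinant is t^2, and the action is equivariant only up to a positive
    factor. *)
Definition hlift p : herm :=
  Herm (sqn p.1 + p.2 ^+ 2) (complex.Re p.1) (complex.Im p.1) 1.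

Definition lbd xi : herm :=
  match xi with
  | Some z => Herm (sqn z) (complex.Re z) (complex.Im z) 1
  | None => Herm 1 0 0 0
  end.

(* The form g X g^*. *)
Definition hact g X : herm :=
  let a := g 0 0 in let b := g 0 1 in let c := g 1 0 in let d := g 1 1 in
  let w := (h_x X +i* h_y X : Cplx R) in
  let be := a * conjc c * (h_al X)%:C + a * conjc d * w + b * conjc c * conjc w
            + b * conjc d * (h_ga X)%:C in
  Herm (sqn a * h_al X + 2 * complex.Re (a * conjc b * w) + sqn b * h_ga X)
    (complex.Re be) (complex.Im be)
    (sqn c * h_al X + 2 * complex.Re (c * conjc d * w) + sqn d * h_ga X).

(** The equation of a plane is linear in the lift: [side] and [side_bd] are the restrictions of this
    one functional to interior and boundary points. *)
Definition ev (h : @hplane R) X : R :=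
  pl_a h * h_al X + 2 * (complex.Re (pl_b h) * h_x X + complex.Im (pl_b h) * h_y X)
  + pl_c h * h_ga X.

Lemma herm_eq X Y : h_al X = h_al Y -> h_x X = h_x Y -> h_y X = h_y Y ->
  h_ga X = h_ga Y -> X = Y.
Proof. by case: X Y => [? ? ? ?] [? ? ? ?] /= -> -> -> ->. Qed.

Lemma side_ev h p : side h p = ev h (hlift p).
Proof. by case: h p => a [b b'] c H [[x y] t]; rewrite /side /ev /= /sqn /=; ring. Qed.

Lemma side_bd_ev h xi : side_bd h xi = ev h (lbd xi).
Proof.
case: h xi => a [b b'] c H [[x y]|]; rewrite /side_bd /side /ev /= /sqn /=; by ring.
Qed.

Lemma ev_lc h l X m Y : ev h (lc l X m Y) = l * ev h X + m * ev h Y.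
Proof. by rewrite /ev /=; ring. Qed.

Lemma ev_scal h k X : ev h (scal k X) = k * ev h X.
Proof. by rewrite /ev /=; ring. Qed.

Lemma hpairC X Y : hpair X Y = hpair Y X.
Proof. by rewrite /hpair; ring. Qed.

Lemma hpair_lcl l X m Y Z : hpair (lc l X m Y) Z = l * hpair X Z + m * hpair Y Z.
Proof. by rewrite /hpair /=; ring. Qed.

Lemma hpair_lcr l X m Y Z : hpair Z (lc l X m Y) = l * hpair Z X + m * hpair Z Y.
Proof. by rewrite /hpair /=; ring. Qed.

Lemma hpair_scall k X Z : hpair (scal k X) Z = k * hpair X Z.
Proof. by rewrite /hpair /=; ring. Qed.

Lemma hpair_quad X : hpair X X = 2 * quad X.
Proof. by rewrite /hpair /quad; ring. Qed.

Lemma quad_hlift p : quad (hlift p) = p.2 ^+ 2.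
Proof. by rewrite /quad /= /sqn; ring. Qed.

Lemma quad_lbd xi : quad (lbd xi) = 0.
Proof. by case: xi => [z|]; rewrite /quad /= /sqn; ring. Qed.

Lemma sqnM z w : sqn (z * w) = sqn z * sqn w :> R.
Proof. by case: z w => [a b] [c d]; rewrite /sqn /=; ring. Qed.

Lemma sqn_ge0 z : 0 <= sqn z.
Proof. by rewrite addr_ge0 ?sqr_ge0. Qed.

Lemma sqn_eq0 z : (sqn z == 0) = (z == 0).
Proof.
case: z => a b; rewrite /sqn /= paddr_eq0 ?sqr_ge0// !sqrf_eq0.
by rewrite eq_complex.
Qed.

Lemma sqn_gt0 z : (0 < sqn z) = (z != 0).
Proof. by rewrite lt_def sqn_ge0 andbT sqn_eq0. Qed.

Lemma sqnN z : sqn (- z) = sqn z.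
Proof. by case: z => a b; rewrite /sqn /=; ring. Qed.

Lemma sqn0 : sqn 0 = 0 :> R.
Proof. by rewrite /sqn /=; ring. Qed.

Lemma sqnV z : sqn z^-1 = (sqn z)^-1 :> R.
Proof.
have [->|z0] := eqVneq z 0; first by rewrite invr0 sqn0 invr0.
have z1 : sqn z != 0 by rewrite sqn_eq0.
by apply: (mulfI z1); rewrite -sqnM !mulfV//; rewrite /sqn /=; ring.
Qed.

Lemma hact_lc g l X m Y : hact g (lc l X m Y) = lc l (hact g X) m (hact g Y).
Proof.
rewrite /hact.
move: (g 0 0) (g 0 1) (g 1 0) (g 1 1) => [a a'] [b b'] [c c'] [d d'].
by apply: herm_eq => /=; rewrite /sqn /=; ring.
Qed.

Lemma hact_scal g k X : hact g (scal k X) = scal k (hact g X).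
Proof.
rewrite /hact.
move: (g 0 0) (g 0 1) (g 1 0) (g 1 1) => [a a'] [b b'] [c c'] [d d'].
by apply: herm_eq => /=; rewrite /sqn /=; ring.
Qed.

Lemma mul2E g h i j : (g * h) i j = g i 0 * h 0 j + g i 1 * h 1 j.
Proof. exact: mul_mx22. Qed.

Lemma det2E g : \det g = g 0 0 * g 1 1 - g 0 1 * g 1 0.
Proof. exact: det_mx22. Qed.

Lemma hact_mul g h X : hact (g * h) X = hact g (hact h X).
Proof.
rewrite /hact !mul2E.
move: (g 0 0) (g 0 1) (g 1 0) (g 1 1) => [a a'] [b b'] [c c'] [d d'].
move: (h 0 0) (h 0 1) (h 1 0) (h 1 1) => [e e'] [f f'] [k k'] [l l'].
by apply: herm_eq => /=; rewrite /sqn /=; ring.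
Qed.

Lemma hact1 X : hact 1 X = X.
Proof. by rewrite /hact !mxE /=; apply: herm_eq => /=; rewrite /sqn /=; ring. Qed.

Lemma hpair_hact g X Y : hpair (hact g X) (hact g Y) = sqn (\det g) * hpair X Y.
Proof.
rewrite det2E /hact.
move: (g 0 0) (g 0 1) (g 1 0) (g 1 1) => [a a'] [b b'] [c c'] [d d'].
by rewrite /hpair /= /sqn /=; ring.
Qed.

End Model.

Section Points.
Context {R : realType}.
Implicit Types (g h : 'M[Cplx R]_2) (xi x y : Chat R) (p q : Pt R) (u v z w : Cplx R) (P X Y : @herm R).

Definition rank1 u v : @herm R :=
  Herm (sqn u) (complex.Re (u * conjc v)) (complex.Im (u * conjc v)) (sqn v).

(** Homogeneous coordinates: with them the Moebius action is linear and the case distinctions at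
    infinity disappear. *)
Definition toC u v : Chat R := if v == 0 then None else Some (u / v).

Definition vec1 xi : Cplx R := if xi is Some z then z else 1.
Definition vec2 xi : Cplx R := if xi is Some _ then 1 else 0.

Lemma lbd_rank1 xi : lbd xi = rank1 (vec1 xi) (vec2 xi).
Proof.
by case: xi => [[a b]|]; apply: herm_eq; rewrite /= /sqn /=; ring.
Qed.

Lemma toC_vec xi : toC (vec1 xi) (vec2 xi) = xi.
Proof. by case: xi => [z|]; rewrite /toC /= ?oner_eq0 ?eqxx// divr1. Qed.

Lemma vec_neq0 xi : vec2 xi = 0 -> vec1 xi <> 0.
Proof.
case: xi => [z|] /=; first by move/eqP; rewrite oner_eq0.
by move=> _; apply/eqP/oner_neq0.
Qed.

Lemma mobiusE g xi : mobius g xi =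
  toC (g 0 0 * vec1 xi + g 0 1 * vec2 xi) (g 1 0 * vec1 xi + g 1 1 * vec2 xi).
Proof. by case: xi => [z|]; rewrite /mobius /toC /= ?mulr1 ?mulr0 ?addr0. Qed.

Lemma hact_rank1 g u v : hact g (rank1 u v) =
  rank1 (g 0 0 * u + g 0 1 * v) (g 1 0 * u + g 1 1 * v).
Proof.
rewrite /hact.
move: (g 0 0) (g 0 1) (g 1 0) (g 1 1) u v => [a a'] [b b'] [c c'] [d d'] [u u'] [v v'].
by apply: herm_eq => /=; rewrite /sqn /=; ring.
Qed.

Lemma mulC_conj z : z * conjc z = (sqn z)%:C :> Cplx R.
Proof. by case: z => a b; apply/eqP; rewrite eq_complex /sqn /=; apply/andP; split; apply/eqP; ring. Qed.

Lemma sqn_div u v : v != 0 -> (sqn v)%:C * (u / v) = u * conjc v :> Cplx R.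
Proof. by move=> v0; rewrite -mulC_conj; field. Qed.

Lemma ReZ (k : R) z : complex.Re (k%:C * z : Cplx R) = k * complex.Re z.
Proof. by case: z => a b /=; ring. Qed.

Lemma ImZ (k : R) z : complex.Im (k%:C * z : Cplx R) = k * complex.Im z.
Proof. by case: z => a b /=; ring. Qed.

Lemma rank1_toC u v : (v = 0 -> u <> 0) -> exists2 k : R, 0 < k & rank1 u v = scal k (lbd (toC u v)).
Proof.
rewrite /toC; case: (eqVneq v 0) => [->|v0] uv.
  exists (sqn u); first by rewrite sqn_gt0; apply/eqP/uv.
  by apply: herm_eq => /=; rewrite /sqn /=; case: u uv => a b _ /=; ring.
exists (sqn v); first by rewrite sqn_gt0.
apply: herm_eq => /=; rewrite ?mulr1//.
- by rewrite sqnM sqnV mulrCA mulfV ?mulr1// sqn_eq0.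
- by rewrite -ReZ sqn_div.
- by rewrite -ImZ sqn_div.
Qed.

Lemma det1_vec g u v : \det g = 1 -> (v = 0 -> u <> 0) ->
  g 1 0 * u + g 1 1 * v = 0 -> g 0 0 * u + g 0 1 * v <> 0.
Proof.
rewrite det2E => dg uv e1 e2; apply: uv.
  rewrite -[v]mul1r -dg.
  transitivity (g 0 0 * (g 1 0 * u + g 1 1 * v) - g 1 0 * (g 0 0 * u + g 0 1 * v)); first by ring.
  by rewrite e1 e2; ring.
rewrite -[u]mul1r -dg.
transitivity (g 1 1 * (g 0 0 * u + g 0 1 * v) - g 0 1 * (g 1 0 * u + g 1 1 * v)); first by ring.
by rewrite e1 e2; ring.
Qed.

(** Positivity of the factor is what lets signs of [ev] be transported by the action. *)
Lemma mobius_lbd g xi : \det g = 1 ->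
  exists2 k : R, 0 < k & hact g (lbd xi) = scal k (lbd (mobius g xi)).
Proof.
move=> dg; rewrite lbd_rank1 hact_rank1 mobiusE; apply: rank1_toC.
exact: det1_vec (@vec_neq0 _).
Qed.

Lemma toC_vec_scal xi :  forall u v, (v = 0 -> u <> 0) -> toC u v = xi ->
  exists2 k, k != 0 & u = k * vec1 xi /\ v = k * vec2 xi.
Proof.
move=> u v uv; rewrite /toC; case: eqVneq => v0 <- /=.
  by exists u; [apply/eqP/uv|rewrite mulr1 mulr0].
by exists v => //; rewrite mulr1 mulrC divfK.
Qed.

Lemma toC_scal k u v : k != 0 -> toC (k * u) (k * v) = toC u v.
Proof.
move=> k0; rewrite /toC mulf_eq0 (negPf k0) /=; case: eqVneq => // v0.
by rewrite -mulf_div mulfV// mul1r.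
Qed.

Lemma mobius_mul g h xi : \det h = 1 -> mobius (g * h) xi = mobius g (mobius h xi).
Proof.
move=> dh; have hv := det1_vec dh (@vec_neq0 xi).
have [k k0 [e1 e2]] := toC_vec_scal hv (esym (mobiusE h xi)).
rewrite (mobiusE g (mobius h xi)) -(toC_scal _ _ k0) !mulrDr ![k * (_ * _)]mulrCA -e1 -e2.
by rewrite (mobiusE (g * h)) !mul2E; congr toC; ring.
Qed.

Lemma mobius1 xi : mobius 1 xi = xi.
Proof. by rewrite mobiusE !mxE /= !mul1r !mul0r addr0 add0r toC_vec. Qed.

Lemma hpair_lbd_Some z w : hpair (lbd (Some z)) (lbd (Some w)) = sqn (z - w).
Proof. by case: z w => [a b] [c d]; rewrite /hpair /= /sqn /=; ring. Qed.

Lemma hpair_lbd_ge0 x y : 0 <= hpair (lbd x) (lbd y).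
Proof.
case: x y => [z|] [w|]; rewrite ?hpair_lbd_Some ?sqn_ge0// /hpair /=; lra.
Qed.

Lemma hpair_lbd_gt0 x y : x <> y -> 0 < hpair (lbd x) (lbd y).
Proof.
case: x y => [z|] [w|] xy; try by [rewrite /hpair /=; lra|case: xy].
rewrite hpair_lbd_Some sqn_gt0 subr_eq0; apply/eqP => zw; apply: xy.
by rewrite zw.
Qed.

Lemma quad_lc_lbd l x m y : quad (lc l (lbd x) m (lbd y)) = l * m * hpair (lbd x) (lbd y).
Proof.
have := quad_lbd x; have := quad_lbd y.
rewrite /quad /hpair /=.
move: (lbd x) (lbd y) => [a b c d] [a' b' c' d'] /= h h'.
transitivity (l * m * (a * d' + d * a' - 2 * (b * b' + c * c')) +
  l ^+ 2 * (a * d - b ^+ 2 - c ^+ 2) + m ^+ 2 * (a' * d' - b' ^+ 2 - c' ^+ 2)); first by ring.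
by rewrite h h'; ring.
Qed.

Lemma nrm_lbd xi : 0 < h_al (lbd xi) + h_ga (lbd xi).
Proof. by case: xi => [z|] /=; rewrite ?addr0// ltr_wpDl ?sqn_ge0. Qed.

Lemma ga_lbd xi : 0 <= h_ga (lbd xi).
Proof. by case: xi => [z|] /=. Qed.

(** Geodesics are plane sections in the linear model. For x = y the span contains null forms only,
    which agrees with the geodesic being empty. *)
Lemma geodesicE x y p : geodesic x y p <-> H3 p /\ exists l m, hlift p = lc l (lbd x) m (lbd y).
Proof.
case: p => [[a b] t]; case: x y => [[x1 x2]|] [[y1 y2]|] /=; rewrite /H3 /=.
- split=> [[t0 [s [e1 e2]]]|[t0 [l [m [e0 e1 e2 e3]]]]]; split=> //.
    exists (1 - s), s; move/eqP: e1; rewrite eq_complex /= => /andP[/eqP-> /eqP->].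
    by apply: herm_eq; rewrite /= ?e2 /sqn /=; ring.
  exists m; have -> : m = 1 - l by rewrite e3; ring.
  move: e0 e1 e2 => /=; rewrite /sqn /= !mulr1 in e3 * => e0 e1 e2.
  split.
    apply/eqP; rewrite eq_complex /= e1 e2.
    by have -> : m = 1 - l by [rewrite e3; ring]; apply/andP; split; apply/eqP; ring.
  move: e0; rewrite e1 e2; have -> : m = 1 - l by rewrite e3; ring.
  by move=> /(canRL (addKr _)) ->; ring.
- split=> [[t0 /eqP]|[t0 [l [m [e0 e1 e2 e3]]]]].
    rewrite eq_complex /= => /andP[/eqP-> /eqP->]; split=> //.
    by exists 1, (t ^+ 2); apply: herm_eq; rewrite /= ?/sqn /=; ring.
  split=> //; move: e1 e2 e3; rewrite !(mulr0, mulr1, addr0) => e1 e2 e3.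
  by rewrite e1 e2 -e3 !mul1r.
- split=> [[t0 /eqP]|[t0 [l [m [e0 e1 e2 e3]]]]].
    rewrite eq_complex /= => /andP[/eqP-> /eqP->]; split=> //.
    by exists (t ^+ 2), 1; apply: herm_eq; rewrite /= ?/sqn /=; ring.
  split=> //; move: e1 e2 e3; rewrite !(mulr0, mulr1, add0r) => e1 e2 e3.
  by rewrite e1 e2 -e3 !mul1r.
- split=> // -[t0 [l [m [_ _ _]]]]; rewrite !mulr0 addr0 => /eqP.
  by rewrite oner_eq0.
Qed.

(** The determinant t^2 > 0 of the lift gives l and m the same sign, and its positive trace excludes
    that both are negative. *)
Lemma geodesic_coefs x y p : geodesic x y p -> [/\ x <> y, H3 p &
  exists l m : R, [/\ 0 < l, 0 < m & hlift p = lc l (lbd x) m (lbd y)]].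
Proof.
move=> /geodesicE[p0 [l [m e]]].
have : 0 < quad (hlift p) by rewrite quad_hlift exprn_gt0.
rewrite e quad_lc_lbd => H.
have xy : x <> y.
  by move=> xy; move: H; rewrite xy hpair_quad quad_lbd !mulr0 ltxx.
split=> //; exists l, m.
move: H; rewrite pmulr_lgt0 ?hpair_lbd_gt0// => lm.
have N : 0 < l * (h_al (lbd x) + h_ga (lbd x)) + m * (h_al (lbd y) + h_ga (lbd y)).
  have -> : l * (h_al (lbd x) + h_ga (lbd x)) + m * (h_al (lbd y) + h_ga (lbd y)) =
    h_al (hlift p) + h_ga (hlift p) by rewrite e /=; ring.
  by rewrite /= ltr_wpDl// addr_ge0 ?sqn_ge0 ?sqr_ge0.
have [l0|l0] := ltP 0 l; first by split=> //; rewrite -(pmulr_rgt0 _ l0).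
have m0 : m <= 0.
  by rewrite leNgt; apply/negP => m0; move: lm; rewrite pmulr_lgt0// ltNge l0.
by move: N; rewrite ltNge -oppr_ge0 opprD -!mulNr addr_ge0// mulr_ge0 ?oppr_ge0// ltW ?nrm_lbd.
Qed.

Lemma geodesicC x y : geodesic x y = geodesic y x.
Proof.
by apply/seteqP; split=> p /geodesicE[p0 [l [m e]]]; apply/geodesicE; split=> //;
  exists m, l; rewrite e; apply: herm_eq => /=; rewrite addrC.
Qed.

(** Inverse of [hlift] up to scale, on positive definite forms. *)
Definition pt P : Pt R := ((h_x P / h_ga P +i* (h_y P / h_ga P) : Cplx R), Num.sqrt (quad P) / h_ga P).

Lemma hlift_pt P : 0 < h_ga P -> 0 <= quad P -> hlift (pt P) = scal (h_ga P)^-1 P.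
Proof.
move=> g0 q0; have gn : h_ga P != 0 by rewrite gt_eqF.
apply: herm_eq; rewrite /= ?mulVf// 1?mulrC// /sqn /= !expr_div_n sqr_sqrtr// /quad.
by field.
Qed.

Lemma H3_pt P : 0 < h_ga P -> 0 < quad P -> H3 (pt P).
Proof. by move=> g0 q0; rewrite /H3 /= divr_gt0// sqrtr_gt0. Qed.

Lemma hlift_inj p q : H3 p -> H3 q -> hlift p = hlift q -> p = q.
Proof.
case: p q => [[a b] t] [[a' b'] t']; rewrite /H3 /= => t0 t0' [] /=.
move=> e ea eb; rewrite ea eb in e *; move/addrI/eqP: e.
by rewrite eqrXn2 ?ltW// => /eqP ->.
Qed.

Lemma act_den_gt0 g p : \det g = 1 -> H3 p ->
  0 < sqn (g 1 0 * p.1 + g 1 1) + sqn (g 1 0) * p.2 ^+ 2.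
Proof.
move=> dg p0; have [c0|c0] := eqVneq (g 1 0) 0.
  rewrite c0 sqn0 !mul0r add0r addr0 sqn_gt0.
  by apply/eqP => d0; move: dg; rewrite det2E c0 d0 !mulr0 subrr => /esym/eqP; rewrite oner_eq0.
by rewrite ltr_wpDl ?sqn_ge0// mulr_gt0 ?sqn_gt0// exprn_gt0.
Qed.

Lemma H3_act g p : \det g = 1 -> H3 p -> H3 (act g p).
Proof. by move=> dg p0; rewrite /H3 /= divr_gt0//; apply: act_den_gt0. Qed.

Lemma act_hlift g p : \det g = 1 -> H3 p ->
  exists2 k : R, 0 < k & hact g (hlift p) = scal k (hlift (act g p)).
Proof.
move=> dg p0; have m0 := act_den_gt0 dg p0.
exists (sqn (g 1 0 * p.1 + g 1 1) + sqn (g 1 0) * p.2 ^+ 2) => //.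
have [m mE] : exists m, sqn (g 1 0 * p.1 + g 1 1) + sqn (g 1 0) * p.2 ^+ 2 = m by eexists.
rewrite mE in m0 *.
have mn : m != 0 by rewrite gt_eqF.
have mC : m%:C != 0 :> Cplx R by rewrite eq_complex /= negb_and mn.
have E3 : h_ga (hact g (hlift p)) = m.
  rewrite -mE /hact /=; case: (p) => [[a b] t] /=.
  by move: (g 0 0) (g 0 1) (g 1 0) (g 1 1) => [? ?] [? ?] [? ?] [? ?]; rewrite /sqn /=; ring.
have EW : (h_x (hact g (hlift p)) +i* h_y (hact g (hlift p)) : Cplx R) =
   (act g p).1 * m%:C.
  rewrite /act mE /= divfK//; apply/eqP; rewrite eq_complex; case: (p) => [[a b] t] /=.
  by move: (g 0 0) (g 0 1) (g 1 0) (g 1 1) => [? ?] [? ?] [? ?] [? ?]; rewrite /sqn /=; 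
    apply/andP; split; apply/eqP; ring.
have E1 : h_x (hact g (hlift p)) = m * complex.Re (act g p).1.
  by rewrite -ReZ [m%:C * _]mulrC -EW.
have E2 : h_y (hact g (hlift p)) = m * complex.Im (act g p).1.
  by rewrite -ImZ [m%:C * _]mulrC -EW.
have E0 : p.2 = m * (act g p).2 by rewrite /= mE mulrC divfK.
(* Three coordinates are compared directly; invariance of the determinant then yields the remaining
   one, [h_al]. *)
have Q : quad (hact g (hlift p)) = p.2 ^+ 2.
  apply: (@mulfI _ 2); first by rewrite pnatr_eq0.
  by rewrite -hpair_quad hpair_hact dg hpair_quad quad_hlift /sqn /=; ring.
clear mC EW mE; move: (act g p) E0 E1 E2 E3 Q => q E0 E1 E2 E3 Q.
apply: herm_eq; [|by []|by []|by rewrite E3 /= mulr1].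
apply: (mulIf mn); rewrite -{1}E3.
have -> : h_al (hact g (hlift p)) * h_ga (hact g (hlift p)) =
  quad (hact g (hlift p)) + h_x (hact g (hlift p)) ^+ 2 + h_y (hact g (hlift p)) ^+ 2.
  by rewrite /quad; ring.
by rewrite Q E0 E1 E2 /= /sqn; ring.
Qed.

End Points.

(** * Moebius invariance *)

Section Invariance.
Context {R : realType}.
Implicit Types (g h : 'M[Cplx R]_2) (xi x y : Chat R) (p q : Pt R) (u v z w : Cplx R) (P X Y N : @herm R)
  (K : set (Chat R)) (S : set (Pt R)) (l m k : R).

Lemma scalA k l X : scal k (scal l X) = scal (k * l) X.
Proof. by apply: herm_eq => /=; rewrite mulrA. Qed.

Lemma scal1 X : scal 1 X = X.
Proof. by apply: herm_eq => /=; rewrite mul1r. Qed.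

Lemma scal_hlift_inj p q k l : 0 < k -> H3 p -> H3 q ->
  scal k (hlift p) = scal l (hlift q) -> p = q.
Proof.
move=> k0 p0 q0 e; have kl : k = l by case: e => _ _ _; rewrite !mulr1.
apply: hlift_inj => //.
have kn : k != 0 by rewrite gt_eqF.
by rewrite -[LHS]scal1 -[RHS]scal1 -(mulVf kn) -!scalA e kl.
Qed.

Lemma act_mul g h p : \det g = 1 -> \det h = 1 -> H3 p ->
  act (g * h) p = act g (act h p).
Proof.
move=> dg dh p0; have dgh : \det (g * h) = 1 by rewrite det_mulmx dg dh mulr1.
have [k k0 ek] := act_hlift dgh p0.
have [l l0 el] := act_hlift dh p0.
have [m m0 em] := act_hlift dg (H3_act dh p0).
apply: (@scal_hlift_inj _ _ k (l * m)) => //; [exact: H3_act|by apply: H3_act => //; apply: H3_act|].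
by rewrite -ek hact_mul el hact_scal em scalA.
Qed.

Lemma act1 p : H3 p -> act 1 p = p.
Proof.
move=> p0; have d1 : \det (1 : 'M[Cplx R]_2) = 1 by rewrite det1.
have [k k0 ek] := act_hlift d1 p0.
apply: (@scal_hlift_inj _ _ k 1) => //; first exact: H3_act.
by rewrite -ek hact1 scal1.
Qed.

Lemma det1_unit g : \det g = 1 -> g \is a GRing.unit.
Proof. by move=> dg; rewrite unitmxE dg unitr1. Qed.

Lemma det1_inv g : \det g = 1 -> \det (g^-1) = 1.
Proof. by move=> dg; rewrite det_inv dg invr1. Qed.

Lemma det1_mul g h : \det g = 1 -> \det h = 1 -> \det (g * h) = 1.
Proof. by move=> dg dh; rewrite det_mulmx dg dh mulr1. Qed.

Lemma actK g p : \det g = 1 -> H3 p -> act g^-1 (act g p) = p.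
Proof.
by move=> dg p0; rewrite -act_mul ?det1_inv// mulVr ?det1_unit// act1.
Qed.

Lemma actVK g p : \det g = 1 -> H3 p -> act g (act g^-1 p) = p.
Proof.
by move=> dg p0; rewrite -act_mul ?det1_inv// mulrV ?det1_unit// act1.
Qed.

Lemma mobiusK g xi : \det g = 1 -> mobius g^-1 (mobius g xi) = xi.
Proof. by move=> dg; rewrite -mobius_mul// mulVr ?det1_unit// mobius1. Qed.

Lemma mobiusVK g xi : \det g = 1 -> mobius g (mobius g^-1 xi) = xi.
Proof. by move=> dg; rewrite -mobius_mul ?det1_inv// mulrV ?det1_unit// mobius1. Qed.

Lemma mobius_inj g x y : \det g = 1 -> mobius g x = mobius g y -> x = y.
Proof. by move=> dg e; rewrite -(mobiusK x dg) e mobiusK. Qed.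

Lemma act_imageK g S : \det g = 1 -> S `<=` H3 -> act g^-1 @` (act g @` S) = S.
Proof.
move=> dg SH; apply/seteqP; split=> [_ [_ [p Sp <-] <-]|p Sp].
  by rewrite actK//; apply: SH.
by exists (act g p); [exists p|rewrite actK//; apply: SH].
Qed.

Lemma act_imageVK g S : \det g = 1 -> S `<=` H3 -> act g @` (act g^-1 @` S) = S.
Proof.
move=> dg SH; apply/seteqP; split=> [_ [_ [p Sp <-] <-]|p Sp].
  by rewrite actVK//; apply: SH.
by exists (act g^-1 p); [exists p|rewrite actVK//; apply: SH].
Qed.

Lemma mobius_imageK g K : \det g = 1 -> mobius g^-1 @` (mobius g @` K) = K.
Proof.
move=> dg; apply/seteqP; split=> [_ [_ [p Sp <-] <-]|p Sp].
  by rewrite mobiusK.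
by exists (mobius g p); [exists p|rewrite mobiusK].
Qed.

Lemma H3_image g S : \det g = 1 -> S `<=` H3 -> act g @` S `<=` H3.
Proof. by move=> dg SH _ [p /SH p0 <-]; apply: H3_act. Qed.

(** The pattern of the invariance statements: one inclusion, proved for every matrix of determinant
    1, is applied to g and to g^-1. *)
Lemma act_image_eq g S (F : set (Pt R)) : \det g = 1 -> S `<=` H3 ->
  (act g @` S `<=` F) -> (act g^-1 @` F `<=` S) -> F `<=` H3 -> F = act g @` S.
Proof.
move=> dg SH h1 h2 FH; apply/seteqP; split=> // p Fp.
exists (act g^-1 p); first by apply: h2; exists p.
by rewrite actVK//; apply: FH.
Qed.

Lemma geodesic_H3 x y : geodesic x y `<=` H3.
Proof. by move=> p /geodesicE[]. Qed.

Lemma geodesic_act_sub g x y p : \det g = 1 -> geodesic x y p ->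
  geodesic (mobius g x) (mobius g y) (act g p).
Proof.
move=> dg /geodesicE[p0 [l [m e]]]; apply/geodesicE; split; first exact: H3_act.
have [k k0 ek] := act_hlift dg p0.
have [a a0 ea] := mobius_lbd x dg; have [b b0 eb] := mobius_lbd y dg.
exists (l * a / k), (m * b / k).
have kn : k != 0 by rewrite gt_eqF.
rewrite -[LHS]scal1 -(mulVf kn) -scalA -ek e hact_lc ea eb.
by apply: herm_eq => /=; ring.
Qed.

Lemma geodesic_act g x y : \det g = 1 ->
  geodesic (mobius g x) (mobius g y) = act g @` geodesic x y.
Proof.
move=> dg; apply: act_image_eq => //; try exact: geodesic_H3.
  by move=> _ [p xyp <-]; apply: geodesic_act_sub.
move=> _ [p xyp <-]; rewrite -(mobiusK x dg) -(mobiusK y dg).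
exact: geodesic_act_sub (det1_inv dg) _.
Qed.

(** Polarity: planes are the orthogonal complements of forms of negative determinant, which move
    along with the action. *)
Lemma plane_of_herm N : quad N < 0 -> exists h : @hplane R, forall X, ev h X = hpair N X.
Proof.
case: N => [a b c d]; rewrite /quad /= => H.
have H' : d * a < sqn ((- b +i* - c) : Cplx R) by rewrite /sqn /=; nra.
by exists (HPlane H') => X; rewrite /ev /hpair /=; ring.
Qed.

Lemma herm_of_plane (h : @hplane R) : exists2 N, quad N < 0 & forall X, ev h X = hpair N X.
Proof.
case: h => a [b c] d H; exists (Herm d (- b) (- c) a).
  by move: H; rewrite /quad /sqn /=; nra.
by move=> X; rewrite /ev /hpair /=; ring.
Qed.

Lemma quad_hact g X : \det g = 1 -> quad (hact g X) = quad X.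
Proof.
move=> dg; apply: (@mulfI _ 2); first by rewrite pnatr_eq0.
by rewrite -!hpair_quad hpair_hact dg /sqn /=; ring.
Qed.

Lemma hpair_act1 g X Y : \det g = 1 -> hpair (hact g X) (hact g Y) = hpair X Y.
Proof. by move=> dg; rewrite hpair_hact dg /sqn /=; ring. Qed.

Lemma plane_pullback g (h : @hplane R) : \det g = 1 ->
  exists h' : @hplane R, forall X, ev h' X = ev h (hact g X).
Proof.
move=> dg; have [N N0 hN] := herm_of_plane h.
have [|h' hh'] := @plane_of_herm (hact g^-1 N); first by rewrite quad_hact ?det1_inv.
exists h' => X; rewrite hh' hN -(hpair_act1 _ _ dg) -hact_mul.
by rewrite mulrV ?det1_unit// hact1.
Qed.

Lemma support_planeE K (h : @hplane R) : support_plane K h <->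
  (exists2 xi, K xi & ev h (lbd xi) = 0) /\ (forall xi, K xi -> ev h (lbd xi) <= 0).
Proof.
split=> -[[xi Kxi e] H]; (split; first by exists xi => //; rewrite -e side_bd_ev) => eta Ke.
  by rewrite leNgt -side_bd_ev; apply/negP/H.
by rewrite side_bd_ev; apply/negP; rewrite -leNgt H.
Qed.

(** The cone over the hull, defined for all forms so that it also contains boundary points and is
    closed under nonnegative combinations. *)
Definition in_cone K P := forall h : @hplane R, support_plane K h -> ev h P <= 0.

Lemma hullE K p : hull K p <-> H3 p /\ in_cone K (hlift p).
Proof.
split=> -[p0 H]; split=> // h /H; rewrite /half_space/= side_ev; last by split.
by case.
Qed.

Lemma in_cone_lc K l X m Y : 0 <= l -> 0 <= m -> in_cone K X -> in_cone K Y ->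
  in_cone K (lc l X m Y).
Proof.
move=> l0 m0 hX hY h sh; rewrite ev_lc.
have := hX _ sh; have := hY _ sh; nra.
Qed.

Lemma in_cone_scal K k X : 0 < k -> in_cone K (scal k X) <-> in_cone K X.
Proof. by move=> k0; split=> H h /H; rewrite ev_scal pmulr_rle0. Qed.

Lemma in_cone_lbd K xi : K xi -> in_cone K (lbd xi).
Proof. by move=> Kxi h /support_planeE[_]; apply. Qed.

Lemma in_cone_hact g K P : \det g = 1 -> in_cone K P -> in_cone (mobius g @` K) (hact g P).
Proof.
move=> dg H h /support_planeE[[_ [xi Kxi <-] e] H'].
have [h' hh'] := plane_pullback h dg; rewrite -hh'; apply/H/support_planeE.
split.
  exists xi => //; rewrite hh'; have [k k0 ->] := mobius_lbd xi dg.
  by rewrite ev_scal e mulr0.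
move=> eta Ke; rewrite hh'; have [k k0 ->] := mobius_lbd eta dg.
by rewrite ev_scal pmulr_rle0//; apply: H'; exists eta.
Qed.

Lemma hull_H3 K : hull K `<=` H3. Proof. by move=> p []. Qed.

Lemma hull_act g K : \det g = 1 -> hull (mobius g @` K) = act g @` hull K.
Proof.
have sub f K' : \det f = 1 -> act f @` hull K' `<=` hull (mobius f @` K').
  move=> df _ [p /hullE[p0 H] <-]; apply/hullE; split; first exact: H3_act.
  have [k k0 ek] := act_hlift df p0.
  by apply/(in_cone_scal _ _ k0); rewrite -ek; apply: in_cone_hact.
move=> dg; apply: act_image_eq => //; try exact: hull_H3.
- exact: sub.
- by rewrite -[X in _ `<=` hull X](mobius_imageK K dg); apply/sub/det1_inv.
Qed.

(* The derivative at p in the direction v of the normalised lift to the hyperboloid,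
   multiplied by the square of the height. *)
Definition dlift p (v : Pt R) : @herm R :=
  let e := 2 * (complex.Re p.1 * complex.Re v.1 + complex.Im p.1 * complex.Im v.1) + 2 * p.2 * v.2 in
  lc p.2 (Herm e (complex.Re v.1) (complex.Im v.1) 0) (- v.2) (hlift p).

Lemma hpair_dlift p (v v' : Pt R) : hpair (dlift p v) (dlift p v') = - (2 * p.2 ^+ 2) * dot v v'.
Proof.
case: p v v' => [[a b] t] [[c d] s] [[c' d'] s'].
by rewrite /dot /hpair /dlift /= /sqn /=; ring.
Qed.

(** The geodesic is traced, up to scale, by l e^-s x + m e^s y, whose derivative at s = 0 is m y - l
    x. *)
Lemma dlift_tangent x y p l m : H3 p -> hlift p = lc l (lbd x) m (lbd y) ->
  exists2 k, k != 0 & dlift p (tangent x y p) = scal k (lc m (lbd y) (- l) (lbd x)).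
Proof.
case: p => [[a b] t]; rewrite /H3 /= => t0.
have tn : t != 0 by rewrite gt_eqF.
case: x y => [[x1 x2]|] [[y1 y2]|]; rewrite /hlift /lc /= /sqn /= => -[e1 e2 e3 e4].
- rewrite !mulr1 in e4.
  have lE : l = 1 - m by rewrite e4; ring.
  move: e2 e3 e1; rewrite lE => -> -> e1.
  have e5 : t ^+ 2 = m * (1 - m) * ((y1 - x1) ^+ 2 + (y2 - x2) ^+ 2).
    by move: e1 => /(canRL (addKr _)) ->; ring.
  have H0 : m * (1 - m) * ((y1 - x1) ^+ 2 + (y2 - x2) ^+ 2) != 0 by rewrite -e5 expf_neq0.
  exists (((y1 - x1) ^+ 2 + (y2 - x2) ^+ 2) / t * (1/2)).
    rewrite !mulf_neq0 ?invr_neq0 ?pnatr_eq0 ?oner_neq0//.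
    by apply: contraNneq H0 => ->; rewrite mulr0.
  have es : (((1 - m) * x1 + m * y1 - y1) ^+ 2 + ((1 - m) * x2 + m * y2 - y2) ^+ 2 -
    (((1 - m) * x1 + m * y1 - x1) ^+ 2 + ((1 - m) * x2 + m * y2 - x2) ^+ 2)) / (2 * t)
    = (1 - 2 * m) * ((y1 - x1) ^+ 2 + (y2 - x2) ^+ 2) / (2 * t) by congr (_ / _); ring.
  apply: herm_eq; rewrite /= es; apply: (mulfI tn).
  + rewrite /sqn /= e1.
    transitivity (t ^+ 2 * (2 * (((1 - m) * x1 + m * y1) * (y1 - x1) + ((1 - m) * x2 + m * y2) * (y2 - x2))
      + (1 - 2 * m) * ((y1 - x1) ^+ 2 + (y2 - x2) ^+ 2)) - (1 - 2 * m) * ((y1 - x1) ^+ 2 + (y2 - x2) ^+ 2)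
      / 2 * ((1 - m) * (x1 ^+ 2 + x2 ^+ 2) + m * (y1 ^+ 2 + y2 ^+ 2))); first by field.
    by rewrite e5; field.
  + transitivity (t ^+ 2 * (y1 - x1) - (1 - 2 * m) * ((y1 - x1) ^+ 2 + (y2 - x2) ^+ 2)
      / 2 * ((1 - m) * x1 + m * y1)); first by field.
    by rewrite e5; field.
  + transitivity (t ^+ 2 * (y2 - x2) - (1 - 2 * m) * ((y1 - x1) ^+ 2 + (y2 - x2) ^+ 2)
      / 2 * ((1 - m) * x2 + m * y2)); first by field.
    by rewrite e5; field.
  + by field.
- move: e4 e1 e2 e3; rewrite !mulr1 !mulr0 !addr0 => <-; rewrite !mul1r => e1 e2 e3.
  rewrite e2 e3 in e1 *; have <- : t ^+ 2 = m by lra.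
  exists 1; first exact: oner_neq0.
  by apply: herm_eq; rewrite /= ?/sqn /=; ring.
- move: e4 e1 e2 e3; rewrite !mulr1 !mulr0 !add0r => <-; rewrite !mul1r => e1 e2 e3.
  rewrite e2 e3 in e1 *; have <- : t ^+ 2 = l by lra.
  exists (-1); first by rewrite oppr_eq0 oner_neq0.
  by apply: herm_eq; rewrite /= ?/sqn /=; ring.
- by move/eqP: e4; rewrite !mulr0 addr0 oner_eq0.
Qed.

(** By [hpair_dlift] the pairing of lifted tangent vectors is a nonzero multiple of their Euclidean
    product, so orthogonality becomes a condition visibly invariant under the action. *)
Lemma orthogonal_atE x y x' y' p : orthogonal_at x y x' y' p <->
  exists l m l' m', [/\ H3 p, hlift p = lc l (lbd x) m (lbd y),
    hlift p = lc l' (lbd x') m' (lbd y') &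
    hpair (lc m (lbd y) (- l) (lbd x)) (lc m' (lbd y') (- l') (lbd x')) = 0].
Proof.
have key l m l' m' : H3 p -> hlift p = lc l (lbd x) m (lbd y) ->
    hlift p = lc l' (lbd x') m' (lbd y') ->
    (dot (tangent x y p) (tangent x' y' p) = 0 <->
    hpair (lc m (lbd y) (- l) (lbd x)) (lc m' (lbd y') (- l') (lbd x')) = 0).
  move=> p0 e e'.
  have [k k0 ek] := dlift_tangent p0 e; have [k' k0' ek'] := dlift_tangent p0 e'.
  have := hpair_dlift p (tangent x y p) (tangent x' y' p).
  rewrite ek ek' hpair_scall [hpair _ (scal _ _)]hpairC hpair_scall hpairC => E.
  split=> [d0|h0].
    by move/eqP: E; rewrite d0 mulr0 !mulf_eq0 (negPf k0) (negPf k0') /= => /eqP.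
  move/esym/eqP: E; rewrite h0 !mulr0 mulf_eq0 oppr_eq0 mulf_eq0 pnatr_eq0 /=.
  by rewrite expf_eq0 /= gt_eqF//= => /eqP.
split=> [[/geodesicE[p0 [l [m e]]] /geodesicE[_ [l' [m' e']]] d0]|].
  by exists l, m, l', m'; split=> //; apply/(key _ _ _ _ p0 e e').
move=> [l [m [l' [m' [p0 e e' h0]]]]]; split.
- by apply/geodesicE; split=> //; exists l, m.
- by apply/geodesicE; split=> //; exists l', m'.
- by apply/(key _ _ _ _ p0 e e').
Qed.

Lemma orthogonal_at_act g x y x' y' p : \det g = 1 -> orthogonal_at x y x' y' p ->
  orthogonal_at (mobius g x) (mobius g y) (mobius g x') (mobius g y') (act g p).
Proof.
move=> dg /orthogonal_atE[l [m [l' [m' [p0 e e' h0]]]]]; apply/orthogonal_atE.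
have [k k0 ek] := act_hlift dg p0; have kn : k != 0 by rewrite gt_eqF.
have [a a0 ea] := mobius_lbd x dg; have [b b0 eb] := mobius_lbd y dg.
have [a' a0' ea'] := mobius_lbd x' dg; have [b' b0' eb'] := mobius_lbd y' dg.
have lcE i X j Y c d r : lc (i * c / r) X (j * d / r) Y = scal r^-1 (lc i (scal c X) j (scal d Y)).
  by apply: herm_eq => /=; ring.
exists (l * a / k), (m * b / k), (l' * a' / k), (m' * b' / k); split.
- exact: H3_act.
- by rewrite lcE -ea -eb -hact_lc -e ek scalA mulVf// scal1.
- by rewrite lcE -ea' -eb' -hact_lc -e' ek scalA mulVf// scal1.
- rewrite -!mulNr !lcE -ea -eb -ea' -eb' -!hact_lc.
  by rewrite hpair_scall hpairC hpair_scall hpair_act1// hpairC h0 !mulr0.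
Qed.

End Invariance.

(** * Continuity of the action and invariance of frontier, leaves and components *)

Section Topology.
Context {R : realType}.
Implicit Types (g h : 'M[Cplx R]_2) (xi x y : Chat R) (p q : Pt R) (u v z w : Cplx R) (P X Y N : @herm R)
  (K : set (Chat R)) (S : set (Pt R)).

(** The norm of [Cplx R] takes its values in the complex field, so radii of balls are complex
    numbers; real squared moduli replace them from here on. *)
Lemma nbhs_sqn z (U : set (Cplx R)) :
  nbhs z U <-> exists2 e : R, 0 < e & forall w, sqn (w - z) < e -> U w.
Proof.
have normE w : `|w| = (Num.sqrt (sqn w))%:C :> Cplx R by case: w.
split=> [/nbhs_ballP[[e e'] /=]|[e e0 H]].
  rewrite ltcE /= => /andP[/eqP e'0 e0] H.
  exists (e ^+ 2); first by rewrite exprn_gt0.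
  move=> w hw; apply: H; rewrite -ball_normE /= distrC normE ltcE /= e'0 eqxx /=.
  by rewrite -[ltRHS]ger0_norm ?ltW// -sqrtr_sqr ltr_sqrt// exprn_gt0.
apply/nbhs_ballP; exists (Num.sqrt e)%:C; first by rewrite /= ltcR sqrtr_gt0.
move=> w; rewrite -ball_normE /= distrC normE ltcR ltr_sqrt//; exact: H.
Qed.

Lemma Re_continuous : continuous (@complex.Re R : Cplx R -> R).
Proof.
move=> z U /nbhs_ballP[e e0 HU]; apply: (nbhs_sqn z _).2.
exists (e ^+ 2); first by rewrite exprn_gt0.
move: z HU => [a b] /= HU [c d]; rewrite /sqn /= => H; apply: HU; rewrite -ball_normE /=.
rewrite -[ltRHS]ger0_norm ?ltW// -ltr_sqr ?nnegrE// !real_normK ?num_real//.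
by apply: le_lt_trans H; rewrite -sqrrN opprB lerDl sqr_ge0.
Qed.

Lemma Im_continuous : continuous (@complex.Im R : Cplx R -> R).
Proof.
move=> z U /nbhs_ballP[e e0 HU]; apply: (nbhs_sqn z _).2.
exists (e ^+ 2); first by rewrite exprn_gt0.
move: z HU => [a b] /= HU [c d]; rewrite /sqn /= => H; apply: HU; rewrite -ball_normE /=.
rewrite -[ltRHS]ger0_norm ?ltW// -ltr_sqr ?nnegrE// !real_normK ?num_real//.
by apply: le_lt_trans H; rewrite -[leLHS]sqrrN opprB lerDr sqr_ge0.
Qed.

Lemma complex_cvg {T} (F : set_system T) {FF : Filter F} (f f' : T -> R) (a b : R) :
  f @ F --> a -> f' @ F --> b -> (fun t => f t +i* f' t : Cplx R) @ F --> (a +i* b : Cplx R).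
Proof.
move=> fa fb U /nbhs_sqn[e e0 H].
have e2 : 0 < e / 2 by rewrite divr_gt0.
have s2 : 0 < Num.sqrt (e / 2) by rewrite sqrtr_gt0.
move/cvgrPdist_lt: fa => /(_ _ s2) fa; move/cvgrPdist_lt: fb => /(_ _ s2) fb.
rewrite /nbhs /=; near=> t; apply: H.
have h (c d : R) : `|c - d| < Num.sqrt (e / 2) -> (d - c) ^+ 2 < e / 2.
  move=> hd; rewrite -sqrrN opprB -[(c - d) ^+ 2]real_normK ?num_real//.
  by rewrite -[ltRHS](@sqr_sqrtr _ (e / 2)) ?ltW// ltr_pXn2r// ?nnegrE// ltW.
have h1 : `|a - f t| < Num.sqrt (e / 2) by near: t.
have h2 : `|b - f' t| < Num.sqrt (e / 2) by near: t.
rewrite /sqn /=; have := h _ _ h1; have := h _ _ h2; lra.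
Unshelve. all: by end_near. Qed.

Lemma cvg_Pt {T} (F : set_system T) {FF : Filter F} (f : T -> Cplx R) (f' : T -> R) a b :
  f @ F --> a -> f' @ F --> b -> (fun t => (f t, f' t) : Pt R) @ F --> ((a, b) : Pt R).
Proof. by move=> fa fb; exact: (cvg_pair fa fb). Qed.

(** [herm] carries no topology, so convergence is meant entrywise. *)
Definition hcvg {T} (F : set_system T) (f : T -> @herm R) X :=
  [/\ (fun t => h_al (f t)) @ F --> h_al X, (fun t => h_x (f t)) @ F --> h_x X,
      (fun t => h_y (f t)) @ F --> h_y X & (fun t => h_ga (f t)) @ F --> h_ga X].

Lemma hcvg_lc {T} (F : set_system T) {FF : Filter F} (l m : T -> R) f f' a b X Y :
  l @ F --> a -> m @ F --> b -> hcvg F f X -> hcvg F f' Y ->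
  hcvg F (fun t => lc (l t) (f t) (m t) (f' t)) (lc a X b Y).
Proof.
move=> la mb [f1 f2 f3 f4] [g1 g2 g3 g4]; split.
- exact: (cvgD (cvgM la f1) (cvgM mb g1)).
- exact: (cvgD (cvgM la f2) (cvgM mb g2)).
- exact: (cvgD (cvgM la f3) (cvgM mb g3)).
- exact: (cvgD (cvgM la f4) (cvgM mb g4)).
Qed.

Lemma hcvg_cst {T} (F : set_system T) {FF : Filter F} X : hcvg F (fun=> X) X.
Proof. by split; apply: cvg_cst. Qed.

Lemma hact_lin g X : hact g X = lc 1 (lc (h_al X) (hact g (Herm 1 0 0 0)) (h_x X) (hact g (Herm 0 1 0 0)))
   1 (lc (h_y X) (hact g (Herm 0 0 1 0)) (h_ga X) (hact g (Herm 0 0 0 1))).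
Proof. by rewrite -!hact_lc; congr hact; apply: herm_eq => /=; ring. Qed.

Lemma hcvg_hact {T} (F : set_system T) {FF : Filter F} g f X :
  hcvg F f X -> hcvg F (fun t => hact g (f t)) (hact g X).
Proof.
move=> [f1 f2 f3 f4]; rewrite hact_lin.
have -> : (fun t => hact g (f t)) = fun t => lc 1 (lc (h_al (f t)) (hact g (Herm 1 0 0 0)) (h_x (f t)) (hact g (Herm 0 1 0 0)))
   1 (lc (h_y (f t)) (hact g (Herm 0 0 1 0)) (h_ga (f t)) (hact g (Herm 0 0 0 1))).
  by apply/funext => t; rewrite hact_lin.
have cc Y : hcvg F (fun=> Y) Y by apply: hcvg_cst.
have c1 : (fun=> 1 : R) @ F --> (1 : R) by apply: cvg_cst.
apply: (@hcvg_lc T F FF (fun=> 1) (fun=> 1) _ _ 1 1 _ _ c1 c1).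
  exact: (hcvg_lc f1 f2 (cc _) (cc _)).
exact: (hcvg_lc f3 f4 (cc _) (cc _)).
Qed.

Lemma hcvg_pt {T} (F : set_system T) {FF : Filter F} f X :
  h_ga X != 0 -> hcvg F f X -> (fun t => pt (f t)) @ F --> pt X.
Proof.
move=> g0 [f1 f2 f3 f4]; have gV : (fun t => (h_ga (f t))^-1) @ F --> (h_ga X)^-1 by apply: cvgV.
have cq : (fun t => quad (f t)) @ F --> quad X.
  exact: (cvgB (cvgB (cvgM f1 f4) (cvgM f2 f2)) (cvgM f3 f3)).
have cs : (fun t => Num.sqrt (quad (f t))) @ F --> Num.sqrt (quad X).
  exact: (cvg_comp _ _ cq (@sqrt_continuous R (quad X))).
apply: cvg_Pt; last exact: (cvgM cs gV).
exact: (complex_cvg (cvgM f2 gV) (cvgM f3 gV)).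
Qed.

Lemma hcvg_hlift p : hcvg (nbhs p) (@hlift R) (hlift p).
Proof.
have c1 : (fun q : Pt R => complex.Re q.1) @ p --> complex.Re p.1.
  by apply: (cvg_comp (fun q : Pt R => q.1)); [exact: cvg_fst|exact: Re_continuous].
have c2 : (fun q : Pt R => complex.Im q.1) @ p --> complex.Im p.1.
  by apply: (cvg_comp (fun q : Pt R => q.1)); [exact: cvg_fst|exact: Im_continuous].
split=> //=; last exact: cvg_cst.
have c3 : (fun q : Pt R => q.2) @ p --> p.2 by exact: cvg_snd.
exact: (cvgD (cvgD (cvgM c1 c1) (cvgM c2 c2)) (cvgM c3 c3)).
Qed.

(** Exhibits the action as a linear map between [hlift] and [pt], both of which are continuous where
    needed. *)
Lemma act_pt g p : \det g = 1 -> H3 p -> act g p = pt (hact g (hlift p)).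
Proof.
move=> dg p0; have [k k0 ek] := act_hlift dg p0.
have g0 : 0 < h_ga (hact g (hlift p)) by rewrite ek /= mulr1.
have q0 : 0 < quad (hact g (hlift p)) by rewrite quad_hact// quad_hlift exprn_gt0.
apply: (@scal_hlift_inj _ _ _ 1 1) => //; first exact: H3_act.
  exact: H3_pt.
rewrite !scal1 hlift_pt ?ltW// ek /= mulr1 scalA mulVf ?scal1//.
by rewrite gt_eqF.
Qed.

Lemma open_H3 : open (@H3 R).
Proof.
rewrite (_ : H3 = (fun q : Pt R => q.2) @^-1` [set t | 0 < t]).
  by apply: open_comp; [move=> q _; exact: cvg_snd|exact: open_gt].
by [].
Qed.

Lemma act_continuous g p : \det g = 1 -> H3 p -> {for p, continuous (act g)}.
Proof.
move=> dg p0; have ep := act_pt dg p0; rewrite /prop_for /continuous_at ep.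
have E : \near p, pt (hact g (hlift p)) = act g p.
  by apply: filterS (open_nbhs_nbhs (conj open_H3 p0)) => q q0; exact/esym/act_pt.
apply: cvg_trans; first exact: (near_eq_cvg E).
apply: hcvg_pt; last exact: (hcvg_hact _ (hcvg_hlift p)).
by have [k k0 ->] := act_hlift dg p0; rewrite /= mulr1 gt_eqF.
Qed.

Lemma nbhs_act g p (U : set (Pt R)) : \det g = 1 -> H3 p -> nbhs p U ->
  nbhs (act g p) (act g @` (U `&` H3)).
Proof.
move=> dg p0 pU; have q0 := H3_act dg p0; have dV := det1_inv dg.
have pU' : nbhs (act g^-1 (act g p)) U by rewrite actK.
have := act_continuous dV q0 pU'; rewrite /nbhs /= => pU2.
apply: filterS (filterI pU2 (open_nbhs_nbhs (conj open_H3 q0))) => q [/= Uq Hq].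
by exists (act g^-1 q); [split=> //; exact: H3_act|exact: actVK].
Qed.

Lemma closure_act g S p : \det g = 1 -> S `<=` H3 -> H3 p -> closure S p ->
  closure (act g @` S) (act g p).
Proof.
move=> dg SH p0 clp V nV; have dV := det1_inv dg.
have := nbhs_act dV (H3_act dg p0) nV; rewrite actK// => nU.
have [q [Sq [r [Vr r0] rq]]] := clp _ nU.
by exists r; split=> //; exists q => //; rewrite -rq actVK.
Qed.

Lemma interior_act g S p : \det g = 1 -> H3 p -> S^° p -> (act g @` S)^° (act g p).
Proof.
move=> dg p0 Sp; have := nbhs_act dg p0 Sp; apply: filterS.
by apply: image_subset => q [].
Qed.

Lemma frontier_H3 S : frontier S `<=` H3. Proof. by move=> p []. Qed.

Lemma frontier_act g S : \det g = 1 -> S `<=` H3 ->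
  frontier (act g @` S) = act g @` frontier S.
Proof.
have sub f S' : \det f = 1 -> S' `<=` H3 -> act f @` frontier S' `<=` frontier (act f @` S').
  move=> df SH _ [p [p0 [clp np]] <-]; split; first exact: H3_act.
  split; first exact: closure_act.
  move=> /(interior_act (det1_inv df) (H3_act df p0)).
  by rewrite actK// act_imageK.
move=> dg SH; apply: act_image_eq => //; try exact: frontier_H3.
- exact: sub.
- rewrite -[X in _ `<=` frontier X](act_imageK dg SH); apply: sub.
    exact: det1_inv.
  exact: H3_image.
Qed.

Lemma arc_through_act g S p x y : \det g = 1 -> arc_through S p x y ->
  arc_through (act g @` S) (act g p) (mobius g x) (mobius g y).
Proof.
move=> dg [xyp [U nU US]]; have p0 := geodesic_H3 xyp.
split; first exact: geodesic_act_sub.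
exists (act g @` (U `&` H3)); first exact: nbhs_act.
rewrite geodesic_act// => _ [[q xyq <-] [r [Ur r0] e]].
have -> : q = r by rewrite -(actK dg (geodesic_H3 xyq)) -e actK.
exists r => //; apply: US; split=> //.
by rewrite -(actK dg r0) e (actK dg (geodesic_H3 xyq)).
Qed.

Lemma pleating_H3 S : pleating_locus S `<=` H3.
Proof. by move=> p [x [y [[/geodesic_H3]]]]. Qed.

Lemma pleating_sub S : pleating_locus S `<=` S.
Proof.
move=> p [x [y [[xyp [U nU US]] _]]]; apply: US; split=> //.
exact: nbhs_singleton.
Qed.

Lemma pleating_act g S : \det g = 1 -> S `<=` H3 ->
  pleating_locus (act g @` S) = act g @` pleating_locus S.
Proof.
have sub f S' : \det f = 1 -> S' `<=` H3 ->
    act f @` pleating_locus S' `<=` pleating_locus (act f @` S').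
  move=> df SH _ [p [x [y [a un]]] <-]; exists (mobius f x), (mobius f y).
  split; first exact: arc_through_act.
  move=> x' y' /(arc_through_act (det1_inv df)).
  rewrite act_imageK// actK//; last exact: geodesic_H3 a.1.
  by move=> /un e; rewrite geodesic_act// -e -geodesic_act// !mobiusVK.
move=> dg SH; apply: act_image_eq => //; try exact: pleating_H3.
- exact: sub.
- rewrite -[X in _ `<=` pleating_locus X](act_imageK dg SH); apply: sub.
    exact: det1_inv.
  exact: H3_image.
Qed.

Lemma leaf_act g S x y : \det g = 1 -> S `<=` H3 -> leaf S x y ->
  leaf (act g @` S) (mobius g x) (mobius g y).
Proof.
move=> dg SH [xy sub]; split; first by move=> /(mobius_inj dg).
by rewrite geodesic_act// pleating_act//; apply: image_subset.
Qed.

Lemma connected_act g S : \det g = 1 -> S `<=` H3 -> connected S -> connected (act g @` S).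
Proof.
move=> dg SH cS; apply: connected_continuous_connected => //.
apply: continuous_in_subspaceT => p /[!inE] /SH p0.
exact: act_continuous.
Qed.

Lemma connected_component_act g S p : \det g = 1 -> S `<=` H3 -> S p ->
  connected_component (act g @` S) (act g p) = act g @` connected_component S p.
Proof.
have sub f S' p' : \det f = 1 -> S' `<=` H3 -> S' p' ->
    act f @` connected_component S' p' `<=` connected_component (act f @` S') (act f p').
  move=> df SH Sp _ [q [C [Cp CS cC] Cq] <-]; exists (act f @` C); last by exists q.
  split; [by exists p'|exact: image_subset|].
  by apply: connected_act => // r /CS/SH.
move=> dg SH Sp; apply: act_image_eq => //.
- by move=> q [C [_ CS _] Cq]; apply/SH/CS.
- exact: sub.
- rewrite -[X in _ `<=` connected_component X _](act_imageK dg SH).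
  rewrite -[X in _ `<=` connected_component _ X](actK dg (SH _ Sp)); apply: sub.
  + exact: det1_inv.
  + exact: H3_image.
  + by exists p.
- by move=> q [C [_ CS _] Cq]; apply/(H3_image dg SH)/CS.
Qed.

Lemma image_act_setD g S S' : \det g = 1 -> S `<=` H3 -> S' `<=` H3 ->
  act g @` (S `\` S') = (act g @` S) `\` (act g @` S').
Proof.
move=> dg SH SH'; apply/seteqP; split=> [_ [p [Sp nSp] <-]|_ [[p Sp <-] nSp]].
  split; first by exists p.
  move=> [q Sq e]; apply: nSp.
  by rewrite -(actK dg (SH _ Sp)) -e (actK dg (SH' _ Sq)).
by exists p => //; split=> // Sp'; apply: nSp; exists p.
Qed.

Lemma complementary_component_act g S D : \det g = 1 -> S `<=` H3 ->
  complementary_component S D -> complementary_component (act g @` S) (act g @` D).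
Proof.
move=> dg SH [p Sp ->]; rewrite /complementary_component pleating_act//.
rewrite -image_act_setD//; last exact: pleating_H3.
exists (act g p); first by exists p.
by rewrite connected_component_act// => q [/SH].
Qed.

Lemma ideal_triangle_act g D : \det g = 1 -> ideal_triangle D -> ideal_triangle (act g @` D).
Proof.
move=> dg [u [v [w [uv vw wu ->]]]]; exists (mobius g u), (mobius g v), (mobius g w).
split; try by move=> /(mobius_inj dg).
rewrite image_act_setD//; [|exact: hull_H3|by move=> q [[|]|]; apply: geodesic_H3].
by rewrite !image_setU !geodesic_act// -hull_act// !image_setU !image_set1.
Qed.

Lemma maximal_pleating_act g S : \det g = 1 -> S `<=` H3 ->
  maximal_pleating S -> maximal_pleating (act g @` S).
Proof.
move=> dg SH mS D cD; have DH : D `<=` H3.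
  case: cD => p _ -> q [C [_ CS _] /CS[/(H3_image dg SH)]].
  by [].
have := complementary_component_act (det1_inv dg) (H3_image dg SH) cD.
rewrite act_imageK// => /mS/(ideal_triangle_act dg).
by rewrite act_imageVK.
Qed.

Lemma endpoints_act g (L I : set (Pt R)) : \det g = 1 -> L `<=` H3 -> I `<=` H3 ->
  endpoints (act g @` L) (act g @` I) = act g @` endpoints L I.
Proof.
have sub (f : 'M[Cplx R]_2) (L' I' : set (Pt R)) : \det f = 1 -> L' `<=` H3 -> I' `<=` H3 ->
    act f @` endpoints L' I' `<=` endpoints (act f @` L') (act f @` I').
  move=> df LH IH _ [p [[Lp cI] cLI] <-]; split; first split.
  - by exists p.
  - exact: closure_act df IH (LH _ Lp) cI.
  - rewrite -image_act_setD//; apply: closure_act df _ (LH _ Lp) cLI.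
    by move=> q [/LH].
move=> dg LH IH; apply: act_image_eq => //.
- by move=> p [[/LH]].
- exact: sub.
- rewrite -[X in _ `<=` endpoints X _](act_imageK dg LH) -[X in _ `<=` endpoints _ X](act_imageK dg IH).
  by apply: sub; [exact: det1_inv|exact: H3_image|exact: H3_image].
- by move=> _ [[[p Lp <-]]] _ _; apply: H3_act => //; apply: LH.
Qed.

End Topology.

(** * The limit set *)

Section LimitSet.
Context {R : realType}.
Implicit Types (g h : 'M[Cplx R]_2) (xi x y : Chat R) (p q : Pt R) (u v z w : Cplx R) (P X Y N : @herm R)
  (K : set (Chat R)) (S : set (Pt R)) (G : set 'M[Cplx R]_2).

(** The lift of the point at height 1 over 0; pairing with it gives the trace. *)
Definition herm1 : @herm R := Herm 1 0 0 1.
Notation nrm X := (hpair X herm1).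

Definition psd X := [/\ 0 <= h_al X, 0 <= h_ga X & 0 <= quad X].

(** Complete the square after multiplying by [h_ga X]. If [h_ga X] is 0, the determinant condition
    forces the off-diagonal entry to vanish. *)
Lemma hpair_rank1_ge0 X u v : psd X -> 0 <= hpair X (rank1 u v).
Proof.
move=> [a0 g0 q0]; have E : hpair X (rank1 u v) = h_al X * sqn v + h_ga X * sqn u -
   2 * (h_x X * complex.Re (u * conjc v) + h_y X * complex.Im (u * conjc v)) by [].
have E2 : h_ga X * hpair X (rank1 u v) = quad X * sqn v +
   sqn ((h_ga X)%:C * u - (h_x X +i* h_y X) * v).
  rewrite E /quad; case: X {a0 g0 q0 E} => [a x y c].
  by case: u v => [u u'] [v v']; rewrite /sqn /=; ring.
move: g0; rewrite le_eqVlt => /predU1P[c0|c0]; last first.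
  by rewrite -(pmulr_rge0 _ c0) E2 addr_ge0 ?mulr_ge0 ?sqn_ge0.
move: q0; rewrite /quad -c0 mulr0 => q0.
have xx : h_x X = 0 by apply/eqP; rewrite -sqrf_eq0; have := sqr_ge0 (h_x X); have := sqr_ge0 (h_y X); lra.
have yy : h_y X = 0 by apply/eqP; rewrite -sqrf_eq0; have := sqr_ge0 (h_x X); have := sqr_ge0 (h_y X); lra.
by rewrite E xx yy -c0 !mul0r !addr0 mulr0 subr0 mulr_ge0 ?sqn_ge0.
Qed.

Lemma herm1_rank1 : herm1 = lc 1 (rank1 1 0) 1 (rank1 0 1).
Proof. by apply: herm_eq; rewrite /= /sqn /=; ring. Qed.

Lemma nrmE X : nrm X = h_al X + h_ga X.
Proof. by rewrite /hpair /=; ring. Qed.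

(* The Loewner order on hermitian forms. *)
Definition hle X Y := forall u v, hpair X (rank1 u v) <= hpair Y (rank1 u v).

Lemma hle_psd X Y : psd (lc 1 Y (-1) X) -> hle X Y.
Proof. by move=> h u v; have := hpair_rank1_ge0 u v h; rewrite hpair_lcl; lra. Qed.

Lemma hle_hact g X Y : \det g = 1 -> hle X Y -> hle (hact g X) (hact g Y).
Proof.
move=> dg XY u v; have E Z : hpair (hact g Z) (rank1 u v) = hpair Z (hact g^-1 (rank1 u v)).
  by rewrite -[RHS](hpair_act1 _ _ dg) -hact_mul mulrV ?det1_unit// hact1.
by rewrite !E hact_rank1; apply: XY.
Qed.

Lemma hle_hpair g X Y : hle X Y -> hpair X (hact g herm1) <= hpair Y (hact g herm1).
Proof.
by move=> XY; rewrite herm1_rank1 hact_lc !hact_rank1 !hpair_lcr !mul1r lerD.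
Qed.

Lemma hle_nrm X Y : hle X Y -> nrm X <= nrm Y.
Proof. by move=> XY; have := hle_hpair 1 XY; rewrite hact1. Qed.

Lemma hle_lbd X Y xi : hle X Y -> hpair X (lbd xi) <= hpair Y (lbd xi).
Proof. by move=> XY; rewrite lbd_rank1; apply: XY. Qed.

Lemma psd_le_nrm X : psd X -> hle X (scal (nrm X) herm1).
Proof.
rewrite nrmE /psd /quad /= => -[a0 g0 q0]; apply: hle_psd.
split=> /=; [lra|lra|rewrite /quad /=; nra].
Qed.

(** The least eigenvalue of X is at least its determinant divided by its trace. *)
Lemma psd_ge X : psd X -> 0 < quad X -> hle herm1 (scal (nrm X / quad X) X).
Proof.
move=> [a0 g0 _] q0; rewrite nrmE; apply: hle_psd.
set k := _ / _.
have kq : k * quad X = h_al X + h_ga X by rewrite /k divfK// gt_eqF.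
have ag : quad X <= h_al X * h_ga X.
  by rewrite /quad; have := sqr_ge0 (h_x X); have := sqr_ge0 (h_y X); lra.
have k0 : 0 <= k by rewrite divr_ge0 ?(ltW q0) ?addr_ge0.
have a1 : 1 <= k * h_al X.
  rewrite -(ler_pM2r q0) mul1r mulrAC kq (le_trans ag)//; nra.
have g1 : 1 <= k * h_ga X.
  rewrite -(ler_pM2r q0) mul1r mulrAC kq (le_trans ag)//; nra.
split=> /=; [lra|lra|].
have -> : quad (lc 1 (scal k X) (-1) herm1) = k * (k * quad X) - k * (h_al X + h_ga X) + 1.
  by rewrite /quad /=; ring.
by rewrite kq; lra.
Qed.

(** The quotient of the two quantities does not depend on scale. For the lift of (w, t) and xi = z
    it is (|w - z|^2 + t^2) / (|w|^2 + t^2 + 1), so it is small exactly when the orbit of X comes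
    close to xi. *)
Definition near_base X G xi := forall e : R, 0 < e -> exists2 g, G g &
  hpair (hact g X) (lbd xi) < e * nrm (hact g X).

Lemma psd_hlift p : psd (hlift p).
Proof. by split; rewrite ?quad_hlift ?sqr_ge0//= addr_ge0 ?sqn_ge0 ?sqr_ge0. Qed.

Lemma psd_herm1 : psd herm1.
Proof. by split; rewrite /quad /=; lra. Qed.

Lemma psd_hact g X : \det g = 1 -> psd X -> psd (hact g X).
Proof.
move=> dg pX; have dV := det1_inv dg.
have E u v : hpair (hact g X) (rank1 u v) = hpair X (hact g^-1 (rank1 u v)).
  by rewrite -[RHS](hpair_act1 _ _ dg) -hact_mul mulrV ?det1_unit// hact1.
split; last by rewrite quad_hact//; case: pX.
  have -> : h_al (hact g X) = hpair (hact g X) (rank1 0 1).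
    by rewrite [RHS]/hpair /= /sqn /=; ring.
  by rewrite E hact_rank1; apply: hpair_rank1_ge0.
have -> : h_ga (hact g X) = hpair (hact g X) (rank1 1 0).
  by rewrite [RHS]/hpair /= /sqn /=; ring.
by rewrite E hact_rank1; apply: hpair_rank1_ge0.
Qed.

Lemma nrm_gt0 X : psd X -> 0 < quad X -> 0 < nrm X.
Proof.
move=> [a0 g0 _] q0; rewrite nrmE.
have : 0 < h_al X * h_ga X.
  by move: q0; rewrite /quad; have := sqr_ge0 (h_x X); have := sqr_ge0 (h_y X); lra.
by nra.
Qed.

(* Any two positive definite forms are comparable, so the base point does not matter. *)
Lemma near_base_le G xi X Y k l : (forall g, G g -> \det g = 1) -> 0 < k -> 0 < l ->
  hle X (scal k Y) -> hle Y (scal l X) -> near_base X G xi -> near_base Y G xi.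
Proof.
move=> G1 k0 l0 XY YX H e e0.
have [|g Gg h] := H (e / (k * l)); first by rewrite divr_gt0 ?mulr_gt0.
exists g => //; have dg := G1 _ Gg.
have := hle_lbd xi (hle_hact dg YX); rewrite hact_scal hpair_scall => h1.
have := hle_nrm (hle_hact dg XY); rewrite hact_scal hpair_scall => h2.
apply: le_lt_trans h1 _.
apply: (@lt_le_trans _ _ (l * (e / (k * l) * (k * nrm (hact g Y))))).
  rewrite ltr_pM2l//; apply: lt_le_trans h _.
  by rewrite ler_pM2l// divr_gt0 ?mulr_gt0.
by rewrite le_eqVlt; apply/orP; left; apply/eqP; field; rewrite !gt_eqF.
Qed.

Lemma near_baseP G xi X : (forall g, G g -> \det g = 1) -> psd X -> 0 < quad X ->
  near_base X G xi <-> near_base herm1 G xi.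
Proof.
move=> G1 pX qX; have n0 := nrm_gt0 pX qX; have m0 : 0 < nrm X / quad X by rewrite divr_gt0.
have h1 := psd_le_nrm pX; have h2 := psd_ge pX qX.
split; first exact: (near_base_le G1 n0 m0 h1 h2).
exact: (near_base_le G1 m0 n0 h2 h1).
Qed.

Lemma hpair_scalr k X Y : hpair Y (scal k X) = k * hpair Y X.
Proof. by rewrite /hpair /=; ring. Qed.

Lemma near_base_conj G xi g : (forall k, G k -> \det k = 1) -> \det g = 1 ->
  near_base herm1 G xi ->
  near_base herm1 [set g * k * g^-1 | k in G] (mobius g xi).
Proof.
move=> G1 dg H e e0; have dV := det1_inv dg.
have pJ := psd_hact dV psd_herm1; have pgJ := psd_hact dg psd_herm1.
have qJ : 0 < quad herm1 by rewrite /quad /=; lra.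
have [m m0 em] := mobius_lbd xi dg.
have c0 : 0 < nrm (hact g herm1) by rewrite nrm_gt0// quad_hact.
have H' : near_base (hact g^-1 herm1) G xi by apply/near_baseP => //; rewrite quad_hact.
(* The factor m is the rescaling of [lbd xi] under g; the trace of [hact g herm1] bounds the change
   of the trace under conjugation, in the inequality [a <= c * b] below. *)
have [|k Gk hk] := H' (e * m / nrm (hact g herm1)); first by rewrite divr_gt0// mulr_gt0.
exists (g * k * g^-1); first by exists k.
rewrite -(ltr_pM2l m0).
have -> : m * hpair (hact (g * k * g^-1) herm1) (lbd (mobius g xi)) =
    hpair (hact k (hact g^-1 herm1)) (lbd xi).
  by rewrite -[RHS](hpair_act1 _ _ dg) em hpair_scalr -!hact_mul.
apply: lt_le_trans hk _.
rewrite -(hpair_act1 (hact k _) _ dg) -!hact_mul.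
set c := nrm (hact g herm1) in c0 *; set a := hpair _ (hact g herm1); set b := nrm (hact (g * k * g^-1) _).
have h : a <= c * b.
  rewrite /a hpairC; apply: le_trans (hle_hpair _ (psd_le_nrm pgJ)) _.
  by rewrite hpair_scall [hpair herm1 _]hpairC.
have em0 : 0 < e * m by rewrite mulr_gt0.
rewrite mulrAC ler_pdivrMr//; nra.
Qed.

End LimitSet.
Notation nrm X := (hpair X herm1).

Section LimitSetTopology.
Context {R : realType}.
Implicit Types (g h : 'M[Cplx R]_2) (xi x y : Chat R) (p q : Pt R) (u v z w : Cplx R) (P X Y N : @herm R)
  (K : set (Chat R)) (S : set (Pt R)) (G : set 'M[Cplx R]_2).

Lemma hpair_hlift_cvg p X : (fun q => hpair (hlift q) X) @ p --> hpair (hlift p) X.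
Proof.
have [c1 c2 c3 c4] := hcvg_hlift p.
have k1 (r : R) : (fun=> r : R) @ p --> r by apply: cvg_cst.
exact: (cvgB (cvgD (cvgM c1 (k1 _)) (cvgM c4 (k1 _))) (cvgM (k1 2) (cvgD (cvgM c2 (k1 _)) (cvgM c3 (k1 _))))).
Qed.

Lemma hpair_hlift_lbd p z : hpair (hlift p) (lbd (Some z)) = sqn (p.1 - z) + p.2 ^+ 2.
Proof. by case: p z => [[a b] t] [c d]; rewrite /hpair /= /sqn /=; ring. Qed.

Lemma nrm_hlift p : nrm (hlift p) = sqn p.1 + p.2 ^+ 2 + 1.
Proof. by rewrite nrmE. Qed.

Lemma compact_ball3 (r : R) : compact [set q : Pt R | sqn q.1 + q.2 ^+ 2 <= r].
Proof.
pose f (t : R * R * R) : Pt R := ((t.1.1 +i* t.1.2 : Cplx R), t.2).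
have cf : continuous f.
  move=> t; apply: cvg_Pt; last exact: cvg_snd.
  apply: complex_cvg.
    by apply: (cvg_comp (fun t => t.1)); [exact: cvg_fst|exact: cvg_fst].
  by apply: (cvg_comp (fun t => t.1)); [exact: cvg_fst|exact: cvg_snd].
pose s := Num.sqrt r.
pose box := (`[(- s), s] `*` `[(- s), s]) `*` `[(- s), s] : set (R * R * R).
have cbox : compact (f @` box).
  apply: continuous_compact; first exact: continuous_subspaceT.
  by apply: compact_setX; [apply: compact_setX|]; apply: segment_compact.
apply: subclosed_compact cbox _.
  apply: (@closed_comp _ _ (fun q : Pt R => sqn q.1 + q.2 ^+ 2) [set t | t <= r]).
    move=> q _; have [c _ _ _] := hcvg_hlift q; exact: c.
  exact: closed_le.
move=> [[a b] t] /= H; exists ((a, b), t) => //.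
have r0 : 0 <= r by apply: le_trans H; rewrite addr_ge0 ?sqn_ge0 ?sqr_ge0.
have le (c : R) : c ^+ 2 <= r -> `[(- s), s]%classic c.
  move=> h; rewrite /= in_itv /= -ler_norml -sqrtr_sqr ler_sqrt//.
have := sqr_ge0 a; have := sqr_ge0 b; have := sqr_ge0 t; move: H; rewrite /sqn /= => *.
by split; [split|]; apply: le => /=; lra.
Qed.

Lemma compact_bound (W : set (Pt R)) : compact W ->
  exists2 M : R, 0 < M & forall q, W q -> sqn q.1 + q.2 ^+ 2 <= M.
Proof.
move=> cW; have [[q0 W0]|W0] := pselect (W !=set0); last first.
  by exists 1 => // q Wq; case: W0; exists q.
have := @compact_EVT_max _ _ (fun q : Pt R => sqn q.1 + q.2 ^+ 2) W (ex_intro _ _ W0) cW.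
case.
  apply: continuous_subspaceT => q; have [c _ _ _] := hcvg_hlift q; exact: c.
move=> c _ H; exists (sqn c.1 + c.2 ^+ 2 + 1).
  by rewrite ltr_wpDl// addr_ge0 ?sqn_ge0 ?sqr_ge0.
by move=> q Wq; rewrite ler_wpDr// H ?inE.
Qed.

(** Together with [nbhs_limit_set]: on points of the space, neighbourhoods of xi amount to bounds on
    the quotient of [near_base], for finite xi and for infinity alike. *)
Lemma limit_set_nbhs xi (e : R) : 0 < e ->
  nbhs (to_boundary xi) [set o : one_point_compactification (Pt R) |
    if o is Some q then hpair (hlift q) (lbd xi) < e * nrm (hlift q) else True].
Proof.
move=> e0; case: xi => [z|].
  rewrite /nbhs /= /fmap /=.
  pose q0 : Pt R := (z, 0).
  pose f (q : Pt R) := e * nrm (hlift q) - hpair (hlift q) (lbd (Some z)).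
  have cf : f @ q0 --> f q0.
    have c1 : (fun q => e * nrm (hlift q)) @ q0 --> e * nrm (hlift q0).
      by apply: cvgM; [exact: cvg_cst|exact: hpair_hlift_cvg].
    by rewrite /f; apply: cvgB => //; exact: hpair_hlift_cvg.
  have pos : 0 < f q0.
    rewrite /f nrm_hlift hpair_hlift_lbd /= subrr sqn0 !expr0n /= !addr0 subr0 mulr_gt0//.
    by rewrite ltr_wpDl ?sqn_ge0.
  have nf : nbhs q0 [set q | 0 < f q] by move/cvgr_gt: cf => /(_ _ pos).
  by apply: filterS nf => q /=; rewrite /f subr_gt0.
exists [set q : Pt R | sqn q.1 + q.2 ^+ 2 <= e^-1].
  split; first exact: compact_ball3.
  apply: (@closed_comp _ _ (fun q : Pt R => sqn q.1 + q.2 ^+ 2) [set t | t <= e^-1]).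
    move=> q _; have [c _ _ _] := hcvg_hlift q; exact: c.
  exact: closed_le.
move=> _ [[q /= /negP + <-]|->] //; rewrite -ltNge => H.
rewrite nrm_hlift; have -> : hpair (hlift q) (Herm 1 0 0 0) = 1 by rewrite /hpair /=; ring.
rewrite -ltr_pdivrMl// mulr1 (lt_trans H)// ltrDl ltr01//.
Qed.

Lemma sqn_le2 w z : sqn w <= 2 * sqn (w - z) + 2 * sqn z.
Proof.
case: w z => [a b] [c d]; rewrite -subr_ge0 /sqn /=.
rewrite (_ : _ - _ = (a - 2 * c) ^+ 2 + (b - 2 * d) ^+ 2); last by ring.
by rewrite addr_ge0 ?sqr_ge0.
Qed.

Lemma nbhs_limit_set xi (V : set (one_point_compactification (Pt R))) :
  nbhs (to_boundary xi) V -> exists2 e : R, 0 < e &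
  forall q, hpair (hlift q) (lbd xi) < e * nrm (hlift q) -> V (Some q).
Proof.
case: xi => [z|]; rewrite /nbhs /=.
  rewrite /fmap /= => -[[U W] /= [nU nW] UW].
  have [e1 e10 He1] := (nbhs_sqn z U).1 nU.
  have [e2 /= e20 He2] := (nbhs_ballP (0 : R) W).1 nW.
  pose eta := Num.min e1 (e2 ^+ 2).
  have eta0 : 0 < eta by rewrite lt_min e10 exprn_gt0.
  have D : 0 < 2 * (2 * sqn z + 1) by have := sqn_ge0 z; lra.
  (* By [sqn_le2] the trace is at most 2 (|w - z|^2 + t^2) + 2 |z|^2 + 1. The bound 1/4 absorbs the
     first summand into the left-hand side at the cost of a factor 2, and the other bound makes what
     remains at most eta. *)
  pose e := Num.min (1/4) (eta / (2 * (2 * sqn z + 1))).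
  have e0 : 0 < e by rewrite lt_min divr_gt0 ?divr_gt0.
  exists e => // -[w t]; rewrite hpair_hlift_lbd nrm_hlift /= => H.
  have ew : sqn w <= 2 * sqn (w - z) + 2 * sqn z.
    exact: sqn_le2.
  have e4 : e <= 1/4 by rewrite /e ge_min lexx.
  have ee : e * (2 * (2 * sqn z + 1)) <= eta by rewrite -ler_pdivlMr// /e ge_min lexx orbT.
  have h : sqn (w - z) + t ^+ 2 < eta.
    have := sqn_ge0 (w - z); have := sqr_ge0 t; have := sqn_ge0 z.
    move: (sqn (w - z)) (t ^+ 2) (sqn w) (sqn z) ew H ee => a b c d ew H ee d0 b0 a0.
    have : a + b < e * (2 * (a + b) + (2 * d + 1)).
      by apply: lt_le_trans H _; rewrite ler_pM2l//; lra.
    nra.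
  have [h1 h2] : eta <= e1 /\ eta <= e2 ^+ 2 by rewrite /eta !ge_min !lexx orbT.
  apply: (UW (w, t)); split=> /=.
    by apply: He1; have := sqr_ge0 t; lra.
  apply: He2; rewrite -ball_normE /= sub0r normrN.
  rewrite -[ltRHS]ger0_norm ?ltW// -ltr_sqr ?nnegrE// !real_normK ?num_real//.
  by have := sqn_ge0 (w - z); lra.
move=> [W [cW _] WV]; have [M M0 HM] := compact_bound cW.
exists (M + 1)^-1; first by rewrite invr_gt0 addr_gt0.
move=> q; have -> : hpair (hlift q) (Herm 1 0 0 0) = 1 by rewrite /hpair /=; ring.
rewrite nrm_hlift ltr_pdivlMl ?addr_gt0// mulr1 ltrD2r => H.
by apply: WV; left; exists q => //= /HM; rewrite leNgt H.
Qed.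

Lemma limit_setE G xi : (forall g, G g -> \det g = 1) ->
  limit_set G xi <-> near_base herm1 G xi.
Proof.
move=> G1; have base p : H3 p -> near_base (hlift p) G xi <-> near_base herm1 G xi.
  by move=> p0; apply: near_baseP G1 (psd_hlift p) _; rewrite quad_hlift exprn_gt0.
have E g p (e : R) : G g -> H3 p ->
  (hpair (hact g (hlift p)) (lbd xi) < e * nrm (hact g (hlift p))) =
  (hpair (hlift (act g p)) (lbd xi) < e * nrm (hlift (act g p))).
  move=> Gg p0; have [k k0 ->] := act_hlift (G1 _ Gg) p0.
  by rewrite !hpair_scall mulrCA ltr_pM2l.
split=> [[p p0 clp]|H].
  apply/(base p p0) => e e0; have [_ [[g Gg <-] h]] := clp _ (limit_set_nbhs xi e0).
  by exists g => //; rewrite E.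
pose p : Pt R := (0, 1); have p0 : H3 p by rewrite /H3 /=.
exists p => // V /nbhs_limit_set[e e0 He].
have [g Gg h] := (base p p0).2 H e e0.
exists (Some (act g p)); split; first by exists g.
by apply: He; rewrite -E.
Qed.

(** For a form X of determinant 1, [h_ga X] times its pairing with z is 1 plus the squared distance
    of [h_ga X] z from the off-diagonal entry; [sqn_le2] then compares the pairings at z and at a
    nearby w. *)
Lemma limit_set_closed G (z : Cplx R) : (forall g, G g -> \det g = 1) ->
  (forall e : R, 0 < e -> exists2 w, limit_set G (Some w) & sqn (z - w) < e) -> limit_set G (Some z).
Proof.
move=> G1 H; apply/limit_setE => // e e0.
have [w /(limit_setE _ G1) Kw zw] := H (e / 4) (divr_gt0 e0 (ltr0n _ 4)).
have [g Gg h] := Kw (e / 4) (divr_gt0 e0 (ltr0n _ 4)).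
exists g => //.
have [a0 g0 _] := psd_hact (G1 _ Gg) (@psd_herm1 R).
have q1 : quad (hact g herm1) = 1 by rewrite quad_hact ?G1// /quad /=; ring.
move: h; rewrite nrmE; move: (hact g herm1) a0 g0 q1 => X a0 g0 q1 h.
suff : hpair X (lbd (Some z)) <= 2 * hpair X (lbd (Some w)) + 2 * h_ga X * sqn (z - w).
  have : h_ga X * sqn (z - w) <= h_ga X * (e / 4) by rewrite ler_wpM2l// ltW.
  nra.
have qX : h_al X * h_ga X = 1 + h_x X ^+ 2 + h_y X ^+ 2 by rewrite -q1 /quad; ring.
have gX : 0 < h_ga X.
  rewrite lt_def g0 andbT; apply/eqP => gX; move: qX; rewrite gX mulr0.
  by have := sqr_ge0 (h_x X); have := sqr_ge0 (h_y X); lra.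
have E c : h_ga X * hpair X (lbd (Some c)) = 1 + sqn ((h_ga X)%:C * c - (h_x X +i* h_y X)).
  transitivity (h_al X * h_ga X + h_ga X ^+ 2 * sqn c -
    2 * h_ga X * (h_x X * complex.Re c + h_y X * complex.Im c)).
    by rewrite /hpair /=; ring.
  by rewrite qX; case: c => [c d]; rewrite /sqn /=; ring.
rewrite -(ler_pM2l gX) E.
have -> : h_ga X * (2 * hpair X (lbd (Some w)) + 2 * h_ga X * sqn (z - w)) =
  2 * (h_ga X * hpair X (lbd (Some w))) + 2 * h_ga X ^+ 2 * sqn (z - w) by ring.
rewrite E.
have := sqn_le2 ((h_ga X)%:C * z - (h_x X +i* h_y X)) ((h_ga X)%:C * w - (h_x X +i* h_y X)).
rewrite opprB addrA subrK -mulrBr sqnM.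
have -> : sqn ((h_ga X)%:C : Cplx R) = h_ga X ^+ 2 by rewrite /sqn /=; ring.
nra.
Qed.

End LimitSetTopology.

(** * Hulls invariant under a half-turn *)

Section AxialSymmetry.
Context {R : realType}.
Implicit Types (g h : 'M[Cplx R]_2) (xi x y : Chat R) (p q : Pt R) (u v z w : Cplx R) (P X Y N : @herm R)
  (K : set (Chat R)) (S : set (Pt R)).

Definition copp xi : Chat R := if xi is Some z then Some (- z) else None.
Definition hopp X : @herm R := Herm (h_al X) (- h_x X) (- h_y X) (h_ga X).

Lemma lbd_copp xi : lbd (copp xi) = hopp (lbd xi).
Proof. by case: xi => [[a b]|]; apply: herm_eq; rewrite /= ?/sqn /=; ring. Qed.

(** On lifts, zero on the hemisphere |z|^2 + t^2 = T, positive outside and negative inside. *)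
Definition sphere (T : R) X : R := h_al X - T * h_ga X.

Lemma geodesic_pt x y (l m : R) : x <> y -> 0 < l -> 0 < m ->
  [/\ 0 < h_ga (lc l (lbd x) m (lbd y)), 0 < quad (lc l (lbd x) m (lbd y)) &
   geodesic x y (pt (lc l (lbd x) m (lbd y)))].
Proof.
move=> xy l0 m0; have q0 : 0 < quad (lc l (lbd x) m (lbd y)).
  by rewrite quad_lc_lbd !mulr_gt0// hpair_lbd_gt0.
have g0 : 0 < h_ga (lc l (lbd x) m (lbd y)).
  by case: x y xy {q0} => [z|] [w|] //= _; rewrite ?mulr1 ?mulr0; lra.
split=> //; apply/geodesicE; split; first exact: H3_pt.
rewrite hlift_pt ?ltW//; move: (h_ga (lc _ _ _ _)) => k.
by exists (k^-1 * l), (k^-1 * m); apply: herm_eq => /=; ring.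
Qed.

Lemma pt_hlift p : H3 p -> pt (hlift p) = p.
Proof.
move=> p0; apply: (@scal_hlift_inj _ _ _ 1 1) => //.
  by apply: H3_pt => //=; rewrite quad_hlift exprn_gt0.
by rewrite hlift_pt ?quad_hlift ?sqr_ge0//= invr1 !scal1.
Qed.

Lemma nbhs0_bound (A : set R) : nbhs (0 : R) A ->
  exists2 d : R, 0 < d <= 1 & forall e, `|e| < d -> A e.
Proof.
move=> /nbhs_ballP[d /= d0 H]; exists (Num.min d 1).
  by rewrite lt_min d0 ltr01 /= ge_min lexx orbT.
move=> e; rewrite lt_min => /andP[ed _]; apply: H.
by rewrite -ball_normE /= sub0r normrN.
Qed.

(** Moving along the geodesic multiplies the coefficients by 1 + e and 1 - e, up to scale. Hence an
    arc around p yields a segment of the cone on both sides of p, in the direction l x - m y. *)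
Lemma arc_in_cone K S p x y (l m : R) : S `<=` hull K -> arc_through S p x y ->
  0 < l -> 0 < m -> hlift p = lc l (lbd x) m (lbd y) ->
  exists2 d : R, 0 < d & forall e : R, `|e| < d ->
    in_cone K (lc 1 (hlift p) e (lc l (lbd x) (- m) (lbd y))).
Proof.
move=> SK [xyp [U nU US]] l0 m0 ep; have [xy p0 _] := geodesic_coefs xyp.
pose f (e : R) := lc (l * (1 + e)) (lbd x) (m * (1 - e)) (lbd y).
have f0 : f 0 = hlift p by rewrite /f addr0 subr0 !mulr1 ep.
have cf : (fun e => pt (f e)) @ (0 : R) --> pt (f 0).
  apply: hcvg_pt; first by rewrite f0 /= oner_eq0.
  apply: hcvg_lc; try exact: hcvg_cst.
    by apply: cvgM; [exact: cvg_cst|apply: cvgD; [exact: cvg_cst|exact: cvg_id]].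
  by apply: cvgM; [exact: cvg_cst|apply: cvgB; [exact: cvg_cst|exact: cvg_id]].
have nU' : nbhs (0 : R) [set e | U (pt (f e))].
  by apply: cf; rewrite f0 pt_hlift.
have [d /andP[d0 d1] Hd] := nbhs0_bound nU'.
exists d => // e ed; have := Hd _ ed; move: ed; rewrite ltr_norml => /andP[e1 e2] /= Ue.
have l'0 : 0 < l * (1 + e) by rewrite mulr_gt0//; lra.
have m'0 : 0 < m * (1 - e) by rewrite mulr_gt0//; lra.
have [g0 q0 ge] := geodesic_pt xy l'0 m'0.
have /SK/hullE[_] := US _ (conj ge Ue).
rewrite hlift_pt ?ltW// => /in_cone_scal; rewrite invr_gt0 => /(_ g0).
by congr in_cone; rewrite ep; apply: herm_eq => /=; ring.
Qed.

Section SymmetricHull.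
Context (K : set (Chat R)) (Kopp : forall xi, K xi -> K (copp xi))
  (Kclosed : forall z, (forall e : R, 0 < e -> exists2 w, K (Some w) & sqn (z - w) < e) -> K (Some z)).

Let C := hull K.
Let L := @geodesic R (Some 0) None.

Lemma in_cone_opp X : in_cone K X -> in_cone K (hopp X).
Proof.
move=> H h /support_planeE[[xi Kxi e] H'].
have [N N0 hN] := herm_of_plane h.
have [|h' hh'] := @plane_of_herm _ (hopp N); first by move: N0; rewrite /quad /= !sqrrN.
have E Y : ev h' Y = ev h (hopp Y) by rewrite hh' hN /hpair /=; ring.
have copK eta : copp (copp eta) = eta by case: eta => //= z; rewrite opprK.
rewrite -E; apply/H/support_planeE; split.
  by exists (copp xi); [exact: Kopp|rewrite E -lbd_copp copK].
by move=> eta /Kopp Ke; rewrite E -lbd_copp; apply: H'.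
Qed.

(** Adding the inequalities at xi and at - xi cancels the term in [pl_b h]. *)
Lemma support_axial (h : @hplane R) : support_plane K h ->
  forall xi, K xi -> pl_a h * h_al (lbd xi) + pl_c h * h_ga (lbd xi) <= 0.
Proof.
move=> /support_planeE[_ H] xi Kxi; have := H _ Kxi; have := H _ (Kopp Kxi).
by rewrite lbd_copp /ev /=; lra.
Qed.

Lemma in_cone_axis (t : R) : in_cone K (Herm t 0 0 1) <->
  forall h : @hplane R, support_plane K h -> pl_a h * t + pl_c h <= 0.
Proof.
have E (h : @hplane R) : ev h (Herm t 0 0 1) = pl_a h * t + pl_c h by rewrite /ev /=; ring.
by split=> H h /H; rewrite E.
Qed.

(** A positive combination of the pairs ([h_al], [h_ga]) of xi and eta is proportional to (t, 1); it
    carries the inequalities of [support_axial] over to the point of the axis. *)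
Lemma in_cone_between (t : R) xi eta : K xi -> K eta -> sphere t (lbd xi) < 0 ->
  0 < sphere t (lbd eta) -> in_cone K (Herm t 0 0 1).
Proof.
move=> Kxi Keta s1 s2; apply/in_cone_axis => h sh.
have h1 := support_axial sh Kxi; have h2 := support_axial sh Keta.
have a1 : 0 <= h_al (lbd xi) by case: (xi) => [z|] //=; apply: sqn_ge0.
have c1 := ga_lbd xi; have c2 := ga_lbd eta.
move: (pl_a h) (pl_c h) h1 h2 s1 s2 a1 c1 c2; rewrite /sphere => {sh h} a c.
move: (h_al (lbd xi)) (h_ga (lbd xi)) (h_al (lbd eta)) (h_ga (lbd eta)) => al1 ga1 al2 ga2 h1 h2 s1 s2 a1 c1 c2.
have g1 : 0 < t * ga1 by lra.
have g2 : 0 < ga1 by rewrite lt_def c1 andbT; apply/eqP => g; move: g1; rewrite g mulr0 ltxx.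
have N : 0 < (al2 - t * ga2) * ga1 + (t * ga1 - al1) * ga2.
  by rewrite ltr_pwDl ?mulr_gt0// mulr_ge0//; lra.
rewrite -(pmulr_lle0 _ N).
have -> : (a * t + c) * ((al2 - t * ga2) * ga1 + (t * ga1 - al1) * ga2) =
  (al2 - t * ga2) * (a * al1 + c * ga1) + (t * ga1 - al1) * (a * al2 + c * ga2) by ring.
rewrite -oppr_ge0 opprD -!mulrN addr_ge0// mulr_ge0//; lra.
Qed.

Lemma hull_axis q : L q -> C q <-> in_cone K (Herm (q.2 ^+ 2) 0 0 1).
Proof.
move=> [q0 q1]; have E : hlift q = Herm (q.2 ^+ 2) 0 0 1.
  by rewrite /hlift q1 sqn0 add0r.
by rewrite -E; split=> [/hullE[]|H]//; apply/hullE.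
Qed.

Lemma cont_sphere q X : (fun q : Pt R => sphere (q.2 ^+ 2) X) @ q --> sphere (q.2 ^+ 2) X.
Proof.
have c2 : (fun q : Pt R => q.2) @ q --> q.2 by exact: cvg_snd.
apply: cvgB; first exact: cvg_cst.
by apply: cvgM; [exact: (cvgM c2 c2)|exact: cvg_cst].
Qed.

(** If K had points strictly on both sides, [in_cone_between] would put all points of L near Q into
    the hull, and Q would not be an endpoint. *)
Lemma endpoint_one_sided Q : endpoints L (L `&` C) Q ->
  (forall xi, K xi -> sphere (Q.2 ^+ 2) (lbd xi) <= 0) \/
  (forall xi, K xi -> 0 <= sphere (Q.2 ^+ 2) (lbd xi)).
Proof.
move=> [[LQ _] cl]; apply: contrapT => /not_orP[].
move=> /existsNP[eta /not_implyP[Keta /negP]]; rewrite -ltNge => s2.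
move=> /existsNP[xi /not_implyP[Kxi /negP]]; rewrite -ltNge => s1.
have c1 := @cont_sphere Q (lbd xi); have c2 := @cont_sphere Q (lbd eta).
have n1 : nbhs Q [set q | sphere (q.2 ^+ 2) (lbd xi) < 0] by move/cvgr_lt: c1 => /(_ _ s1).
have n2 : nbhs Q [set q | 0 < sphere (q.2 ^+ 2) (lbd eta)] by move/cvgr_gt: c2 => /(_ _ s2).
have [q [[Lq nI] [h1 h2]]] := cl _ (filterI n1 n2).
apply: nI; split=> //; apply/(hull_axis Lq).
exact: in_cone_between Kxi Keta h1 h2.
Qed.

Lemma compact_disk (r : R) : compact [set z : Cplx R | sqn z <= r].
Proof.
have -> : [set z : Cplx R | sqn z <= r] = fst @` [set q : Pt R | sqn q.1 + q.2 ^+ 2 <= r].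
  apply/seteqP; split=> [z /= zr|_ [q /= qr <-]].
    by exists (z, 0) => //=; rewrite expr0n /= addr0.
  by apply: le_trans qr; rewrite lerDl sqr_ge0.
apply: continuous_compact; last exact: compact_ball3.
by apply: continuous_subspaceT => q; apply: cvg_fst.
Qed.

Lemma closed_finite_part : closed [set z | K (Some z)].
Proof.
move=> z cz; apply: Kclosed => e e0.
have nz : nbhs z [set w | sqn (w - z) < e] by apply/nbhs_sqn; exists e.
have [w [Kw /= wz]] := cz _ nz.
by exists w => //; rewrite -sqnN opprB.
Qed.

Lemma sqn_continuous : continuous (@sqn R).
Proof.
move=> z; have c1 := @Re_continuous R z; have c2 := @Im_continuous R z.
exact: (cvgD (cvgM c1 c1) (cvgM c2 c2)).
Qed.

Lemma finite_part_min : (exists z, K (Some z)) ->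
  exists2 X, K (Some X) & forall z, K (Some z) -> sqn X <= sqn z.
Proof.
move=> [z0 Kz0].
pose A := [set z | sqn z <= sqn z0] `&` [set z | K (Some z)].
have cA : compact A by apply: compact_closedI; [exact: compact_disk|exact: closed_finite_part].
have A0 : A !=set0 by exists z0; split=> //=.
have cs : {within A, continuous (@sqn R)} by apply: continuous_subspaceT; exact: sqn_continuous.
have [X] := compact_EVT_min A0 cA cs; rewrite inE => -[_ KX] H.
exists X => // z Kz; have [zz|zz] := leP (sqn z) (sqn z0).
  by apply: H; rewrite inE.
by apply: le_trans (H z0 _) (ltW zz); rewrite inE; split=> /=.
Qed.

Lemma finite_part_max (r : R) : (exists z, K (Some z)) -> (forall z, K (Some z) -> sqn z <= r) ->
  exists2 X, K (Some X) & forall z, K (Some z) -> sqn z <= sqn X.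
Proof.
move=> [z0 Kz0] Hr.
pose A := [set z | sqn z <= r] `&` [set z | K (Some z)].
have cA : compact A by apply: compact_closedI; [exact: compact_disk|exact: closed_finite_part].
have A0 : A !=set0 by exists z0; split=> //=; exact: Hr.
have cs : {within A, continuous (@sqn R)} by apply: continuous_subspaceT; exact: sqn_continuous.
have [X] := compact_EVT_max A0 cA cs; rewrite inE => -[_ KX] H.
by exists X => // z Kz; apply: H; rewrite inE; split=> //=; exact: Hr.
Qed.

End SymmetricHull.
End AxialSymmetry.

(** * Support hemispheres at the endpoints *)

Section SymmetricHullFrontier.
Context {R : realType}.
Implicit Types (xi x y : Chat R) (p q : Pt R) (u v z w : Cplx R) (P X Y N : @herm R)
  (S : set (Pt R)).
Context (K : set (Chat R)) (Kopp : forall xi, K xi -> K (copp xi))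
  (Kclosed : forall z, (forall e : R, 0 < e -> exists2 w, K (Some w) & sqn (z - w) < e) -> K (Some z)).

Let C := hull K.
Let L := @geodesic R (Some 0) None.
Let S := frontier C.

Lemma ev_sphere (h : @hplane R) (s T : R) : pl_a h = s -> pl_b h = 0 -> pl_c h = - (s * T) ->
  forall X, ev h X = s * sphere T X.
Proof. by move=> h1 h2 h3 X; rewrite /ev h1 h2 h3 /sphere /=; ring. Qed.

(** The sign of s is the coorientation: positive when K lies inside the hemisphere, negative when K
    lies outside. *)
Lemma sphere_plane (s T : R) : 0 < T -> s != 0 ->
  exists h : @hplane R, forall X, ev h X = s * sphere T X.
Proof.
move=> T0 s0; have H : s * (- (s * T)) < sqn (0 : Cplx R).
  rewrite sqn0 mulrN oppr_lt0 mulrA -expr2 mulr_gt0// lt_def sqr_ge0 sqrf_eq0 s0//.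
by exists (HPlane H); apply: ev_sphere.
Qed.

Lemma in_cone_sphere (s T : R) z : 0 < T -> s != 0 -> K (Some z) -> sqn z = T ->
  (forall xi, K xi -> s * sphere T (lbd xi) <= 0) ->
  forall X, in_cone K X -> s * sphere T X <= 0.
Proof.
move=> T0 s0 Kz zT H X; have [h hE] := sphere_plane T0 s0.
move=> /(_ h); rewrite hE; apply; apply/support_planeE; split.
  by exists (Some z) => //; rewrite hE /sphere /= zT mulr1 subrr mulr0.
by move=> xi /H; rewrite hE.
Qed.

(** K lies on one side of the hemisphere through Q; take z in K of extreme modulus on that side. If
    |z| differed from the height of Q, the hemisphere of radius |z| would be a support plane cutting
    Q off from the hull. When K is a single end of L this hemisphere degenerates and another plane
    does the same. *)
Lemma endpoint_extremal Q : endpoints L (L `&` C) Q ->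
  exists z s, [/\ K (Some z), sqn z = Q.2 ^+ 2, s != 0 &
    forall X, in_cone K X -> s * sphere (Q.2 ^+ 2) X <= 0].
Proof.
move=> eQ; have [[LQ cI] cLI] := eQ; have [Q0 Q1] := LQ.
pose T := Q.2 ^+ 2; have T0 : 0 < T by rewrite exprn_gt0.
have CQ : in_cone K (Herm T 0 0 1).
  move=> h sh; rewrite leNgt; apply/negP => hQ.
  have E : ev h (Herm T 0 0 1) = ev h (hlift Q) by rewrite /hlift Q1 sqn0 add0r.
  have c := @hpair_hlift_cvg R Q.
  have [N N0 hN] := herm_of_plane h.
  have nU : nbhs Q [set q | 0 < ev h (hlift q)].
    have {}c := c N; move/cvgr_gt: c => /(_ 0); rewrite hpairC -hN -E => /(_ hQ).
    by apply: filterS => q /=; rewrite hN hpairC.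
  have [q [[_ /hullE[_ /(_ h sh) H]] /=]] := cI _ nU.
  by rewrite ltNge H.
(* The empty set has no support plane, so its hull is the whole space and L would have no
   endpoint. *)
have Kne : exists xi, K xi.
  apply: contrapT => K0.
  have [q [[[q0 q1]] nI] _] := cLI _ (filterT : nbhs Q setT).
  apply: nI; split; [by split|apply/hullE; split => // h /support_planeE[[xi Kxi _] _]].
  by case: K0; exists xi.
have planeQ (h : @hplane R) : support_plane K h -> pl_a h * T + pl_c h <= 0.
  by move=> sh; apply: ((in_cone_axis K T).1 CQ).
case: (endpoint_one_sided Kopp eQ) => H.
- have fin xi : K xi -> exists2 z, xi = Some z & sqn z <= T.
    case: xi => [z|] /H; rewrite /sphere /= ?mulr1 ?mulr0 => h; last by move: h; lra.
    by exists z => //; rewrite -subr_le0.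
  have [z Kz zmax] : exists2 z, K (Some z) & forall w, K (Some w) -> sqn w <= sqn z.
    apply: (finite_part_max Kclosed (r := T)).
      by case: Kne => xi Kxi; have [z e _] := fin _ Kxi; exists z; rewrite -e.
    by move=> w Kw; have [_ [<-]] := fin _ Kw.
  have H' M : sqn z = M -> forall xi, K xi -> 1 * sphere M (lbd xi) <= 0.
    move=> <- xi Kxi; have [w e _] := fin _ Kxi.
    by rewrite e mul1r /sphere /= mulr1 subr_le0 zmax// -e.
  have zT : sqn z = T.
    apply/eqP; rewrite eq_le; have [_ [<-] ->] := fin _ Kz; rewrite /= leNgt.
    apply/negP => zT; have [z0|z0] := eqVneq z 0.
      (* Here K is reduced to 0: the hemisphere |p - 1| = 1 touches it and leaves the whole axis
         outside. *)
      have h0 : 1 * 0 < sqn (-1 : Cplx R) by rewrite /sqn /=; lra.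
      suff /planeQ : support_plane K (HPlane h0) by rewrite /=; lra.
      apply/support_planeE; split; first by exists (Some z) => //; rewrite z0 /ev /= sqn0; ring.
      move=> xi Kxi; have [w e _] := fin _ Kxi.
      have : sqn w <= sqn z by apply: zmax; rewrite -e.
      rewrite e z0 sqn0 => w0; have /eqP : sqn w = 0 by apply/eqP; rewrite eq_le w0 sqn_ge0.
      by rewrite sqn_eq0 => /eqP ->; rewrite /ev /= sqn0; lra.
    have zp : 0 < sqn z by rewrite sqn_gt0.
    have := in_cone_sphere zp (oner_neq0 R) Kz erefl (H' _ erefl) CQ.
    by rewrite /sphere /=; lra.
  exists z, 1; split=> //.
  exact: in_cone_sphere T0 (oner_neq0 R) Kz zT (H' _ zT).
- have n1 : -1 != 0 :> R by rewrite oppr_eq0 oner_neq0.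
  have [Kfin|Kinf] := pselect (exists z, K (Some z)); last first.
    (* Here K is reduced to infinity: the vertical plane 2 Re z + 1 = 0 has infinity on its horizon
       and the axis on its positive side. *)
    have h0 : 0 * 1 < sqn (1 : Cplx R) by rewrite /sqn /=; lra.
    suff /planeQ : support_plane K (HPlane h0) by rewrite /=; lra.
    have KN xi : K xi -> xi = None.
      by case: xi => // z Kz; case: Kinf; exists z.
    apply/support_planeE; split; last by move=> xi /KN ->; rewrite /ev /=; lra.
    by case: Kne => xi Kxi; exists xi => //; rewrite (KN _ Kxi) /ev /=; ring.
  have [z Kz zmin] := finite_part_min Kclosed Kfin.
  have H' M : sqn z = M -> forall xi, K xi -> -1 * sphere M (lbd xi) <= 0.
    move=> <- [w|] Kw; rewrite mulN1r oppr_le0 /sphere /= ?mulr1 ?mulr0 ?subr0//.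
    by rewrite subr_ge0 zmin.
  have zT : sqn z = T.
    apply/eqP; rewrite eq_le; have := H _ Kz; rewrite /sphere /= mulr1 subr_ge0 => zT.
    rewrite zT andbT leNgt; apply/negP => zT'.
    have zp : 0 < sqn z by apply: lt_trans zT'.
    have := in_cone_sphere zp n1 Kz erefl (H' _ erefl) CQ.
    by rewrite /sphere /=; lra.
  exists z, (-1); split=> //.
  exact: in_cone_sphere T0 n1 Kz zT (H' _ zT).
Qed.

Lemma hull_closed p : H3 p -> closure C p -> C p.
Proof.
move=> p0 cp; apply/hullE; split=> // h sh; rewrite leNgt; apply/negP => hp.
have [N N0 hN] := herm_of_plane h.
have nU : nbhs p [set q | 0 < ev h (hlift q)].
  have := @hpair_hlift_cvg R p N; move/cvgr_gt => /(_ 0); rewrite hpairC -hN => /(_ hp).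
  by apply: filterS => q /=; rewrite hN hpairC.
by have [q [/hullE[_ /(_ h sh) H]] /=] := cp _ nU; rewrite ltNge H.
Qed.

Lemma frontier_sub : S `<=` C.
Proof. by move=> p [p0 [cp _]]; apply: hull_closed. Qed.

(** A small vertical displacement of p, upwards or downwards according to the sign of s, leaves the
    half-space that contains the hull. The step stays below the height of p so that heights remain
    positive. *)
Lemma sphere_frontier (s T : R) p : s != 0 ->
  (forall X, in_cone K X -> s * sphere T X <= 0) ->
  C p -> sphere T (hlift p) = 0 -> S p.
Proof.
move=> s0 H Cp sp; have [p0 _] := Cp.
split=> //; split; first exact: subset_closure.
move=> /= ip; have cc : (fun r : R => (p.1, r) : Pt R) @ p.2 --> ((p.1, p.2) : Pt R).
  by apply: cvg_Pt; [exact: cvg_cst|exact: cvg_id].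
have : nbhs p.2 [set r : R | C (p.1, r)] by apply: cc; rewrite -surjective_pairing.
move=> /nbhs_ballP[d /= d0 Hd].
pose e := Num.min d p.2 / 2.
have e0 : 0 < e by rewrite divr_gt0// lt_min d0.
have ed : e < d by rewrite /e ltr_pdivrMr// gt_min; apply/orP; left; lra.
have ep : e < p.2 by rewrite /e ltr_pdivrMr// gt_min; apply/orP; right; move: p0; rewrite /H3 /=; lra.
have val (r : R) : C (p.1, r) -> s * (r ^+ 2 - p.2 ^+ 2) <= 0.
  move=> /hullE[_ /H]; move: sp; rewrite /sphere /= => sp.
  by congr (_ * _ <= _); lra.
have v1 : s * ((p.2 + e) ^+ 2 - p.2 ^+ 2) <= 0.
  by apply/val/Hd; rewrite -ball_normE /= opprD addrA subrr sub0r normrN gtr0_norm.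
have v2 : s * ((p.2 - e) ^+ 2 - p.2 ^+ 2) <= 0.
  by apply/val/Hd; rewrite -ball_normE /= opprB addrCA subrr addr0 gtr0_norm.
have [sp0|sn0|s00] := ltgtP 0 s; last by rewrite -s00 eqxx in s0.
  by move: v1; rewrite leNgt mulr_gt0// subr_gt0 ltr_pXn2r ?nnegrE//; lra.
move: v2; rewrite leNgt nmulr_rgt0// subr_lt0 ltr_pXn2r ?nnegrE//; lra.
Qed.

End SymmetricHullFrontier.

(** * The diameter through an endpoint as a leaf *)

Section SymmetricHullLeaves.
Context {R : realType}.
Implicit Types (xi x y : Chat R) (p q : Pt R) (u v z w : Cplx R) (P X Y N : @herm R)
  (S : set (Pt R)).
Context (K : set (Chat R)) (Kopp : forall xi, K xi -> K (copp xi)).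

Let C := hull K.
Let L := @geodesic R (Some 0) None.
Let S := frontier C.

Lemma diameterE z p : geodesic (Some z) (Some (- z)) p <->
  [/\ H3 p, sphere (sqn z) (hlift p) = 0 & exists r : R, p.1 = r%:C * z].
Proof.
split=> [[p0 [s [e1 e2]]]|[p0 sp [r e]]].
  have e3 : p.1 = (1 - 2 * s)%:C * z.
    rewrite e1; case: (z) => [a b]; apply/eqP; rewrite eq_complex /=.
    by apply/andP; split; apply/eqP; ring.
  split=> //; last by exists (1 - 2 * s).
  rewrite /sphere /= e2 e3; case: (z) => [a b]; rewrite /sqn /=; ring.
split=> //; exists ((1 - r) / 2); split.
  rewrite e; case: (z) => [a b]; apply/eqP; rewrite eq_complex /=.
  by apply/andP; split; apply/eqP; field.
move: sp; rewrite /sphere /= e => /eqP; rewrite subr_eq0 => /eqP sp.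
have -> : p.2 ^+ 2 = sqn z - sqn (r%:C * z : Cplx R) by move: sp; lra.
by case: (z) => [a b]; rewrite /sqn /=; field.
Qed.

Lemma sqn_scal (r : R) z : sqn (r%:C * z : Cplx R) = r ^+ 2 * sqn z.
Proof. by case: z => [a b]; rewrite /sqn /=; ring. Qed.

Lemma scal0C z : (0 : R)%:C * z = 0 :> Cplx R.
Proof. exact: mul0r. Qed.

Section Extremal.
Context (T s : R) (z : Cplx R) (Kz : K (Some z)) (zT : sqn z = T) (T0 : 0 < T) (s0 : s != 0)
  (H : forall X, in_cone K X -> s * sphere T X <= 0).

Lemma diameter_frontier p : geodesic (Some z) (Some (- z)) p -> S p.
Proof.
move=> /[dup] /geodesic_coefs[_ p0 [l [m [l0 m0 e]]]] /diameterE[_ sp _].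
apply: (@sphere_frontier _ K s T) => //; last by rewrite -zT.
apply/hullE; split=> //; rewrite e; apply: in_cone_lc; try exact: ltW.
  exact: in_cone_lbd.
by apply: in_cone_lbd; apply: (Kopp (xi := Some z)).
Qed.

(* Averaging an arc of the frontier at a point of the diameter with its image under
   the half-turn gives an arc through the top of the sphere in the same direction. *)
Lemma arc_at_top p x y : geodesic (Some z) (Some (- z)) p -> arc_through S p x y ->
  exists a b (l m : R), [/\ x = Some a, y = Some b, sqn a = T /\ sqn b = T,
    [/\ a <> b, 0 < l, 0 < m, l + m = 1 & p.1 = l%:C * a + m%:C * b] &
    forall t : Pt R, (t.1 = 0 -> t.2 ^+ 2 = T -> H3 t ->
      let v := l%:C * a - m%:C * b in
      exists2 w, sqn w = T & v <> 0 /\ (exists k : R, v = k%:C * w) /\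
      arc_through S t (Some w) (Some (- w)))].
Proof.
move=> pz axy; have [xyp _] := axy.
have [xy p0 [l [m [l0 m0 e]]]] := geodesic_coefs xyp.
have [d d0 Hd] := arc_in_cone (@frontier_sub R K) axy l0 m0 e.
have [_ sp _] := (diameterE z p).1 pz; rewrite zT in sp.
(* The functional has constant sign on a two-sided segment and vanishes at its midpoint p, hence
   also in the direction of the segment. Vanishing at l x + m y and at l x - m y, it vanishes at
   both ends. *)
have FV : s * sphere T (lc l (lbd x) (- m) (lbd y)) = 0.
  have val (r : R) : `|r| < d -> r * (s * sphere T (lc l (lbd x) (- m) (lbd y))) <= 0.
    move=> /Hd/H; have -> : sphere T (lc 1 (hlift p) r (lc l (lbd x) (- m) (lbd y))) =
      sphere T (hlift p) + r * sphere T (lc l (lbd x) (- m) (lbd y)).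
      by rewrite /sphere /=; ring.
    by rewrite sp add0r mulrCA.
  have d2 : 0 < d / 2 by rewrite divr_gt0.
  have h1 : `|d / 2| < d by rewrite gtr0_norm//; lra.
  have h2 : `|- (d / 2)| < d by rewrite normrN.
  have v1 := val _ h1; have v2 := val _ h2.
  apply/eqP; rewrite eq_le -(pmulr_rle0 _ d2) v1 /=.
  by rewrite -(pmulr_rge0 _ d2) -oppr_le0 -mulNr.
have {}FV : sphere T (lc l (lbd x) (- m) (lbd y)) = 0.
  by apply/eqP; move/eqP: FV; rewrite mulf_eq0 (negPf s0).
have FX : sphere T (lbd x) = 0.
  apply: (mulfI (lt0r_neq0 l0)); move: sp FV; rewrite e /sphere /= mulr0; lra.
have FY : sphere T (lbd y) = 0.
  apply: (mulfI (lt0r_neq0 m0)); move: sp FV; rewrite e /sphere /= mulr0; lra.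
case: x xy axy xyp e Hd FV FX => [a|]; last first.
  by move=> _ _ _ _ _ _; rewrite /sphere /= mulr0 subr0 => /eqP; rewrite oner_eq0.
case: y FY => [b|]; last first.
  by rewrite /sphere /= mulr0 subr0 => /eqP; rewrite oner_eq0.
move=> FY xy axy xyp e Hd FV FX.
have aT : sqn a = T by move: FX; rewrite /sphere /=; lra.
have bT : sqn b = T by move: FY; rewrite /sphere /=; lra.
have ab : a <> b by move=> ab; apply: xy; rewrite ab.
have lm : l + m = 1 by case: e => _ _ _; rewrite !mulr1 => ->.
have e1 : p.1 = l%:C * a + m%:C * b.
  case: e => _ + + _; case: (p.1) (a) (b) => [p1 p2] [a1 a2] [b1 b2] /= -> ->.
  by apply/eqP; rewrite eq_complex /=; apply/andP; split; apply/eqP; ring.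
exists a, b, l, m; split=> // t t1 t2 t0 v.
have vn : v <> 0.
  move=> v0; apply: ab; have E : l%:C * a = m%:C * b :> Cplx R.
    by apply/eqP; rewrite -subr_eq0; apply/eqP.
  have : l ^+ 2 * T = m ^+ 2 * T by rewrite -{1}aT -bT -!sqn_scal E.
  move=> /(mulIf (lt0r_neq0 T0))/eqP; rewrite eqrXn2 ?ltW// => /eqP lm'.
  move: E; rewrite lm'; apply: mulfI.
  by rewrite eq_complex /= negb_and gt_eqF.
have sv : 0 < sqn v by rewrite sqn_gt0; apply/eqP.
pose k := Num.sqrt (T / sqn v).
have k0 : 0 < k by rewrite sqrtr_gt0 divr_gt0.
have kn : k != 0 by rewrite gt_eqF.
have wT : sqn (k%:C * v : Cplx R) = T.
  by rewrite sqn_scal sqr_sqrtr ?divfK ?gt_eqF// ltW// divr_gt0.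
exists (k%:C * v) => //; split=> //; split.
  exists k^-1; rewrite mulrA.
  have -> : (k^-1)%:C * k%:C = 1 :> Cplx R.
    by apply/eqP; rewrite eq_complex /=; apply/andP; split; apply/eqP; field.
  by rewrite mul1r.
have tv : geodesic (Some (k%:C * v)) (Some (- (k%:C * v))) t.
  apply/diameterE; split=> //.
    by rewrite wT /sphere /= t1 sqn0 add0r t2 mulr1 subrr.
  by exists 0; rewrite t1 scal0C.
split=> //; exists [set q | sqn q.1 < d ^+ 2 * sqn v].
  have c : (fun q : Pt R => sqn q.1) @ t --> sqn t.1.
    by apply: (cvg_comp (fun q : Pt R => q.1)); [exact: cvg_fst|exact: sqn_continuous].
  by move/cvgr_lt: c; apply; rewrite t1 sqn0 mulr_gt0// exprn_gt0.
move=> q [/diameterE[q0 sq [r er]] /= qd].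
rewrite wT in sq; apply: (@sphere_frontier _ K s T) => //.
pose c := r * k.
have qe : q.1 = c%:C * v.
  rewrite er /c; move: (k) => k'; case: (v) => v1 v2.
  by apply/eqP; rewrite eq_complex /=; apply/andP; split; apply/eqP; ring.
have cd : `|c| < d.
  rewrite -ltr_sqr ?nnegrE ?normr_ge0 ?ltW// real_normK ?num_real//.
  by move: qd; rewrite qe sqn_scal ltr_pM2r.
have cd' : `|- c| < d by rewrite normrN.
apply/hullE; split=> //.
(* The lift of q is the mean of the point of parameter c of the segment and of the half-turn image
   of the point of parameter - c. *)
have h1 := Hd _ cd; have h2 := in_cone_opp Kopp (Hd _ cd').
have i2 : 0 <= 1 / 2 :> R by lra.
have := in_cone_lc i2 i2 h1 h2; congr in_cone.
have q2 : q.2 ^+ 2 = T - sqn q.1 by move: sq; rewrite /sphere /=; lra.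
have pT : sqn p.1 + p.2 ^+ 2 = T by move: sp; rewrite /sphere /=; lra.
apply: herm_eq.
- by rewrite /= pT q2 aT bT; field.
- by rewrite /= qe /v; case: (a) (b) => [a1 a2] [b1 b2] /=; field.
- by rewrite /= qe /v; case: (a) (b) => [a1 a2] [b1 b2] /=; field.
- by rewrite /=; field.
Qed.

(** At another point p of the diameter, an arc with ends a, b produces by [arc_at_top] an arc at Q
    in the direction l a - m b. Uniqueness at Q makes this direction a real multiple of z, as is p.1
    = l a + m b; so a and b are real multiples of z, of the same modulus as z. *)
Lemma pleated_top_leaf Q : L Q -> Q.2 ^+ 2 = T -> pleating_locus S Q ->
  leaf S (Some z) (Some (- z)) /\ orthogonal_at (Some z) (Some (- z)) (Some 0) None Q.
Proof.
move=> [Q0 Q1] Q2 [x0 [y0 [aQ uQ]]].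
have zn : z <> 0 by move=> z0; move: T0; rewrite -zT z0 sqn0 ltxx.
have zQ : geodesic (Some z) (Some (- z)) Q.
  apply/diameterE; split=> //; first by rewrite /sphere /= Q1 sqn0 add0r Q2 zT mulr1 subrr.
  by exists 0; rewrite Q1 scal0C.
have sub : geodesic (Some z) (Some (- z)) `<=` S by move=> p; apply: diameter_frontier.
have arc p : geodesic (Some z) (Some (- z)) p -> arc_through S p (Some z) (Some (- z)).
  by move=> pz; split=> //; exists setT; [exact: filterT|move=> q [/sub]].
split; last first.
  split=> //; rewrite /dot /tangent /= Q1 sub0r opprK sub0r sqnN subrr mul0r mul0r addr0.
  by case: (z) => a b /=; ring.
split; first by move=> [/eqP]; rewrite -addr_eq0 -mulr2n mulrn_eq0 /= => /eqP.
move=> p pz; exists (Some z), (Some (- z)); split; first exact: arc.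
move=> x y axy; have [a [b [l [m [-> -> [aT bT] [ab l0 m0 lm e1] top]]]]] := arc_at_top pz axy.
have [w wT [vn [[k vk] aw]]] := top Q Q1 Q2 Q0.
have ew : geodesic (Some w) (Some (- w)) = geodesic (Some z) (Some (- z)).
  by rewrite (uQ _ _ aw) (uQ _ _ (arc _ zQ)).
have [r wr] : exists r : R, w = r%:C * z.
  (* A point of the geodesic away from its top reveals its direction; the height uses 3/4 = 1 -
     (1/2)^2. *)
  pose q : Pt R := ((1/2)%:C * w, Num.sqrt (T * (3/4))).
  have q2 : q.2 ^+ 2 = T * (3/4) by rewrite sqr_sqrtr// mulr_ge0 ?ltW//; lra.
  have : geodesic (Some w) (Some (- w)) q.
    apply/diameterE; split; last by exists (1/2).
      by rewrite /H3 /= sqrtr_gt0 mulr_gt0//; lra.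
    by rewrite /sphere [h_al _]/= q2 sqn_scal wT /=; field.
  rewrite ew => /diameterE[_ _ [r /= er]]; exists (2 * r).
  transitivity ((2 : R)%:C * ((1 / 2)%:C * w)).
    by case: (w) => c c'; apply/eqP; rewrite eq_complex /=; apply/andP; split; apply/eqP; field.
  by rewrite er; case: (z) => c c'; apply/eqP; rewrite eq_complex /=; apply/andP; split; apply/eqP; ring.
have [_ _ [j ej]] := (diameterE z p).1 pz.
have mult c (n : R) i : n != 0 -> sqn c = T -> n%:C * c = i%:C * z -> c = z \/ c = - z.
  move=> n0 cT ec.
  have : n ^+ 2 * T = i ^+ 2 * T by rewrite -{1}cT -zT -!sqn_scal ec.
  move=> /(mulIf (lt0r_neq0 T0))/eqP; rewrite eqf_sqr => /orP[]/eqP ni.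
    left; move: ec; rewrite ni; apply: mulfI.
    by rewrite -ni eq_complex /= negb_and n0.
  right; move: ec; rewrite ni => ec; apply: (@mulfI _ (i%:C : Cplx R)).
    by rewrite eq_complex /= negb_and -oppr_eq0 -ni n0.
  rewrite mulrN -ec; case: (c) => c1 c2; apply/eqP; rewrite eq_complex /=.
  by apply/andP; split; apply/eqP; ring.
have ha : (2 * l)%:C * a = (j + k * r)%:C * z.
  have : l%:C * a + m%:C * b + (l%:C * a - m%:C * b) = j%:C * z + k%:C * (r%:C * z).
    by rewrite -e1 ej vk wr.
  case: (a) (b) (z) => [a1 a2] [b1 b2] [z1 z2] /eqP; rewrite eq_complex /= => /andP[/eqP h1 /eqP h2].
  by apply/eqP; rewrite eq_complex /=; apply/andP; split; apply/eqP; lra.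
have hb : (2 * m)%:C * b = (j - k * r)%:C * z.
  have : l%:C * a + m%:C * b - (l%:C * a - m%:C * b) = j%:C * z - k%:C * (r%:C * z).
    by rewrite -e1 ej vk wr.
  case: (a) (b) (z) => [a1 a2] [b1 b2] [z1 z2] /eqP; rewrite eq_complex /= => /andP[/eqP h1 /eqP h2].
  by apply/eqP; rewrite eq_complex /=; apply/andP; split; apply/eqP; lra.
have l2 : 2 * l != 0 by rewrite mulf_neq0 ?pnatr_eq0 ?gt_eqF.
have m2 : 2 * m != 0 by rewrite mulf_neq0 ?pnatr_eq0 ?gt_eqF.
have [] := mult _ _ _ l2 aT ha; have [] := mult _ _ _ m2 bT hb => eb ea.
- by case: ab; rewrite ea eb.
- by rewrite ea eb.
- by rewrite ea eb geodesicC.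
- by case: ab; rewrite ea eb.
Qed.

End Extremal.

End SymmetricHullLeaves.

(** * The half-turn about the vertical axis *)

Section HalfTurn.
Context {R : realType}.
Implicit Types (xi x y : Chat R) (p q : Pt R) (u v z w : Cplx R) (P X Y N : @herm R)
  (S : set (Pt R)) (K : set (Chat R)).

Definition half_turn : 'M[Cplx R]_2 :=
  \matrix_(i, j) if i == j then (if i == 0 then 'i%C : Cplx R else - 'i%C) else 0.

Lemma half_turn00 : half_turn 0 0 = 'i%C. Proof. by rewrite mxE. Qed.

Lemma half_turn01 : half_turn 0 1 = 0. Proof. by rewrite mxE. Qed.

Lemma half_turn10 : half_turn 1 0 = 0. Proof. by rewrite mxE. Qed.

Lemma half_turn11 : half_turn 1 1 = - 'i%C. Proof. by rewrite mxE. Qed.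

Definition half_turnE := (half_turn00, half_turn01, half_turn10, half_turn11).

Lemma det_half_turn : \det half_turn = 1.
Proof.
rewrite det2E !half_turnE mul0r subr0; apply/eqP; rewrite eq_complex /=.
by apply/andP; split; apply/eqP; ring.
Qed.

Lemma hact_half_turn X : hact half_turn X = hopp X.
Proof.
by rewrite /hact !half_turnE; apply: herm_eq => /=; rewrite ?/sqn /=; ring.
Qed.

Lemma lbd_inj k x y : lbd x = scal k (lbd y) -> x = y.
Proof.
move=> e; apply: contrapT => xy; have := hpair_lbd_gt0 xy.
by rewrite e hpair_scall hpair_quad quad_lbd !mulr0 ltxx.
Qed.

Lemma mobius_half_turn xi : mobius half_turn xi = copp xi.
Proof.
have [k k0] := mobius_lbd xi det_half_turn.
by rewrite hact_half_turn -lbd_copp => /lbd_inj.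
Qed.

Lemma act_half_turn_hlift p : H3 p -> hlift (act half_turn p) = hopp (hlift p).
Proof.
move=> p0; have [k k0] := act_hlift det_half_turn p0.
rewrite hact_half_turn => e.
have k1 : k = 1 by case: e => _ _ _; rewrite mulr1.
by rewrite e k1 scal1.
Qed.

Lemma act_half_turn_axis p : @geodesic R (Some 0) None p -> act half_turn p = p.
Proof.
move=> [p0 p1]; apply: hlift_inj => //; first exact: H3_act det_half_turn _.
rewrite act_half_turn_hlift//; apply: herm_eq; rewrite /= ?p1 /=; ring.
Qed.

End HalfTurn.

(** * Barycentric coordinates in an ideal triangle *)

Section Triangle.
Context {R : realType}.
Implicit Types (xi x y u v w : Chat R) (p q : Pt R) (P X Y N : @herm R)
  (S : set (Pt R)) (K : set (Chat R)).

(** The pairing has Lorentz signature: orthogonally to a null vector there is no timelike vector,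
    and no null vector outside its line. *)
Lemma null_orth X xi : 0 <= quad X -> hpair X (lbd xi) = 0 -> exists k, X = scal k (lbd xi).
Proof.
case: X xi => [a b c d] [[x y]|]; rewrite /quad /hpair /= => q0.
  rewrite /sqn /= mulr1 => e; exists d.
  have E : d * (a + d * (x ^+ 2 + y ^+ 2) - 2 * (b * x + c * y)) =
    (a * d - b ^+ 2 - c ^+ 2) + (d * x - b) ^+ 2 + (d * y - c) ^+ 2 by ring.
  move: E; rewrite e mulr0 => E.
  have h1 : (d * x - b) ^+ 2 = 0 by have := sqr_ge0 (d * x - b); have := sqr_ge0 (d * y - c); lra.
  have h2 : (d * y - c) ^+ 2 = 0 by have := sqr_ge0 (d * x - b); have := sqr_ge0 (d * y - c); lra.
  move/eqP: h1; rewrite sqrf_eq0 subr_eq0 => /eqP h1.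
  move/eqP: h2; rewrite sqrf_eq0 subr_eq0 => /eqP h2.
  apply: herm_eq => //=; rewrite ?mulr1//.
  by move: e; rewrite -h1 -h2 /sqn /= => e; nra.
move=> e; have d0 : d = 0 by lra.
exists a.
have h1 : b ^+ 2 = 0 by have := sqr_ge0 b; have := sqr_ge0 c; move: q0; rewrite d0; lra.
have h2 : c ^+ 2 = 0 by have := sqr_ge0 b; have := sqr_ge0 c; move: q0; rewrite d0; lra.
move/eqP: h1; rewrite sqrf_eq0 => /eqP h1.
move/eqP: h2; rewrite sqrf_eq0 => /eqP h2.
by apply: herm_eq => /=; rewrite ?mulr1 ?mulr0.
Qed.

Lemma null_orth2 X u v : u <> v -> 0 <= quad X -> hpair X (lbd u) = 0 ->
  hpair X (lbd v) = 0 -> X = scal 0 X.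
Proof.
move=> uv q0 hu hv; have [k Xk] := null_orth q0 hu.
have k0 : k = 0.
  move: hv; rewrite Xk hpair_scall => /eqP; rewrite mulf_eq0 => /orP[/eqP//|].
  by rewrite gt_eqF// hpair_lbd_gt0.
by rewrite Xk k0; apply: herm_eq => /=; ring.
Qed.

(* The normal of the plane through v and w that is orthogonal to the plane of u, v, w. *)
Definition edge_normal u v w : @herm R :=
  lc 1 (lc (hpair (lbd u) (lbd w)) (lbd v) (hpair (lbd u) (lbd v)) (lbd w))
     (- hpair (lbd v) (lbd w)) (lbd u).

Lemma lbd_null xi : hpair (lbd xi) (lbd xi) = 0.
Proof. by rewrite hpair_quad quad_lbd mulr0. Qed.

Lemma edge_normal1 u v w : hpair (edge_normal u v w) (lbd u) =
  2 * hpair (lbd u) (lbd v) * hpair (lbd u) (lbd w).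
Proof. by rewrite !hpair_lcl lbd_null [hpair (lbd v) (lbd u)]hpairC [hpair (lbd w) (lbd u)]hpairC; ring. Qed.

Lemma edge_normal2 u v w : hpair (edge_normal u v w) (lbd v) = 0.
Proof. by rewrite !hpair_lcl lbd_null [hpair (lbd w) (lbd v)]hpairC; ring. Qed.

Lemma edge_normal3 u v w : hpair (edge_normal u v w) (lbd w) = 0.
Proof. by rewrite !hpair_lcl lbd_null; ring. Qed.

Lemma quad_edge_normal u v w : u <> v -> v <> w -> w <> u -> quad (edge_normal u v w) < 0.
Proof.
move=> uv vw wu; have : 2 * quad (edge_normal u v w) < 0.
  rewrite -hpair_quad {2}/edge_normal !hpair_lcr edge_normal1 edge_normal2 edge_normal3.
  rewrite !mulr0 addr0 mulr0 add0r mulNr oppr_lt0 !mulr_gt0 ?hpair_lbd_gt0//.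
  by move=> e; apply: wu.
by rewrite pmulr_rlt0.
Qed.

Lemma edge_normal_ge0 K u v w P : u <> v -> v <> w -> w <> u -> K v ->
  (forall xi, K xi -> [\/ xi = u, xi = v | xi = w]) -> in_cone K P ->
  0 <= hpair (edge_normal u v w) P.
Proof.
move=> uv vw wu Kv KK cP.
have [|h hE] := @plane_of_herm R (scal (-1) (edge_normal u v w)).
  have -> : quad (scal (-1) (edge_normal u v w)) = quad (edge_normal u v w) by rewrite /quad /=; ring.
  exact: quad_edge_normal.
have := cP h; rewrite hE hpair_scall mulN1r oppr_le0; apply; apply/support_planeE; split.
  by exists v => //; rewrite hE hpair_scall edge_normal2 mulr0.
move=> xi /KK; rewrite hE hpair_scall mulN1r oppr_le0 => -[] ->.
- rewrite edge_normal1 !mulr_ge0 ?hpair_lbd_ge0//.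
- by rewrite edge_normal2.
- by rewrite edge_normal3.
Qed.

(** The coordinates are pairings with the edge normals. The remainder X is orthogonal to u, v and w;
    if its determinant were negative, X and - X would both define support planes, so X would be
    orthogonal to P, hence to itself. Otherwise [null_orth2] applies. *)
Lemma barycentric u v w P : u <> v -> v <> w -> w <> u -> in_cone [set u; v; w] P ->
  exists a b c : R, [/\ 0 <= a, 0 <= b, 0 <= c & P = lc 1 (lc a (lbd u) b (lbd v)) c (lbd w)].
Proof.
move=> uv vw wu cP.
have p1 : 0 < hpair (lbd v) (lbd w) by apply: hpair_lbd_gt0.
have p2 : 0 < hpair (lbd u) (lbd w) by apply: hpair_lbd_gt0 => e; apply: wu.
have p3 : 0 < hpair (lbd u) (lbd v) by apply: hpair_lbd_gt0.
have e1 := edge_normal_ge0 uv vw wu (K := [set u; v; w]) (P := P).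
have e2 := edge_normal_ge0 vw wu uv (K := [set u; v; w]) (P := P).
have e3 := edge_normal_ge0 wu uv vw (K := [set u; v; w]) (P := P).
have {}e1 : 0 <= hpair (edge_normal u v w) P.
  by apply: e1 => //; [left; right|move=> xi [[]|] ->; constructor].
have {}e2 : 0 <= hpair (edge_normal v w u) P.
  by apply: e2 => //; [right|move=> xi [[]|] ->; constructor].
have {}e3 : 0 <= hpair (edge_normal w u v) P.
  by apply: e3 => //; [left; left|move=> xi [[]|] ->; constructor].
pose a := hpair (edge_normal u v w) P / (2 * hpair (lbd u) (lbd v) * hpair (lbd u) (lbd w)).
pose b := hpair (edge_normal v w u) P / (2 * hpair (lbd u) (lbd v) * hpair (lbd v) (lbd w)).
pose c := hpair (edge_normal w u v) P / (2 * hpair (lbd u) (lbd w) * hpair (lbd v) (lbd w)).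
exists a, b, c; split; try by rewrite divr_ge0// !mulr_ge0// ltW.
pose X := lc 1 P (-1) (lc 1 (lc a (lbd u) b (lbd v)) c (lbd w)).
have n1 := lt0r_neq0 p1; have n2 := lt0r_neq0 p2; have n3 := lt0r_neq0 p3.
have sym := (hpairC (lbd w) (lbd u), hpairC (lbd v) (lbd u), hpairC (lbd w) (lbd v)).
have Xu : hpair X (lbd u) = 0.
  rewrite /X !hpair_lcl lbd_null ?sym /a /b /c /edge_normal !hpair_lcl ?sym.
  rewrite ![hpair (lbd _) P]hpairC; field.
  by rewrite n1 n2 n3.
have Xv : hpair X (lbd v) = 0.
  rewrite /X !hpair_lcl lbd_null ?sym /a /b /c /edge_normal !hpair_lcl ?sym.
  rewrite ![hpair (lbd _) P]hpairC; field.
  by rewrite n1 n2 n3.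
have Xw : hpair X (lbd w) = 0.
  rewrite /X !hpair_lcl lbd_null ?sym /a /b /c /edge_normal !hpair_lcl ?sym.
  rewrite ![hpair (lbd _) P]hpairC; field.
  by rewrite n1 n2 n3.
have qX : 0 <= quad X.
  rewrite leNgt; apply/negP => qX.
  have val (e : R) : e ^+ 2 = 1 -> e * hpair X P <= 0.
    move=> ee; have [|h hE] := @plane_of_herm R (scal e X).
      have -> : quad (scal e X) = e ^+ 2 * quad X by rewrite /quad /=; ring.
      by rewrite ee mul1r.
    have := cP h; rewrite hE hpair_scall; apply; apply/support_planeE.
    have Z xi : [set u; v; w] xi -> ev h (lbd xi) = 0.
      by rewrite hE hpair_scall => -[[]|] ->; rewrite ?Xu ?Xv ?Xw mulr0.
    split; last by move=> xi /Z ->.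
    by exists u; [left; left|apply: Z; left; left].
  have XP : hpair X P = 0.
    have := val 1 (expr1n _ _); have := val (-1); rewrite sqrrN expr1n => /(_ erefl); lra.
  have : 2 * quad X = 0.
    rewrite -hpair_quad {2}/X !hpair_lcr Xu Xv Xw XP; ring.
  by move=> q0; move: qX; rewrite -(@pmulr_rlt0 _ 2) ?ltr0n// q0 ltxx.
have := null_orth2 uv qX Xu Xv; rewrite /X => -[] h1 h2 h3 h4.
by apply: herm_eq => /=; lra.
Qed.

End Triangle.

(** * The case of unpleated endpoints *)

Section SymmetricHullFaces.
Context {R : realType}.
Implicit Types (xi x y : Chat R) (p q : Pt R) (z : Cplx R) (P X Y N : @herm R)
  (S : set (Pt R)).
Context (K : set (Chat R)) (Kopp : forall xi, K xi -> K (copp xi)).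

Let C := hull K.
Let L := @geodesic R (Some 0) None.
Let S := frontier C.

(** A leaf through a point p of L would meet it at a non-endpoint, so an arc of L around p lies in
    the hull. That arc lies in the frontier, since p does; by uniqueness at p the leaf is L itself,
    so L stays in the hull and has no endpoint. *)
Lemma leaf_disjoint_axis (A : set (Pt R)) : endpoints L (L `&` C) = A -> A !=set0 ->
  (forall q, A q -> ~ pleating_locus S q) ->
  forall x y, leaf S x y -> geodesic x y `&` (L `&` C) = set0.
Proof.
move=> eA A0 nA x y [xy lf]; apply/seteqP; split=> // p [xyp [Lp Cp]].
have plp := lf _ xyp; have [p0 p1] := Lp; have Sp := pleating_sub plp.
have ncl : ~ closure (L `\` (L `&` C)) p.
  move=> cl; apply: (nA p) => //; rewrite -eA; split=> //; split=> //.
  exact: subset_closure.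
(* Squared heights are used because lifts of points of the axis are affine in them. *)
have [eta eta0 Heta] : exists2 eta : R, 0 < eta & forall tau : R, `|tau - p.2 ^+ 2| < eta ->
    0 < tau /\ in_cone K (Herm tau 0 0 1).
  have /existsNP[U /not_implyP[nU dis]] := ncl.
  have Usub q : L q -> U q -> C q.
    move=> Lq Uq; apply: contrapT => nC; apply: dis; exists q; split=> //.
    by split=> // -[].
  have cc : (fun tau : R => (0, Num.sqrt tau) : Pt R) @ (p.2 ^+ 2) --> ((0, Num.sqrt (p.2 ^+ 2)) : Pt R).
    by apply: cvg_Pt; [exact: cvg_cst|exact: sqrt_continuous].
  have ep : ((0, Num.sqrt (p.2 ^+ 2)) : Pt R) = p.
    by rewrite sqrtr_sqr gtr0_norm// -p1 -surjective_pairing.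
  have n1 : nbhs (p.2 ^+ 2) [set tau : R | U (0, Num.sqrt tau)] by apply: cc; rewrite ep.
  have t0 : 0 < p.2 ^+ 2 by rewrite exprn_gt0.
  have n2 : nbhs (p.2 ^+ 2) [set tau : R | 0 < tau].
    by apply: open_nbhs_nbhs; split; [exact: open_gt|].
  have n12 : nbhs (p.2 ^+ 2) [set tau : R | U (0, Num.sqrt tau) /\ 0 < tau] by exact: filterI n1 n2.
  have [d /= d0 Hd] := (nbhs_ballP (p.2 ^+ 2) _).1 n12.
  exists d => // tau td; have [|/= Ut tau0] := Hd tau.
    by rewrite -ball_normE /= distrC.
  split=> //; have Lq : L (0, Num.sqrt tau) by split=> //; rewrite /H3 /= sqrtr_gt0.
  by move: (Usub _ Lq Ut) => /(hull_axis K Lq); rewrite /= sqr_sqrtr// ltW.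
have arcL : arc_through S p (Some 0) None.
  split=> //; exists [set q | `|q.2 ^+ 2 - p.2 ^+ 2| < eta].
    have c2 : (fun q : Pt R => q.2) @ p --> p.2 by exact: cvg_snd.
    have c3 : (fun q : Pt R => q.2 ^+ 2) @ p --> p.2 ^+ 2 by exact: (cvgM c2 c2).
    move/cvgrPdist_lt: c3 => /(_ _ eta0).
    by apply: filterS => q /=; rewrite distrC.
  move=> q [Lq /= qe]; have [q0 q1] := Lq.
  have [_ cq] := Heta _ qe; have Cq : C q by apply/(hull_axis K Lq).
  split=> //; split; first exact: subset_closure.
  move=> iq; have [_ [_ ip]] := Sp; apply: ip.
  (* The lift of p is the mean of those of q and of the axis point of squared height tau. If q were
     interior to the hull, averaging a neighbourhood of q with that point would make p interior. *)
  pose tau := 2 * p.2 ^+ 2 - q.2 ^+ 2.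
  have te : `|tau - p.2 ^+ 2| < eta.
    by rewrite /tau (_ : _ - _ = - (q.2 ^+ 2 - p.2 ^+ 2)) ?normrN//; ring.
  have [tau0 ct] := Heta _ te.
  pose f (n : Pt R) := lc 2 (hlift n) (-1) (Herm tau 0 0 1).
  have fp : f p = Herm (q.2 ^+ 2) 0 0 1.
    by apply: herm_eq; rewrite /= ?p1 /tau ?sqn0 /=; ring.
  have fpq : pt (f p) = q.
    by rewrite fp -[RHS](pt_hlift q0); congr pt; rewrite /hlift q1 sqn0 add0r.
  have cf : hcvg (nbhs p) f (f p).
    apply: hcvg_lc; [exact: cvg_cst|exact: cvg_cst|exact: hcvg_hlift|exact: hcvg_cst].
  have cpt : (fun n => pt (f n)) @ p --> pt (f p).
    by apply: hcvg_pt cf; rewrite fp /= oner_neq0.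
  have n1 : nbhs p [set n | C (pt (f n))] by apply: cpt; rewrite fpq.
  have n2 : nbhs p [set n | 0 < quad (f n)].
    have [c1 c2' c3 c4] := cf.
    have cq' : (fun n => quad (f n)) @ p --> quad (f p).
      exact: (cvgB (cvgB (cvgM c1 c4) (cvgM c2' c2')) (cvgM c3 c3)).
    move/cvgr_gt: cq'; apply; rewrite fp /quad /= expr0n /= !subr0 mulr1 exprn_gt0//.
  have n3 : nbhs p (@H3 R) by exact: open_nbhs_nbhs (conj (@open_H3 R) p0).
  apply: filterS (filterI (filterI n1 n2) n3) => n [[/= C1 q2] n0].
  have g1 : h_ga (f n) = 1 by rewrite /=; ring.
  move: C1 => /hullE[_]; rewrite hlift_pt ?ltW ?g1 ?ltr01// invr1 scal1 => c1.
  apply/hullE; split=> //.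
  have i2 : 0 <= 1 / 2 :> R by lra.
  have := in_cone_lc i2 i2 c1 ct; congr in_cone.
  by apply: herm_eq => /=; field.
have subS : geodesic x y `<=` S by move=> q /lf/pleating_sub.
have arcxy : arc_through S p x y by split=> //; exists setT; [exact: filterT|move=> q [/subS]].
have [x0 [y0 [_ un]]] := plp.
have eL : geodesic x y = L by rewrite (un _ _ arcxy) -(un _ _ arcL).
have [q Aq] := A0; move: Aq; rewrite -eA => -[_ cl].
have [r [[Lr nr] _]] := cl _ (filterT : nbhs q setT).
by apply: nr; split=> //; apply: frontier_sub; apply: subS; rewrite eL.
Qed.

Lemma image_half_turn_K : mobius half_turn @` K = K.
Proof.
apply/seteqP; split=> [_ [xi Kxi <-]|xi Kxi].
  by rewrite mobius_half_turn; apply: Kopp.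
exists (copp xi); first exact: Kopp.
by rewrite mobius_half_turn; case: (xi) => //= z; rewrite opprK.
Qed.

Lemma image_half_turn_frontier : act half_turn @` S = S.
Proof.
rewrite /S -frontier_act ?det_half_turn//; last exact: hull_H3.
by rewrite -hull_act ?det_half_turn// image_half_turn_K.
Qed.

Lemma sphere_lbd0 (T : R) x : sphere T (lbd x) = 0 -> exists2 a, x = Some a & sqn a = T.
Proof.
case: x => [a|]; rewrite /sphere /= ?mulr1 ?mulr0 => e; last by move: e; lra.
by exists a => //; lra.
Qed.

(** Q is interior to the triangle, so it can be moved both ways in the direction of the vertex u:
    this puts u on the circle |z|^2 = T. By symmetry - u is a vertex too, and Q, lying between u and
    - u, would be on an edge. *)
Lemma component_not_triangle (T s : R) Q D : 0 < T -> s != 0 ->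
  (forall X, in_cone K X -> s * sphere T X <= 0) ->
  L Q -> Q.2 ^+ 2 = T -> S Q -> ~ pleating_locus S Q ->
  D = connected_component (S `\` pleating_locus S) Q -> ~ ideal_triangle D.
Proof.
move=> T0 s0 H LQ QT SQ nQ DE [u [v [w [uv vw wu DT]]]]; have [Q0 Q1] := LQ.
have SPQ : (S `\` pleating_locus S) Q by [].
have DQ : D Q by rewrite DE; apply: connected_component_refl.
have DS p : D p -> S p by rewrite DE => /connected_component_sub[].
have SH : S `<=` H3 by exact: frontier_H3.
have uw : u <> w by move=> e; apply: wu.
have p1 := hpair_lbd_gt0 vw; have p2 := hpair_lbd_gt0 uw; have p3 := hpair_lbd_gt0 uv.
have [/hullE[_ cQ] nQe] : (hull [set u; v; w] `\`
   (geodesic u v `|` geodesic v w `|` geodesic w u)) Q by rewrite -DT.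
have [a [b [c [a0 b0 c0 eQ]]]] := barycentric uv vw wu cQ.
have {}a0 : 0 < a.
  rewrite lt_def a0 andbT; apply/eqP => az; apply: nQe; left; right.
  by apply/geodesicE; split=> //; exists b, c; rewrite eQ az; apply: herm_eq => /=; ring.
have {}b0 : 0 < b.
  rewrite lt_def b0 andbT; apply/eqP => az; apply: nQe; right.
  by apply/geodesicE; split=> //; exists c, a; rewrite eQ az; apply: herm_eq => /=; ring.
have {}c0 : 0 < c.
  rewrite lt_def c0 andbT; apply/eqP => az; apply: nQe; left; left.
  by apply/geodesicE; split=> //; exists a, b; rewrite eQ az; apply: herm_eq => /=; ring.
have Dtri (i j k : R) : 0 < i -> 0 < j -> 0 < k ->
    let X := lc 1 (lc i (lbd u) j (lbd v)) k (lbd w) in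
    [/\ 0 < h_ga X, 0 < quad X & D (pt X)].
  move=> i0 j0 k0 X.
  have g0 : 0 < h_ga X.
    have [g _ _] := geodesic_pt uv i0 j0.
    by rewrite /= mul1r ltr_wpDr// mulr_ge0 ?ga_lbd// ltW.
  have q0 : 0 < quad X.
    have -> : quad X = i * j * hpair (lbd u) (lbd v) + i * k * hpair (lbd u) (lbd w) +
        j * k * hpair (lbd v) (lbd w).
      have := quad_lbd u; have := quad_lbd v; have := quad_lbd w.
      rewrite /X /quad /hpair /= => e1 e2 e3.
      move: e1 e2 e3; move: (lbd u) (lbd v) (lbd w) => [u1 u2 u3 u4] [v1 v2 v3 v4] [w1 w2 w3 w4] /=.
      move=> e1 e2 e3; apply/eqP; rewrite -subr_eq0; apply/eqP.
      transitivity (i ^+ 2 * (u1 * u4 - u2 ^+ 2 - u3 ^+ 2) + j ^+ 2 * (v1 * v4 - v2 ^+ 2 - v3 ^+ 2)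
        + k ^+ 2 * (w1 * w4 - w2 ^+ 2 - w3 ^+ 2)); first by ring.
      by rewrite e1 e2 e3; ring.
    by rewrite !addr_gt0// !mulr_gt0.
  split=> //; rewrite DT; have lX := hlift_pt g0 (ltW q0).
  have gi : 0 < (h_ga X)^-1 by rewrite invr_gt0.
  split.
    apply/hullE; split; first exact: H3_pt.
    rewrite lX; apply/(in_cone_scal _ _ gi).
    apply: in_cone_lc; rewrite ?ler01 ?ltW//; last by apply: in_cone_lbd; right.
    by apply: in_cone_lc; rewrite ?ltW//; apply: in_cone_lbd; left; [left|right].
  have no (x y z' : Chat R) (i' j' k' l m : R) : x <> y -> y <> z' -> z' <> x -> 0 < k' ->
      scal (h_ga X)^-1 (lc 1 (lc i' (lbd x) j' (lbd y)) k' (lbd z')) = lc l (lbd x) m (lbd y) -> False.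
    move=> xy yz zx k'0 e.
    have := edge_normal2 z' x y; have := edge_normal3 z' x y; have := edge_normal1 z' x y.
    move=> e1 e3 e2; have := congr1 (hpair (edge_normal z' x y)) e.
    rewrite hpair_scalr !hpair_lcr e1 e2 e3 !mulr0 !addr0 mulr0 add0r => /eqP.
    rewrite mulf_eq0 mulf_eq0 invr_eq0 !gt_eqF//= !mulr_gt0 ?hpair_lbd_gt0//.
    by move=> e'; apply: yz.
  move=> [[|]|] /geodesicE[_ [l [m]]]; rewrite lX /X => e.
  - exact: (no _ _ _ _ _ _ _ _ uv vw wu k0 e).
  - apply: (no v w u j k i l m) => //; rewrite -e; congr scal.
    by apply: herm_eq => /=; ring.
  - apply: (no w u v k i j l m) => //; rewrite -e; congr scal.
    by apply: herm_eq => /=; ring.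
have Dcone (i j k : R) : 0 < i -> 0 < j -> 0 < k ->
    in_cone K (lc 1 (lc i (lbd u) j (lbd v)) k (lbd w)).
  move=> i0 j0 k0; have [g0 q0 /DS/frontier_sub/hullE[_]] := Dtri _ _ _ i0 j0 k0.
  rewrite hlift_pt ?ltW// => /in_cone_scal; apply.
  by rewrite invr_gt0.
have sQ : sphere T (hlift Q) = 0 by rewrite /sphere /= Q1 sqn0 add0r QT mulr1 subrr.
have vertex x (d : R) : 0 < d ->
    (forall r : R, `|r| < d -> in_cone K (lc 1 (hlift Q) r (lbd x))) -> exists2 z, x = Some z & sqn z = T.
  move=> d0 Hd; apply: sphere_lbd0; apply/eqP; rewrite -(mulrI_eq0 _ (mulfI s0)).
  have val (r : R) : `|r| < d -> r * (s * sphere T (lbd x)) <= 0.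
    move=> /Hd/H; have -> : sphere T (lc 1 (hlift Q) r (lbd x)) =
        sphere T (hlift Q) + r * sphere T (lbd x) by rewrite /sphere /=; ring.
    by rewrite sQ add0r mulrCA.
  have d2 : 0 < d / 2 by rewrite divr_gt0.
  have h1 : `|d / 2| < d by rewrite gtr0_norm//; lra.
  have h2 : `|- (d / 2)| < d by rewrite normrN.
  have v1 := val _ h1; have v2 := val _ h2.
  rewrite eq_le -(pmulr_rle0 _ d2) v1 /=.
  by rewrite -(pmulr_rge0 _ d2) -oppr_le0 -mulNr.
have [z uz zT] : exists2 z, u = Some z & sqn z = T.
  apply: (vertex u a a0) => r; rewrite ltr_norml => /andP[r1 r2].
  have -> : lc 1 (hlift Q) r (lbd u) = lc 1 (lc (a + r) (lbd u) b (lbd v)) c (lbd w).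
    by rewrite eQ; apply: herm_eq => /=; ring.
  by apply: Dcone => //; lra.
have Eturn p : D p -> D (act half_turn p).
  move=> Dp; rewrite DE; exists (act half_turn @` D); last by exists p.
  split.
  - by exists Q => //; apply: act_half_turn_axis.
  - move=> _ [q Dq <-]; move: Dq; rewrite DE => /connected_component_sub[Sq nq].
    split; first by rewrite -image_half_turn_frontier; exists q.
    rewrite -image_half_turn_frontier pleating_act ?det_half_turn// => -[r /[dup] plr /pleating_H3 r0 e].
    apply: nq; rewrite -(actK det_half_turn (SH _ Sq)) -e actK ?det_half_turn//.
  - apply: connected_act; [exact: det_half_turn|by move=> q /DS/SH|].
    by rewrite DE; apply: component_connected.
(* D contains the points Q + r u up to scale for all r > 0, hence also their half-turn images Q + r
   (- u). A support functional positive at - u would be positive there for large r. *)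
have cu : in_cone [set u; v; w] (lbd (copp u)).
  move=> h sh; rewrite leNgt; apply/negP => hu.
  have eQ' : hopp (hlift Q) = hlift Q by apply: herm_eq; rewrite /= ?Q1 /=; ring.
  have val (r : R) : 0 < r -> ev h (hlift Q) + r * ev h (lbd (copp u)) <= 0.
    move=> r0; have ar : 0 < a + r by rewrite addr_gt0.
    have [g0 q0] := Dtri _ _ _ ar b0 c0; set X := lc 1 _ _ _ in g0 q0 *.
    move=> /[dup] /DS/SH pH /Eturn; rewrite {1}DT => -[/hullE[_ /(_ h sh) +] _].
    rewrite act_half_turn_hlift// (hlift_pt g0 (ltW q0)).
    have -> : hopp (scal (h_ga X)^-1 X) = scal (h_ga X)^-1 (lc 1 (hlift Q) r (lbd (copp u))).
      rewrite -eQ' lbd_copp eQ /X; move: (h_ga _) => g.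
      by apply: herm_eq => /=; ring.
    by rewrite ev_scal pmulr_rle0 ?invr_gt0// ev_lc mul1r.
  pose r := `|ev h (hlift Q)| / ev h (lbd (copp u)) + 1.
  have r0 : 0 < r by rewrite ltr_wpDl// divr_ge0// ltW.
  have := val r r0; rewrite /r mulrDl divfK ?gt_eqF// mul1r.
  have := ler_norm (- ev h (hlift Q)); rewrite normrN; lra.
have [a' [b' [c' [a'0 b'0 c'0 eu]]]] := barycentric uv vw wu cu.
(* The determinant of the null form of - u is a sum of nonnegative cross terms, so they all vanish
   and at most one coefficient survives. *)
have [e1 e2 e3] : [/\ a' * b' = 0, a' * c' = 0 & b' * c' = 0].
  have : a' * b' * hpair (lbd u) (lbd v) + a' * c' * hpair (lbd u) (lbd w) +
        b' * c' * hpair (lbd v) (lbd w) = 0.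
    have := quad_lbd (copp u); rewrite eu.
    have := quad_lbd u; have := quad_lbd v; have := quad_lbd w.
    move: (lbd u) (lbd v) (lbd w) => [u1 u2 u3 u4] [v1 v2 v3 v4] [w1 w2 w3 w4].
    rewrite /quad /hpair /= => f1 f2 f3 f4; rewrite -[RHS]f4; apply/eqP; rewrite -subr_eq0; apply/eqP.
    transitivity (- (a' ^+ 2 * (u1 * u4 - u2 ^+ 2 - u3 ^+ 2) + b' ^+ 2 * (v1 * v4 - v2 ^+ 2 - v3 ^+ 2)
        + c' ^+ 2 * (w1 * w4 - w2 ^+ 2 - w3 ^+ 2))); first by ring.
    by rewrite f1 f2 f3; ring.
  have m1 : 0 <= a' * b' by rewrite mulr_ge0.
  have m2 : 0 <= a' * c' by rewrite mulr_ge0.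
  have m3 : 0 <= b' * c' by rewrite mulr_ge0.
  have n1 : 0 <= a' * b' * hpair (lbd u) (lbd v) by rewrite mulr_ge0// ltW.
  have n2 : 0 <= a' * c' * hpair (lbd u) (lbd w) by rewrite mulr_ge0// ltW.
  have n3 : 0 <= b' * c' * hpair (lbd v) (lbd w) by rewrite mulr_ge0// ltW.
  have z0 (i j : R) : 0 < j -> i * j = 0 -> i = 0.
    by move=> j0 /eqP; rewrite mulf_eq0 => /orP[/eqP//|]; rewrite gt_eqF.
  by move=> e; split; [apply: z0 p3 _|apply: z0 p2 _|apply: z0 p1 _]; lra.
have zn : z <> 0 by move=> z0; move: T0; rewrite -zT z0 sqn0 ltxx.
have cuu : copp u <> u.
  rewrite uz => -[] /eqP; rewrite eq_sym -addr_eq0 -mulr2n mulrn_eq0 /= => /eqP.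
  exact: zn.
have QE x : x = copp u -> geodesic u x Q.
  move=> ->; rewrite uz; apply/diameterE; rewrite zT; split=> //.
  by exists 0; rewrite Q1 scal0C.
have [za|na] := eqVneq a' 0; last first.
  move/eqP: e1; rewrite mulf_eq0 (negPf na) /= => /eqP zb.
  move/eqP: e2; rewrite mulf_eq0 (negPf na) /= => /eqP zc.
  apply: cuu; apply: (@lbd_inj _ a'); rewrite eu zb zc; apply: herm_eq => /=; ring.
have [zb|nb] := eqVneq b' 0; last first.
  move/eqP: e3; rewrite mulf_eq0 (negPf nb) /= => /eqP zc.
  apply: nQe; left; left; apply: QE; apply/esym/(@lbd_inj _ b').
  by rewrite eu za zc; apply: herm_eq => /=; ring.
apply: nQe; right; rewrite geodesicC; apply: QE; apply/esym/(@lbd_inj _ c').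
by rewrite eu za zb; apply: herm_eq => /=; ring.
Qed.

End SymmetricHullFaces.

(** * Palindromes *)

Section Words.
Context {R : realType}.
Implicit Types (g h M N A B : 'M[Cplx R]_2) (w : seq (bool * bool)) (G : set 'M[Cplx R]_2).

Lemma ord2 (i : 'I_2) : i = 0 \/ i = 1.
Proof. by case: i => -[|[|//]] i; [left|right]; apply/val_inj. Qed.

Lemma mx22_eq M N : M 0 0 = N 0 0 -> M 0 1 = N 0 1 -> M 1 0 = N 1 0 -> M 1 1 = N 1 1 -> M = N.
Proof.
by move=> h1 h2 h3 h4; apply/matrixP => i j; case: (ord2 i) => ->; case: (ord2 j) => ->.
Qed.

(** For determinant 1 this is the conjugate of M^-1 by [half_turn]; as an entry permutation it is
    multiplicative in reverse order without inverses. *)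
Definition flip M : 'M[Cplx R]_2 := \matrix_(i, j) M (rev_ord j) (rev_ord i).

Lemma rev_ord20 : rev_ord (0 : 'I_2) = 1. Proof. exact/val_inj. Qed.

Lemma rev_ord21 : rev_ord (1 : 'I_2) = 0. Proof. exact/val_inj. Qed.

Lemma flipE M : [/\ flip M 0 0 = M 1 1, flip M 0 1 = M 0 1, flip M 1 0 = M 1 0 & flip M 1 1 = M 0 0].
Proof. by rewrite !mxE !rev_ord20 !rev_ord21. Qed.

Lemma flipM M N : flip (M * N) = flip N * flip M.
Proof.
have [e1 e2 e3 e4] := flipE M; have [f1 f2 f3 f4] := flipE N; have [g1 g2 g3 g4] := flipE (M * N).
by apply: mx22_eq; rewrite ?g1 ?g2 ?g3 ?g4 !mul2E ?e1 ?e2 ?e3 ?e4 ?f1 ?f2 ?f3 ?f4; ring.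
Qed.

Lemma flip1 : flip 1 = 1.
Proof. by have [e1 e2 e3 e4] := flipE 1; apply: mx22_eq; rewrite ?e1 ?e2 ?e3 ?e4 !mxE. Qed.

Lemma flip_id M : M 0 0 = M 1 1 -> flip M = M.
Proof. by have [e1 e2 e3 e4] := flipE M => h; apply: mx22_eq; rewrite ?e1 ?e2 ?e3 ?e4. Qed.

Lemma inv22 g : \det g = 1 ->
  [/\ g^-1 0 0 = g 1 1, g^-1 0 1 = - g 0 1, g^-1 1 0 = - g 1 0 & g^-1 1 1 = g 0 0].
Proof.
move=> dg; pose h : 'M[Cplx R]_2 := \matrix_(i, j)
  if i == 0 then (if j == 0 then g 1 1 else - g 0 1) else (if j == 0 then - g 1 0 else g 0 0).
have [h1 h2 h3 h4] : [/\ h 0 0 = g 1 1, h 0 1 = - g 0 1, h 1 0 = - g 1 0 & h 1 1 = g 0 0].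
  by rewrite !mxE.
have hg : h * g = 1.
  rewrite det2E in dg.
  apply: mx22_eq; rewrite mul2E ?h1 ?h2 ?h3 ?h4 [RHS]mxE /=.
  - by rewrite -dg; ring.
  - by rewrite mulr0n; ring.
  - by rewrite mulr0n; ring.
  - by rewrite -dg; ring.
have -> : g^-1 = h by rewrite -[LHS]mul1r -hg mulrK// det1_unit.
by [].
Qed.

Lemma letterE A B l : letter A B l =
  let X := if l.1 then A else B in if l.2 then X^-1 else X.
Proof. by []. Qed.

Section Generators.
Context (A B : 'M[Cplx R]_2) (dA : \det A = 1) (dB : \det B = 1).

Lemma det_letter l : \det (letter A B l) = 1.
Proof. by rewrite letterE; case: l.1 l.2 => -[]; rewrite ?det1_inv. Qed.

Lemma word_val_cons l w : word_val A B (l :: w) = letter A B l * word_val A B w.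
Proof. by rewrite /word_val big_cons. Qed.

Lemma word_val_cat w w' : word_val A B (w ++ w') = word_val A B w * word_val A B w'.
Proof. by rewrite /word_val big_cat. Qed.

Lemma word_val_nil : word_val A B [::] = 1.
Proof. by rewrite /word_val big_nil. Qed.

Lemma word_val_seq1 l : word_val A B [:: l] = letter A B l.
Proof. by rewrite word_val_cons word_val_nil mulr1. Qed.

Lemma det_word w : \det (word_val A B w) = 1.
Proof.
elim: w => [|l w IH]; first by rewrite word_val_nil det1.
by rewrite word_val_cons; apply: det1_mul => //; apply: det_letter.
Qed.

Lemma generated_det g : generated A B g -> \det g = 1.
Proof. by move=> [w _ <-]; apply: det_word. Qed.

Lemma generated1 : generated A B 1.
Proof. by exists [::] => //; rewrite word_val_nil. Qed.

Lemma generated_mul g h : generated A B g -> generated A B h -> generated A B (g * h).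
Proof. by move=> [w _ <-] [w' _ <-]; exists (w ++ w') => //; rewrite word_val_cat. Qed.

Lemma letter_inv l : (letter A B l)^-1 = letter A B (l.1, ~~ l.2).
Proof. by rewrite !letterE; case: l.1 l.2 => -[] /=; rewrite ?invrK. Qed.

Lemma generated_letter l : generated A B (letter A B l).
Proof. by exists [:: l] => //; rewrite word_val_seq1. Qed.

Lemma generated_inv g : generated A B g -> generated A B g^-1.
Proof.
move=> [w _ <-]; elim: w => [|l w IH]; first by rewrite word_val_nil invr1; apply: generated1.
rewrite word_val_cons invrM; try exact/det1_unit/det_word; last exact/det1_unit/det_letter.
by apply: generated_mul => //; rewrite letter_inv; apply: generated_letter.
Qed.

Lemma generated_ind (Q : 'M[Cplx R]_2 -> Prop) : Q 1 -> Q A -> Q B ->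
  (forall g h, \det g = 1 -> \det h = 1 -> Q g -> Q h -> Q (g * h)) ->
  (forall g, \det g = 1 -> Q g -> Q g^-1) -> forall g, generated A B g -> Q g.
Proof.
move=> Q1 QA QB QM QV _ [w _ <-]; elim: w => [|l w IH]; first by rewrite word_val_nil.
rewrite word_val_cons; apply: QM => //; [exact: det_letter|exact: det_word|].
by rewrite letterE; case: l.1 l.2 => -[] //=; apply: QV.
Qed.

End Generators.

Section Palindromes.
Context (A B : 'M[Cplx R]_2) (dA : \det A = 1) (dB : \det B = 1)
  (sA : A 0 0 = A 1 1) (sB : B 0 0 = B 1 1).

Lemma flip_letter l : flip (letter A B l) = letter A B l.
Proof.
have [a1 a2 a3 a4] := inv22 dA; have [b1 b2 b3 b4] := inv22 dB.
by apply: flip_id; rewrite letterE; case: l.1 l.2 => -[]; rewrite ?a1 ?a4 ?b1 ?b4.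
Qed.

(* flip is the anti-automorphism of SL2 induced by the half-turn about the axis: it fixes both generators. *)
Lemma word_val_rev w : word_val A B (rev w) = flip (word_val A B w).
Proof.
elim: w => [|l w IH]; first by rewrite word_val_nil flip1.
rewrite rev_cons -cats1 word_val_cat word_val_seq1 IH word_val_cons flipM.
by rewrite flip_letter.
Qed.

(** Equality of the diagonal entries is the matrix form of inversion by the half-turn. The half-turn
    thus normalises the group without having to belong to it. *)
Lemma half_turn_conj M : \det M = 1 -> M 0 0 = M 1 1 -> half_turn * M * half_turn^-1 = M^-1.
Proof.
move=> dM sM; have [m1 m2 m3 m4] := inv22 dM; have [h1 h2 h3 h4] := inv22 (@det_half_turn R).
have ii : 'i%C * 'i%C = -1 :> Cplx R by apply/eqP; rewrite eq_complex /=; apply/andP; split; apply/eqP; ring.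
apply: mx22_eq; rewrite ?m1 ?m2 ?m3 ?m4 !mul2E ?h1 ?h2 ?h3 ?h4 !half_turnE ?sM.
- transitivity (- ('i%C * 'i%C) * M 1 1 : Cplx R); first by ring.
  by rewrite ii opprK mul1r.
- transitivity (('i%C * 'i%C) * M 0 1 : Cplx R); first by ring.
  by rewrite ii mulN1r.
- transitivity (('i%C * 'i%C) * M 1 0 : Cplx R); first by ring.
  by rewrite ii mulN1r.
- transitivity (- ('i%C * 'i%C) * M 1 1 : Cplx R); first by ring.
  by rewrite ii opprK mul1r.
Qed.

Lemma generated_half_turn g : generated A B g -> generated A B (half_turn * g * half_turn^-1).
Proof.
have uE := det1_unit (@det_half_turn R).
move: g; apply: (generated_ind dA dB).
- by rewrite mulr1 mulrV//; apply: generated1.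
- by rewrite half_turn_conj//; apply: generated_inv => //; apply: (generated_letter A B (true, false)).
- by rewrite half_turn_conj//; apply: generated_inv => //; apply: (generated_letter A B (false, false)).
- move=> g h _ _ Gg Gh; have := generated_mul Gg Gh.
  by rewrite -!mulrA mulKr.
- move=> g dg IHg; have ug := det1_unit dg.
  suff <- : (half_turn * g * half_turn^-1)^-1 = half_turn * g^-1 * half_turn^-1.
    by apply: generated_inv.
  rewrite invrM; [|by apply/det1_unit/det1_mul => //; exact: det_half_turn|by rewrite unitrV].
  by rewrite invrK invrM// mulrA.
Qed.

End Palindromes.
End Words.

(** * Contraction towards a limit point *)

Section Convergence.
Context {R : realType}.
Implicit Types (g h : 'M[Cplx R]_2) (xi x y e : Chat R) (z c d u v : Cplx R) (G : set 'M[Cplx R]_2).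

Lemma seq_lower_bound (T : eqType) (s : seq T) (f : T -> R) : (forall t, t \in s -> 0 < f t) ->
  exists2 d : R, 0 < d & forall t, t \in s -> d <= f t.
Proof.
elim: s => [|a s IH] H; first by exists 1.
have [|d d0 Hd] := IH; first by move=> t ts; apply: H; rewrite inE ts orbT.
exists (Num.min d (f a)); first by rewrite lt_min d0 H// inE eqxx.
move=> t; rewrite inE => /predU1P[->|/Hd h]; first by rewrite ge_min lexx orbT.
by rewrite ge_min h.
Qed.

Lemma sqn_CS (a b u v : Cplx R) : sqn (a * u + b * v) <= (sqn a + sqn b) * (sqn u + sqn v).
Proof.
move: a b u v => [a a'] [b b'] [u u'] [v v']; rewrite -subr_ge0 /sqn /=.
rewrite (_ : _ - _ = (a * v + a' * v' - (b * u + b' * u')) ^+ 2 +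
  (a * v' - a' * v - (b' * u - b * u') * (-1)) ^+ 2); last by ring.
by rewrite addr_ge0 ?sqr_ge0.
Qed.

Lemma sqnD_le u v : sqn (u + v) <= 2 * (sqn u + sqn v).
Proof. by have := sqn_CS 1 1 u v; rewrite !mul1r (_ : sqn 1 + sqn 1 = 2)//; rewrite /sqn /=; ring. Qed.

Definition nrmC xi : R := sqn (vec1 xi) + sqn (vec2 xi).

Lemma nrmC_gt0 xi : 0 < nrmC xi.
Proof. by case: xi => [z|]; rewrite /nrmC /= /sqn /=; [have := sqr_ge0 (complex.Re z); have := sqr_ge0 (complex.Im z)|]; lra. Qed.

(* A row vector cannot be nearly orthogonal to two distinct points of the sphere. *)
Lemma at_most_one_bad (s : seq (Chat R)) : exists2 d : R, 0 < d & forall x y c b, x \in s -> y \in s ->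
  sqn (c * vec1 x + b * vec2 x) < d * (sqn c + sqn b) ->
  sqn (c * vec1 y + b * vec2 y) < d * (sqn c + sqn b) -> x = y.
Proof.
pose f (t : Chat R * Chat R) : R := if t.1 == t.2 then 1 else
  hpair (lbd t.1) (lbd t.2) / (2 * (nrmC t.1 + nrmC t.2)).
have [t|d d0 Hd] := @seq_lower_bound _ [seq (x, y) | x <- s, y <- s] f.
  move=> _; rewrite /f; case: eqVneq => // /eqP tt.
  by rewrite divr_gt0 ?hpair_lbd_gt0// mulr_gt0// addr_gt0 // nrmC_gt0.
exists d => // x y c b xs ys hx hy; apply/eqP; apply: contraT => xy.
have := Hd (x, y) (allpairs_f _ xs ys); rewrite /f /= (negPf xy) => dxy.
have Nx := nrmC_gt0 x; have Ny := nrmC_gt0 y.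
have E : hpair (lbd x) (lbd y) = sqn (vec1 x * vec2 y - vec1 y * vec2 x).
  by case: x y {xs ys hx hy xy dxy Nx Ny} => [[? ?]|] [[? ?]|]; rewrite /hpair /= /sqn /=; ring.
have c0 := sqn_ge0 c; have b0 := sqn_ge0 b.
have Nxy := addr_gt0 Nx Ny; move: dxy; rewrite ler_pdivlMr; last by rewrite mulr_gt0.
move=> dxy.
(* Cramer's rule: eliminating b, respectively c, between the two linear forms leaves c, respectively
   b, times the determinant of x and y. *)
have h1 : sqn (vec1 x * vec2 y - vec1 y * vec2 x) * (sqn c + sqn b) <=
    2 * (sqn (c * vec1 x + b * vec2 x) * nrmC y + sqn (c * vec1 y + b * vec2 y) * nrmC x).
  have k1 := sqnD_le ((c * vec1 x + b * vec2 x) * vec2 y) (- ((c * vec1 y + b * vec2 y) * vec2 x)).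
  have k2 := sqnD_le ((c * vec1 x + b * vec2 x) * vec1 y) (- ((c * vec1 y + b * vec2 y) * vec1 x)).
  move: k1 k2; rewrite !sqnN !sqnM.
  have -> : (c * vec1 x + b * vec2 x) * vec2 y - (c * vec1 y + b * vec2 y) * vec2 x =
    c * (vec1 x * vec2 y - vec1 y * vec2 x) by ring.
  have -> : (c * vec1 x + b * vec2 x) * vec1 y - (c * vec1 y + b * vec2 y) * vec1 x =
    - (b * (vec1 x * vec2 y - vec1 y * vec2 x)) by ring.
  by rewrite sqnN !sqnM /nrmC; lra.
move: dxy; rewrite E => dxy.
have n0 : 0 < sqn c + sqn b.
  rewrite lt_def addr_ge0// andbT; apply/eqP => z0; move: hx; rewrite z0 mulr0 ltNge sqn_ge0//.
move: h1 dxy hx hy; move: (sqn (_ - _)) (sqn (c * vec1 x + _)) (sqn (c * vec1 y + _)) (sqn c + sqn b) n0 (nrmC x) (nrmC y) Nx Ny.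
move=> D X Y n n0 a b' a0 b'0 h1 h2 h3 h4.
have h5 : d * (2 * (a + b')) * n <= D * n by rewrite ler_wpM2r// ltW.
have h6 : X * b' < d * n * b' by rewrite ltr_pM2r.
have h7 : Y * a < d * n * a by rewrite ltr_pM2r.
have : d * (2 * (a + b')) * n = 2 * (d * n * b' + d * n * a) by ring.
lra.
Qed.

Section Orbit.
Context (G : set 'M[Cplx R]_2) (G1 : G 1) (GM : forall g h, G g -> G h -> G (g * h))
  (GV : forall g, G g -> G g^-1) (Gdet : forall g, G g -> \det g = 1) (Gne : ~ elementary G).

(** If every k in G sent some point of F to q, the orbit of q under inverses would lie in the finite
    set F. *)
Lemma orbit_escape (F : seq (Chat R)) q : exists2 k, G k & forall e, e \in F -> mobius k e <> q.
Proof.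
apply: contrapT => H; apply: Gne; exists q.
apply: (@sub_finite_set _ _ [set` F]); last exact: finite_seq.
move=> _ [g Gg <-] /=; apply: contrapT => nF; apply: H; exists g^-1; first exact: GV.
move=> e eF eq; apply: nF; rewrite -eq mobiusVK ?Gdet//.
Qed.

(* An element of G taking a base point near z contracts all but a neighbourhood of one
   point, and one of finitely many translates of F avoids that neighbourhood. *)
Lemma limit_set_attracts z (F : seq (Chat R)) (eta : R) : limit_set G (Some z) -> 0 < eta ->
  exists2 h, G h & forall e, e \in F -> exists2 w, mobius h e = Some w & sqn (w - z) < eta.
Proof.
move=> /limit_setE-/(_ Gdet) Kz eta0.
have /choice[k Hk] : forall q : Chat R, exists h, G h /\ forall e, e \in F -> mobius h e <> q.
  by move=> q; have [h Gh Hh] := orbit_escape F q; exists h.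
pose N := F ++ [seq mobius (k q) e | q <- F, e <- F].
have [d d0 Hd] := at_most_one_bad N.
have [m m0 Hm] := @seq_lower_bound _ N (fun e => (nrmC e)^-1)
  (fun e _ => etrans (invr_gt0 _) (nrmC_gt0 e)).
pose D := 2 * (1 + 2 * sqn z).
have D0 : 0 < D by rewrite /D; have := sqn_ge0 z; lra.
(* The bound 1/4 absorbs a term as in [nbhs_limit_set]. The other bound serves the final quotient,
   whose numerator is below eps D (|c|^2 + |e|^2) [nrmC y], whose denominator is at least d (|c|^2 +
   |e|^2), and where m [nrmC y] is at most 1. *)
pose eps := Num.min (1 / 4) (eta * d * m / D).
have eps0 : 0 < eps by rewrite lt_min; apply/andP; split; [lra|rewrite divr_gt0// !mulr_gt0].
have eps1 : eps <= 1 / 4 by rewrite /eps ge_min lexx.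
have eps2 : eps * D <= eta * d * m by rewrite -ler_pdivlMr// /eps ge_min lexx orbT.
have [g Gg hg] := Kz eps eps0.
pose a := g 0 0; pose b := g 0 1; pose c := g 1 0; pose e := g 1 1.
(* Either no point of F is nearly killed by the second row of g, or some q is. By the choice of d, q
   is then the only such point among those of N, and the translate of F by [k q] avoids it. *)
have good : exists2 k', G k' & forall x, x \in F -> mobius k' x \in N /\
    d * (sqn c + sqn e) <= sqn (c * vec1 (mobius k' x) + e * vec2 (mobius k' x)).
  have [all|] := pselect (forall x, x \in F -> d * (sqn c + sqn e) <= sqn (c * vec1 x + e * vec2 x)).
    by exists 1 => // x xF; rewrite mobius1; split; [rewrite mem_cat xF|exact: all].
  move=> /existsNP[q /not_implyP[qF /negP]]; rewrite -ltNge => bq.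
  have [Gk kq] := Hk q; exists (k q) => // x xF.
  have xN : mobius (k q) x \in N by rewrite mem_cat; apply/orP; right; apply: allpairs_f.
  split=> //; rewrite leNgt; apply/negP => bx; apply: (kq x xF).
  by apply: Hd bx bq => //; rewrite mem_cat qF.
have [k' Gk' Hk'] := good; exists (g * k'); first exact: GM.
move=> x xF; have [xN gx] := Hk' x xF; rewrite mobius_mul ?Gdet//.
move: (mobius k' x) xN gx => y yN gy {x xF}.
have dg := Gdet Gg.
have ga0 : 0 < sqn c + sqn e.
  rewrite lt_def addr_ge0 ?sqn_ge0// andbT; apply/eqP => z0.
  have /eqP c0 : sqn c == 0 by rewrite eq_le sqn_ge0 andbT -z0 lerDl sqn_ge0.
  have /eqP e0 : sqn e == 0 by rewrite eq_le sqn_ge0 andbT -z0 lerDr sqn_ge0.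
  move/eqP: c0; rewrite sqn_eq0 => /eqP c0; move/eqP: e0; rewrite sqn_eq0 => /eqP e0.
  by move: dg; rewrite det2E -/c -/e c0 e0 !mulr0 subrr => /eqP; rewrite eq_sym oner_eq0.
have yp : 0 < sqn (c * vec1 y + e * vec2 y) by apply: lt_le_trans gy; rewrite mulr_gt0.
have yn : c * vec1 y + e * vec2 y != 0 by rewrite -sqn_gt0.
rewrite mobiusE /toC -/a -/b -/c -/e (negPf yn).
eexists; first by [].
have -> : (a * vec1 y + b * vec2 y) / (c * vec1 y + e * vec2 y) - z =
    ((a - z * c) * vec1 y + (b - z * e) * vec2 y) / (c * vec1 y + e * vec2 y) by field.
rewrite sqnM sqnV ltr_pdivrMr//.
apply: le_lt_trans (sqn_CS _ _ _ _) _; rewrite -/(nrmC y).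
have E1 : hpair (hact g herm1) (lbd (Some z)) = sqn (a - z * c) + sqn (b - z * e).
  rewrite /hact -/a -/b -/c -/e; move: (a) (b) (c) (e) (z) => [? ?] [? ?] [? ?] [? ?] [? ?].
  by rewrite /hpair /= /sqn /=; ring.
have E2 : nrm (hact g herm1) = sqn a + sqn b + (sqn c + sqn e).
  rewrite nrmE /hact -/a -/b -/c -/e; move: (a) (b) (c) (e) => [? ?] [? ?] [? ?] [? ?].
  by rewrite /= /sqn /=; ring.
have h1 : sqn a + sqn b <= 2 * (sqn (a - z * c) + sqn (b - z * e)) + 2 * sqn z * (sqn c + sqn e).
  have := sqnD_le (a - z * c) (z * c); have := sqnD_le (b - z * e) (z * e).
  by rewrite !subrK !sqnM; lra.
move: hg; rewrite E1 E2 => hg.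
have ny := nrmC_gt0 y; have my : m * nrmC y <= 1 by rewrite -ler_pdivlMr// div1r Hm.
move: (sqn (a - z * c) + _) (sqn a + sqn b) (sqn c + sqn e) (sqn (c * vec1 y + _)) (nrmC y)
  h1 hg ga0 gy yp ny my => p q n t N' h1 hg n0 nt t0 N0 mN.
have z0 := sqn_ge0 z.
have p0 : p < eps * D * n.
  have : eps * (q + n) <= eps * (2 * p + (2 * sqn z + 1) * n) by rewrite ler_pM2l//; lra.
  have : eps * (2 * p + (2 * sqn z + 1) * n) = 2 * (eps * p) + eps * D * n / 2.
    by rewrite /D; field.
  have [pp|pp] := leP 0 p; last first.
    by move=> _ _; apply: (lt_trans pp); rewrite mulr_gt0// mulr_gt0.
  by have := ler_wpM2r pp eps1; lra.
have p1 : p * N' < eps * D * n * N' by rewrite ltr_pM2r.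
have p2 : eps * D * n * N' <= eta * d * m * n * N'.
  by rewrite ler_wpM2r ?(ltW N0)// ler_wpM2r// ltW.
have p3 : eta * d * n * (m * N') <= eta * d * n * 1.
  by rewrite ler_wpM2l// ltW// mulr_gt0// mulr_gt0.
have p4 : eta * (d * n) <= eta * t by rewrite ler_pM2l.
have -> : eta * t = eta * t + 0 by rewrite addr0.
have : eta * d * m * n * N' = eta * d * n * (m * N') by ring.
lra.
Qed.

End Orbit.
End Convergence.

(** * Axes of palindromes close to a given diameter *)

Section PalindromeAxes.
Context {R : realType}.
Implicit Types (g h M J : 'M[Cplx R]_2) (xi x y e : Chat R) (z c d u v s X : Cplx R).

(* e1 and e2 are the fixed points of the half-turn J * half_turn. *)
Lemma symmetric_form_factor J : \det J = 1 -> J 0 0 = J 1 1 ->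
  exists e1 e2 (k : Cplx R), k != 0 /\ forall x y : Cplx R,
    J 0 1 * x ^+ 2 + 2 * J 0 0 * x * y + J 1 0 * y ^+ 2 =
    k * ((x * vec1 e1 + y * vec2 e1) * (x * vec1 e2 + y * vec2 e2)).
Proof.
rewrite det2E => + sJ; rewrite -sJ; move: (J 0 0) (J 0 1) (J 1 0) => p q r dJ.
have [r0|r0] := eqVneq r 0.
  have p0 : p != 0 by apply/eqP => p0; move/eqP: dJ; rewrite p0 r0 !mulr0 subrr eq_sym oner_eq0.
  have two : (2 : Cplx R) != 0 by rewrite pnatr_eq0.
  exists None, (Some (q / (2 * p))), (2 * p); split; first by rewrite mulf_neq0.
  by move=> x y /=; rewrite r0; field; rewrite p0.
(* The determinant condition gives p^2 - q r = 1, so the roots need no square root. *)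
exists (Some ((p + 1) / r)), (Some ((p - 1) / r)), r; split=> // x y /=.
have -> : q = (p ^+ 2 - 1) / r.
  by apply: (mulIf r0); rewrite divfK// -dJ; ring.
by field.
Qed.

(** The same quadratic form at the two rows of h: factored by [symmetric_form_factor], its values
    are products of the numerators, respectively denominators, of the images of e1 and e2 under h,
    so [W 0 1] / [W 1 0] is the product of these images. *)
Lemma palindrome_entries J h :
  let W := h * J * flip h in J 0 0 = J 1 1 ->
  [/\ W 0 0 = W 1 1,
      W 0 1 = J 0 1 * h 0 0 ^+ 2 + 2 * J 0 0 * h 0 0 * h 0 1 + J 1 0 * h 0 1 ^+ 2 &
      W 1 0 = J 0 1 * h 1 0 ^+ 2 + 2 * J 0 0 * h 1 0 * h 1 1 + J 1 0 * h 1 1 ^+ 2].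
Proof.
move=> W sJ; have [f1 f2 f3 f4] := flipE h.
by rewrite /W; split; rewrite !mul2E ?f1 ?f2 ?f3 ?f4 -sJ; ring.
Qed.

Lemma mobius_Some_eq g e z : mobius g e = Some z ->
  g 1 0 * vec1 e + g 1 1 * vec2 e != 0 /\
  g 0 0 * vec1 e + g 0 1 * vec2 e = z * (g 1 0 * vec1 e + g 1 1 * vec2 e).
Proof. by rewrite mobiusE /toC; case: eqVneq => // n0 [<-]; rewrite divfK. Qed.

Lemma axis_ends_symmetric M s : \det M = 1 -> M 0 0 = M 1 1 -> M 1 0 != 0 ->
  M 0 1 = s ^+ 2 * M 1 0 -> axis_ends M (Some s) (Some (- s)).
Proof.
rewrite /axis_ends det2E => + sM c0 b0; rewrite -sM b0 => dM.
have E : mobius M None = None -> False by rewrite mobiusE /toC /= mulr1 mulr0 addr0 (negPf c0).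
apply/seteqP; split=> [[z|] H|_ [->|->]]; last 2 first.
- have n0 : M 1 0 * s + M 0 0 != 0.
    apply/eqP => n0; move/eqP: dM; rewrite (_ : _ - _ = (M 1 0 * s + M 0 0) * (M 0 0 - M 1 0 * s)); last by ring.
    by rewrite n0 mul0r eq_sym oner_eq0.
  rewrite /mkset mobiusE /toC /= !mulr1 -sM b0 (negPf n0); congr Some.
  by apply: (mulIf n0); rewrite divfK//; ring.
- have n0 : M 1 0 * (- s) + M 0 0 != 0.
    apply/eqP => n0; move/eqP: dM; rewrite (_ : _ - _ = (M 1 0 * (- s) + M 0 0) * (M 0 0 + M 1 0 * s)); last by ring.
    by rewrite n0 mul0r eq_sym oner_eq0.
  rewrite /mkset mobiusE /toC /= !mulr1 -sM b0 (negPf n0); congr Some.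
  by apply: (mulIf n0); rewrite divfK//; ring.
- have := H : mobius M (Some z) = Some z; rewrite mobiusE /toC /= !mulr1 -sM b0; case: eqVneq => // n0 [] e.
  have : (z - s) * (z + s) = 0.
    apply: (mulIf c0); rewrite mul0r.
    have : z * (M 1 0 * z + M 0 0) = M 0 0 * z + s ^+ 2 * M 1 0 by rewrite -{1}e divfK.
    by move=> /eqP; rewrite -subr_eq0 => /eqP <-; ring.
  move/eqP; rewrite mulf_eq0 subr_eq0 addr_eq0 => /orP[]/eqP ->; [by left|by right].
- by case: (E H).
Qed.

(** Of the two square roots take the one with |s - X| <= |s + X|; then |s - X|^2 is at most |s^2 -
    X^2|, which is small. *)
Lemma close_sqrt X (eta : R) : 0 < eta -> exists2 del : R, 0 < del &
  forall z1 z2, sqn (z1 - X) < del -> sqn (z2 - X) < del ->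
  exists2 s, s ^+ 2 = z1 * z2 & sqn (s - X) < eta.
Proof.
move=> eta0; have X0 := sqn_ge0 X.
pose del := Num.min 1 (eta ^+ 2 / (4 + 8 * sqn X)).
have D0 : 0 < 4 + 8 * sqn X by lra.
have del0 : 0 < del by rewrite lt_min ltr01 divr_gt0// exprn_gt0.
exists del => // z1 z2 h1 h2.
have d1 : del <= 1 by rewrite /del ge_min lexx.
have d2 : del * (4 + 8 * sqn X) <= eta ^+ 2.
  by rewrite -ler_pdivlMr// /del ge_min lexx orbT.
have E : sqn (z1 * z2 - X ^+ 2) < eta ^+ 2.
  have -> : z1 * z2 - X ^+ 2 = (z1 - X) * (z2 - X) + X * ((z1 - X) + (z2 - X)) by ring.
  have := sqnD_le ((z1 - X) * (z2 - X)) (X * ((z1 - X) + (z2 - X))).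
  have := sqnD_le (z1 - X) (z2 - X); rewrite !sqnM => k1 k2.
  apply: le_lt_trans k2 _; apply: lt_le_trans d2.
  have a0 := sqn_ge0 (z1 - X); have b0 := sqn_ge0 (z2 - X).
  have k3 : sqn X * sqn (z1 - X + (z2 - X)) <= sqn X * (4 * del).
    by rewrite ler_wpM2l//; lra.
  have k4 : sqn (z1 - X) * sqn (z2 - X) <= del * sqn (z2 - X).
    by rewrite ler_wpM2r// ltW.
  have k5 : del * sqn (z2 - X) < del * 1 by rewrite ltr_pM2l//; lra.
  lra.
have [s0 s0E] : exists s : Cplx R, s ^+ 2 = z1 * z2.
  by exists (sqrtc (z1 * z2)); exact: sqr_sqrtc.
have F (s : Cplx R) : s ^+ 2 = z1 * z2 -> sqn (s - X) <= sqn (s + X) ->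
    exists2 s, s ^+ 2 = z1 * z2 & sqn (s - X) < eta.
  move=> sE le; exists s => //.
  have : sqn (s - X) ^+ 2 < eta ^+ 2.
    apply: le_lt_trans E; rewrite -sE.
    have -> : s ^+ 2 - X ^+ 2 = (s - X) * (s + X) by ring.
    rewrite sqnM.
    by rewrite expr2 ler_wpM2l// sqn_ge0.
  by rewrite ltr_pXn2r// nnegrE ?sqn_ge0// ltW.
have [le|lt] := leP (sqn (s0 - X)) (sqn (s0 + X)); first exact: F le.
apply: (F (- s0)); first by rewrite sqrrN.
by rewrite -opprD sqnN -[- s0 + X]opprK opprD opprK sqnN ltW.
Qed.

Section Approximation.
Context (A B : 'M[Cplx R]_2) (dA : \det A = 1) (dB : \det B = 1)
  (sA : A 0 0 = A 1 1) (sB : B 0 0 = B 1 1) (Gne : ~ elementary (generated A B)).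

(** The condition [s <> X] is what accumulation requires. It may fail for a single palindrome, and
    three of them built from the same h are compared. *)
Lemma palindrome_axes_approx X (eta : R) : limit_set (generated A B) (Some X) -> X <> 0 -> 0 < eta ->
  exists s, [/\ sqn (s - X) < eta, s <> X & palindrome_axes A B (Some s, Some (- s))].
Proof.
move=> KX X0 eta0; pose G := generated A B.
have sX : 0 < sqn X by rewrite sqn_gt0; apply/eqP.
(* The bound [sqn X] keeps s away from 0, so that s and - s are distinct. *)
have eta'0 : 0 < Num.min eta (sqn X) by rewrite lt_min eta0.
have [del del0 Hdel] := close_sqrt X eta'0.
pose pal (J : 'M[Cplx R]_2) := exists2 w, rev w = w & word_val A B w = J.
have pal1 : pal 1 by exists [::] => //; rewrite word_val_nil.
have palA : pal A by exists [:: (true, false)] => //; rewrite word_val_seq1.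
have palB : pal B by exists [:: (false, false)] => //; rewrite word_val_seq1.
have d1 : \det (1 : 'M[Cplx R]_2) = 1 by rewrite det1.
have s1 : (1 : 'M[Cplx R]_2) 0 0 = (1 : 'M[Cplx R]_2) 1 1 by rewrite !mxE.
have [e1 [e2 [k1 [k10 F1]]]] := symmetric_form_factor d1 s1.
have [e3 [e4 [k2 [k20 F2]]]] := symmetric_form_factor dA sA.
have [e5 [e6 [k3 [k30 F3]]]] := symmetric_form_factor dB sB.
have [h Gh Hh] := limit_set_attracts (@generated1 _ A B) (@generated_mul _ A B) (generated_inv dA dB)
  (generated_det dA dB) Gne [:: e1; e2; e3; e4; e5; e6] KX del0.
have dh := generated_det dA dB Gh.
have core J e e' k : \det J = 1 -> J 0 0 = J 1 1 -> pal J -> k != 0 ->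
   (forall x y : Cplx R, J 0 1 * x ^+ 2 + 2 * J 0 0 * x * y + J 1 0 * y ^+ 2 =
    k * ((x * vec1 e + y * vec2 e) * (x * vec1 e' + y * vec2 e'))) ->
   e \in [:: e1; e2; e3; e4; e5; e6] -> e' \in [:: e1; e2; e3; e4; e5; e6] ->
   (exists s, [/\ sqn (s - X) < eta, s <> X & palindrome_axes A B (Some s, Some (- s))]) \/
   mobius (h * J * flip h) (Some X) = Some X.
  move=> dJ sJ [w rw wJ] k0 F eF eF'.
  have [z1 m1 z1X] := Hh e eF; have [z2 m2 z2X] := Hh e' eF'.
  have [y1n x1E] := mobius_Some_eq m1; have [y2n x2E] := mobius_Some_eq m2.
  have [W00 W01 W10] := @palindrome_entries J h sJ.
  set W := h * J * flip h in W00 W01 W10 *.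
  have flh : exists2 w', word_val A B w' = h & word_val A B (rev w') = flip h.
    by case: Gh => w' _ <-; exists w' => //; apply: word_val_rev.
  have dW : \det W = 1.
    rewrite /W; have [w' _ <-] := flh.
    by apply: det1_mul; [exact: det1_mul|exact: det_word].
  have palW : pal W.
    have [w' wh e'h] := flh; exists (w' ++ w ++ rev w').
      by rewrite !rev_cat revK rw catA.
    by rewrite !word_val_cat wJ /W e'h wh mulrA.
  rewrite F in W10; rewrite F x1E x2E in W01.
  have c0 : W 1 0 != 0 by rewrite W10 !mulf_neq0.
  have b0 : W 0 1 = z1 * z2 * W 1 0 by rewrite W01 W10; ring.
  have [s sE sX'] := Hdel _ _ z1X z2X.
  rewrite -sE in b0.
  have ax := axis_ends_symmetric dW W00 c0 b0.
  move: sX'; rewrite lt_min => /andP[h1 h2].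
  have [eX|nX] := eqVneq s X.
    rewrite eX in ax; right; have : [set xi | mobius W xi = xi] (Some X) by rewrite ax; left.
    by [].
  left; exists s; split=> //; first by move/eqP; rewrite (negPf nX).
  split=> /=; last by have [w' r' eW] := palW; exists w' => //; rewrite eW.
  move=> [] /eqP; rewrite -addr_eq0 -mulr2n mulrn_eq0 /= => /eqP s0.
  by move: h2; rewrite s0 sub0r sqnN ltxx.
have := core _ _ _ _ d1 s1 pal1 k10 F1; rewrite !inE !eqxx !orbT => /(_ erefl erefl)[//|f1].
have := core _ _ _ _ dA sA palA k20 F2; rewrite !inE !eqxx !orbT => /(_ erefl erefl)[//|f2].
have := core _ _ _ _ dB sB palB k30 F3; rewrite !inE !eqxx !orbT => /(_ erefl erefl)[//|f3].
(* Otherwise the conjugates of A and B by h both fix X, and the group fixes the preimage of X. *)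
exfalso; apply: Gne; exists (mobius h^-1 (Some X)).
have dfl : \det (flip h) = 1.
  by case: Gh => w _ <-; rewrite -word_val_rev//; apply: det_word.
rewrite mulr1 in f1.
(* The palindrome with J = 1 identifies the images of X under [flip h] and h^-1; in the other two
   palindromes this cancels h and leaves J fixing that image. *)
have f1' : mobius (flip h) (Some X) = mobius h^-1 (Some X).
  by rewrite -[in RHS]f1 mobius_mul// mobiusK.
have fixJ J : \det J = 1 -> mobius (h * J * flip h) (Some X) = Some X ->
    mobius J (mobius h^-1 (Some X)) = mobius h^-1 (Some X).
  move=> dJ; rewrite mobius_mul// mobius_mul// f1' => fJ.
  by rewrite -[LHS](mobiusK _ dh) fJ.
have all g : G g -> mobius g (mobius h^-1 (Some X)) = mobius h^-1 (Some X).
  move: g; apply: (generated_ind dA dB).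
  - exact: mobius1.
  - exact: fixJ.
  - exact: fixJ.
  - by move=> g g' dg dg' hg hg'; rewrite mobius_mul// hg' hg.
  - by move=> g dg hg; rewrite -{1}hg mobiusK.
apply: (@sub_finite_set _ _ [set mobius h^-1 (Some X)]); last exact: finite_set1.
by move=> _ [g Gg <-]; rewrite all.
Qed.

End Approximation.
End PalindromeAxes.

(** * The dichotomy when the core geodesic is vertical *)

Section Normalisation.
Context {R : realType}.
Implicit Types (g h M A B : 'M[Cplx R]_2) (xi x y : Chat R) (z X : Cplx R) (G : set 'M[Cplx R]_2).

Lemma limit_set_copp A B xi : \det A = 1 -> \det B = 1 -> A 0 0 = A 1 1 -> B 0 0 = B 1 1 ->
  limit_set (generated A B) xi -> limit_set (generated A B) (copp xi).
Proof.
move=> dA dB sA sB; have Gd := generated_det dA dB.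
move=> /(limit_setE _ Gd)/(near_base_conj Gd (@det_half_turn R)); rewrite mobius_half_turn => H.
apply/(limit_setE _ Gd) => e /H[_ [k Gk <-] hk].
by exists (half_turn * k * half_turn^-1) => //; apply: generated_half_turn.
Qed.

(** The cases are separated by whether Q1 or Q2 is pleated. The facts [X <> 0] and [K (Some X)] are
    recorded for [palindrome_axes_approx]. *)
Lemma symmetric_dichotomy A B (Q1 Q2 : Pt R) : \det A = 1 -> \det B = 1 -> A 0 0 = A 1 1 -> B 0 0 = B 1 1 ->
  let K := limit_set (generated A B) in let C := hull K in
  let L := geodesic (Some 0) None in
  endpoints L (L `&` C) = [set Q1; Q2] ->
  (exists X, [/\ leaf (frontier C) (Some X) (Some (- X)),
     exists2 Q, Q = Q1 \/ Q = Q2 & orthogonal_at (Some X) (Some (- X)) (Some 0) None Q,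
     X <> 0 & K (Some X)]) \/
  [/\ forall x y, leaf (frontier C) x y -> geodesic x y `&` (L `&` C) = set0,
      exists2 D, complementary_component (frontier C) D & D Q1,
      exists2 D, complementary_component (frontier C) D & D Q2 &
      ~ maximal_pleating (frontier C)].
Proof.
move=> dA dB sA sB K C L eQ; have Gd := generated_det dA dB.
have Kopp xi : K xi -> K (copp xi) by apply: limit_set_copp.
have Kcl z : (forall e : R, 0 < e -> exists2 w, K (Some w) & sqn (z - w) < e) -> K (Some z).
  exact: limit_set_closed.
have LQ Q : Q = Q1 \/ Q = Q2 -> L Q.
  by move=> QQ; have : [set Q1; Q2] Q by []; rewrite -eQ => -[[]].
have ext Q : Q = Q1 \/ Q = Q2 -> exists z (s : R), [/\ K (Some z), sqn z = Q.2 ^+ 2, s != 0 &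
    forall Y, in_cone K Y -> s * sphere (Q.2 ^+ 2) Y <= 0].
  by move=> QQ; apply: (endpoint_extremal Kopp Kcl); rewrite -/C -/L eQ.
have leafQ Q : Q = Q1 \/ Q = Q2 -> pleating_locus (frontier C) Q ->
   exists X, [/\ leaf (frontier C) (Some X) (Some (- X)),
     exists2 Q, Q = Q1 \/ Q = Q2 & orthogonal_at (Some X) (Some (- X)) (Some 0) None Q,
     X <> 0 & K (Some X)].
  move=> QQ plQ; have [z [s [Kz zT s0 H]]] := ext Q QQ; have lQ := LQ Q QQ; have [Q0 _] := lQ.
  have T0 : 0 < Q.2 ^+ 2 by rewrite exprn_gt0.
  have [h1 h2] := pleated_top_leaf Kopp Kz zT T0 s0 H lQ erefl plQ.
  exists z; split=> //; first by exists Q.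
  by move=> z0; move: T0; rewrite -zT z0 sqn0 ltxx.
have [p1|n1] := pselect (pleating_locus (frontier C) Q1).
  by left; apply: (leafQ Q1) => //; left.
have [p2|n2] := pselect (pleating_locus (frontier C) Q2).
  by left; apply: (leafQ Q2) => //; right.
right; have SQ Q : Q = Q1 \/ Q = Q2 -> frontier C Q.
  move=> QQ; have [z [s [Kz zT s0 H]]] := ext Q QQ; have [Q0 Q10] := LQ Q QQ.
  apply: (diameter_frontier Kopp Kz zT s0 H).
  apply/diameterE; split=> //; first by rewrite /sphere /= Q10 sqn0 zT add0r mulr1 subrr.
  by exists 0; rewrite Q10 scal0C.
have comp Q : Q = Q1 \/ Q = Q2 -> ~ pleating_locus (frontier C) Q ->
    exists2 D, complementary_component (frontier C) D & D Q.
  move=> QQ nQ; have SPQ : (frontier C `\` pleating_locus (frontier C)) Q by split=> //; exact: SQ.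
  exists (connected_component (frontier C `\` pleating_locus (frontier C)) Q); first by exists Q.
  exact: connected_component_refl.
have i1 : Q1 = Q1 \/ Q1 = Q2 by left.
have i2 : Q2 = Q1 \/ Q2 = Q2 by right.
split; [|exact: comp|exact: comp|].
  apply: (leaf_disjoint_axis (K := K) eQ); first by exists Q1; left.
  by move=> Q [] ->.
move=> mx; have [z [s [Kz zT s0 H]]] := ext Q1 i1; have [Q0 Q10] := LQ Q1 i1.
have T0 : 0 < Q1.2 ^+ 2 by rewrite exprn_gt0.
apply: (component_not_triangle Kopp T0 s0 H (LQ _ i1) erefl (SQ _ i1) n1 erefl).
by apply: mx; exists Q1 => //; split=> //; exact: SQ.
Qed.

Lemma normalising x y : x <> y -> exists g, [/\ \det g = 1, mobius g x = Some 0 & mobius g y = None].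
Proof.
move=> xy; pose D := vec1 x * vec2 y - vec2 x * vec1 y.
have D0 : D != 0.
  case: x y xy @D => [a|] [b|] xy /=; rewrite ?mulr1 ?mulr0 ?mul1r ?mul0r ?subr0 ?sub0r ?oppr_eq0 ?oner_neq0//.
  by rewrite subr_eq0; apply/eqP => ab; apply: xy; rewrite ab.
pose g : 'M[Cplx R]_2 := \matrix_(i, j)
  if i == 0 then (if j == 0 then vec2 x / D else - vec1 x / D) else (if j == 0 then vec2 y else - vec1 y).
have [g1 g2 g3 g4] : [/\ g 0 0 = vec2 x / D, g 0 1 = - vec1 x / D, g 1 0 = vec2 y & g 1 1 = - vec1 y].
  by rewrite !mxE.
exists g; split.
- by rewrite det2E g1 g2 g3 g4; rewrite -(divff D0) /D; ring.
- rewrite mobiusE g1 g2 g3 g4 /toC.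
  have -> : vec2 y * vec1 x + - vec1 y * vec2 x = D by rewrite /D; ring.
  rewrite (negPf D0); congr Some.
  by rewrite (_ : _ + _ = 0) ?mul0r//; ring.
- rewrite mobiusE g1 g2 g3 g4 /toC.
  have -> : vec2 y * vec1 y + - vec1 y * vec2 y = 0 by ring.
  by rewrite eqxx.
Qed.

Lemma axis_ends_conj g M x y : \det g = 1 -> \det M = 1 -> axis_ends M x y ->
  axis_ends (g * M * g^-1) (mobius g x) (mobius g y).
Proof.
rewrite /axis_ends => dg dM ax; have dV := det1_inv dg; have dgM := det1_mul dg dM.
have E xi : mobius (g * M * g^-1) xi = mobius g (mobius M (mobius g^-1 xi)).
  by rewrite !mobius_mul.
have fixE xi : mobius (g * M * g^-1) xi = xi <-> [set eta | mobius M eta = eta] (mobius g^-1 xi).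
  rewrite E; split=> /= [e|->]; last exact: mobiusVK.
  by rewrite -[in RHS]e mobiusK.
apply/seteqP; split=> [xi /fixE|_ [->|->]]; rewrite ?ax.
- by move=> -[] e; [left|right]; rewrite -e mobiusVK.
- by apply/fixE; rewrite ax mobiusK//; left.
- by apply/fixE; rewrite ax mobiusK//; right.
Qed.

(** If M has a single fixed point, at 0 or infinity, unequal diagonal entries would create a second
    one. Otherwise orthogonality to the vertical line forces y = - x, and a matrix fixing both x and
    - x has equal diagonal entries. *)
Lemma perpendicular_entries M x y : \det M = 1 -> axis_ends M x y ->
  perpendicular (Some 0) None x y -> M 0 0 = M 1 1.
Proof.
move=> dM ax; have fixP xi : mobius M xi = xi <-> xi = x \/ xi = y.
  by have := congr1 (fun s : set (Chat R) => s xi) ax => /= ->.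
move: dM; rewrite det2E => dM.
have fx : mobius M x = x by apply/fixP; left.
have fy : mobius M y = y by apply/fixP; right.
have one0 : (0 : Cplx R) = 1 -> False by move/eqP; rewrite eq_sym oner_eq0.
case=> [[xy]|[xy [p [[p0 p1] gxy d0]]]].
- rewrite -xy in fixP; have uniqx xi : mobius M xi = xi -> xi = x by move/fixP => -[].
  case=> x0; rewrite -x0 in fx uniqx.
  + move: fx; rewrite /mobius mulr0 add0r mulr0 add0r.
    case: eqVneq => // d0 [] /eqP; rewrite mulf_eq0 invr_eq0 (negPf d0) orbF => /eqP b0.
    rewrite b0 mul0r subr0 in dM.
    have c0 : M 1 0 != 0.
      by apply/eqP => c0; have := uniqx None; rewrite /mobius c0 eqxx => /(_ erefl).
    have a0 : M 0 0 != 0 by apply/eqP => a0; apply: one0; rewrite -dM a0 mul0r.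
    (* With 0 fixed, this is the other root of the fixed point equation. *)
    have e : mobius M (Some ((M 0 0 - M 1 1) / M 1 0)) = Some ((M 0 0 - M 1 1) / M 1 0).
      rewrite /mobius b0 addr0.
      have -> : M 1 0 * ((M 0 0 - M 1 1) / M 1 0) + M 1 1 = M 0 0 by field.
      by rewrite (negPf a0) mulrAC divff// mul1r.
    have [/eqP] := uniqx _ e.
    by rewrite mulf_eq0 invr_eq0 (negPf c0) orbF subr_eq0 => /eqP.
  + move: fx; rewrite /mobius; case: eqVneq => // c0 _.
    rewrite c0 mulr0 subr0 in dM.
    have d0 : M 1 1 != 0 by apply/eqP => d0; apply: one0; rewrite -dM d0 mulr0.
    apply/eqP; rewrite -subr_eq0; apply/eqP; apply: contrapT => /eqP ad.
    have da : M 1 1 - M 0 0 != 0 by rewrite -oppr_eq0 opprB.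
    have e : mobius M (Some (M 0 1 / (M 1 1 - M 0 0))) = Some (M 0 1 / (M 1 1 - M 0 0)).
      rewrite /mobius c0 mul0r add0r (negPf d0); congr Some; field.
      by rewrite d0 da.
    by have := uniqx _ e.
- have [a [b [ea eb]]] : exists a b, x = Some a /\ y = Some b.
    move: gxy d0; rewrite /dot; case: (x) (y) => [a|] [b|] h e; first by exists a, b.
    + by move/eqP: e; rewrite /= mulr1 !mul0r subr0 add0r oner_eq0.
    + by move/eqP: e; rewrite /= mulr1 !mul0r subr0 add0r oner_eq0.
    + by [].
  subst x y; move: gxy d0 => [_ [s [e1 e2]]].
  rewrite /dot [X in _ + X = 0]/= p1 !sub0r !sqnN.
  have -> : complex.Re (((0, 1) : Pt R).1 * conjc (b - a)) = 0 by rewrite /= mul0r.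
  rewrite add0r mul1r => /eqP; rewrite mulf_eq0 invr_eq0 mulf_eq0 pnatr_eq0 /= (gt_eqF p0) orbF.
  rewrite subr_eq0 => /eqP ab.
  have s0 : 0 < s * (1 - s) * sqn (b - a) by rewrite -e2 exprn_gt0.
  have n1 : (1 - s)%:C * a = - (s%:C * b).
    apply/eqP; rewrite -addr_eq0; have <- : a + s%:C * (b - a) = (1 - s)%:C * a + s%:C * b.
      by case: (a) (b) => [a1 a2] [b1 b2]; apply/eqP; rewrite eq_complex /=; apply/andP; split; apply/eqP; ring.
    by rewrite -e1 p1.
  have b0 : 0 < sqn b.
    rewrite lt_def sqn_ge0 andbT; apply/eqP => b0; move: s0; rewrite b0 in ab.
    move/eqP: b0; rewrite sqn_eq0 => /eqP ->; move/eqP: ab; rewrite eq_sym sqn_eq0 => /eqP ->.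
    by rewrite subrr sqn0 mulr0 ltxx.
  have ss : s = 1 / 2.
    have : (1 - s) ^+ 2 * sqn b = s ^+ 2 * sqn b by rewrite {1}ab -!sqn_scal n1 sqnN.
    move=> /(mulIf (lt0r_neq0 b0)) h.
    have : (1 - s) ^+ 2 - s ^+ 2 = 1 - 2 * s by ring.
    by rewrite h subrr; lra.
  have eba : b = - a.
    move: n1; rewrite ss; case: (a) (b) => [a1 a2] [b1 b2] /eqP; rewrite eq_complex /=.
    by move=> /andP[/eqP h1 /eqP h2]; apply/eqP; rewrite eq_complex /=; apply/andP; split; apply/eqP; lra.
  have a0 : a != 0 by rewrite -sqn_gt0 -ab.
  have [k1 k2] := mobius_Some_eq fx; have [k3 k4] := mobius_Some_eq fy.
  move: k2 k4; rewrite eba /= !mulr1 => k2 k4.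
  apply/eqP; rewrite -subr_eq0; have : (M 0 0 - M 1 1) * (2 * a) = 0.
    transitivity (M 0 0 * a + M 0 1 - (M 0 0 * - a + M 0 1) - 2 * M 1 1 * a); first by ring.
    by rewrite k2 k4; ring.
  by move/eqP; rewrite mulf_eq0 mulf_eq0 pnatr_eq0 (negPf a0) !orbF.
Qed.

End Normalisation.

(** * Conjugation of the group and continuity on the sphere *)

Section Conjugation.
Context {R : realType}.
Implicit Types (g h M A B : 'M[Cplx R]_2) (xi x y : Chat R) (z X : Cplx R) (G : set 'M[Cplx R]_2).

Section Conj.
Context (g : 'M[Cplx R]_2) (dg : \det g = 1) (A B : 'M[Cplx R]_2) (dA : \det A = 1) (dB : \det B = 1).

Lemma det_conj M : \det M = 1 -> \det (g * M * g^-1) = 1.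
Proof. by move=> dM; apply: det1_mul; [exact: det1_mul|exact: det1_inv]. Qed.

Lemma letter_conj l : letter (g * A * g^-1) (g * B * g^-1) l = g * letter A B l * g^-1.
Proof.
have ug := det1_unit dg.
have inv M : \det M = 1 -> (g * M * g^-1)^-1 = g * M^-1 * g^-1.
  move=> dM; have uM := det1_unit dM.
  rewrite invrM; [|by apply/det1_unit/det1_mul|by rewrite unitrV].
  by rewrite invrK invrM// mulrA.
by rewrite !letterE; case: l.1 l.2 => -[]; [exact: inv dA| |exact: inv dB|].
Qed.

Lemma word_val_conj w : word_val (g * A * g^-1) (g * B * g^-1) w = g * word_val A B w * g^-1.
Proof.
have ug := det1_unit dg; elim: w => [|l w IH].
  by rewrite !word_val_nil mulr1 mulrV.
by rewrite !word_val_cons IH letter_conj !mulrA mulrVK.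
Qed.

Lemma generated_conj : generated (g * A * g^-1) (g * B * g^-1) =
  [set g * k * g^-1 | k in generated A B].
Proof.
apply/seteqP; split=> [_ [w _ <-]|_ [_ [w _ <-] <-]].
  by rewrite word_val_conj; exists (word_val A B w) => //; exists w.
by rewrite -word_val_conj; exists w.
Qed.

Lemma mobius_conj M xi : \det M = 1 ->
  mobius (g * M * g^-1) (mobius g xi) = mobius g (mobius M xi).
Proof.
by move=> dM; rewrite mobius_mul ?det1_inv// mobiusK// mobius_mul.
Qed.

Lemma elementary_conj : elementary (generated (g * A * g^-1) (g * B * g^-1)) ->
  elementary (generated A B).
Proof.
rewrite generated_conj => -[xi fin]; exists (mobius g^-1 xi).
apply: (@sub_finite_set _ _ (mobius g^-1 @` [set mobius k xi | k in [set g * k * g^-1 | k in generated A B]])).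
  move=> _ [k Gk <-]; exists (mobius (g * k * g^-1) xi).
    by exists (g * k * g^-1) => //; exists k.
  have dk := generated_det dA dB Gk.
  by rewrite -{1}(mobiusVK xi dg) mobius_conj// mobiusK.
exact: finite_image.
Qed.

Lemma limit_set_conj_sub xi : limit_set (generated A B) xi ->
  limit_set (generated (g * A * g^-1) (g * B * g^-1)) (mobius g xi).
Proof.
have Gd := generated_det dA dB; have Gd' := generated_det (det_conj dA) (det_conj dB).
move=> /(limit_setE _ Gd)/(near_base_conj Gd dg) H; apply/(limit_setE _ Gd').
by rewrite generated_conj.
Qed.

End Conj.

Lemma conjVK g M : \det g = 1 -> g^-1 * (g * M * g^-1) * g^-1^-1 = M.
Proof. by move=> dg; have ug := det1_unit dg; rewrite invrK mulrA mulrA mulVr// mul1r mulrVK. Qed.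

(** Generic in F so that the same rewriting serves [generated] and [palindrome_axes]. *)
Lemma conjVK2 (T : Type) (F : 'M[Cplx R]_2 -> 'M[Cplx R]_2 -> T) g A B : \det g = 1 ->
  F (g^-1 * (g * A * g^-1) * g^-1^-1) (g^-1 * (g * B * g^-1) * g^-1^-1) = F A B.
Proof. by move=> dg; congr F; exact: conjVK. Qed.

Lemma limit_set_conj g A B : \det g = 1 -> \det A = 1 -> \det B = 1 ->
  limit_set (generated (g * A * g^-1) (g * B * g^-1)) = mobius g @` limit_set (generated A B).
Proof.
move=> dg dA dB; apply/seteqP; split=> [xi H|_ [xi H <-]]; last exact: limit_set_conj_sub.
exists (mobius g^-1 xi); last exact: mobiusVK.
rewrite -(conjVK2 (@generated R) A B dg).
exact: (limit_set_conj_sub (det1_inv dg) (det_conj dg dA) (det_conj dg dB) H).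
Qed.

Lemma palindrome_axes_conj g A B x y : \det g = 1 -> \det A = 1 -> \det B = 1 ->
  palindrome_axes A B (x, y) ->
  palindrome_axes (g * A * g^-1) (g * B * g^-1) (mobius g x, mobius g y).
Proof.
move=> dg dA dB [/= xy [w rw ax]]; split=> /=; first by move=> /(mobius_inj dg).
exists w => //; rewrite word_val_conj//; apply: axis_ends_conj => //.
exact: det_word.
Qed.

Lemma nbhs_infty (U : set (Chat R)) : nbhs (None : Chat R) U ->
  exists2 r : R, 0 < r & forall z, r < sqn z -> U (Some z).
Proof.
rewrite /nbhs /= => -[W [cW _] WU].
have [[w0 W0]|W0] := pselect (W !=set0); last first.
  by exists 1 => // z _; apply: WU; left; exists z => //= Wz; apply: W0; exists z.
have := @compact_EVT_max _ _ (@sqn R) W (ex_intro _ _ W0) cW.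
case; first by apply: continuous_subspaceT; exact: sqn_continuous.
move=> c _ H; exists (sqn c + 1); first by rewrite ltr_wpDl ?sqn_ge0.
move=> z rz; apply: WU; left; exists z => //= Wz.
have : sqn z <= sqn c by apply: H; rewrite inE.
lra.
Qed.

Lemma affine_continuous (a b : Cplx R) : continuous (fun z : Cplx R => a * z + b).
Proof.
move=> z U /nbhs_sqn[e e0 He]; apply/nbhs_sqn; have a0 := sqn_ge0 a.
exists (e / (sqn a + 1)); first by rewrite divr_gt0//; lra.
move=> w; rewrite ltr_pdivlMr; last by lra.
move=> we; apply: He; rewrite (_ : _ - _ = a * (w - z)); last by ring.
rewrite sqnM; have := sqn_ge0 (w - z); lra.
Qed.

(** Continuity at a finite point. The image may be infinity, whose neighbourhoods are complements of
    compact sets, hence the two cases for the denominator. *)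
Lemma nbhs_mobius g X (U : set (Chat R)) : \det g = 1 -> nbhs (mobius g (Some X)) U ->
  exists2 e : R, 0 < e & forall z, sqn (z - X) < e -> U (mobius g (Some z)).
Proof.
move=> dg; pose num z : Cplx R := g 0 0 * z + g 0 1; pose den z : Cplx R := g 1 0 * z + g 1 1.
have E z : mobius g (Some z) = toC (num z) (den z) by rewrite mobiusE /= !mulr1.
have cnum : (fun z => num z) @ X --> num X.
  exact: (@affine_continuous (g 0 0) (g 0 1) X).
have cden : (fun z => den z) @ X --> den X.
  exact: (@affine_continuous (g 1 0) (g 1 1) X).
rewrite E /toC; have [d0|d0] := eqVneq (den X) 0.
  move=> /[dup] /nbhs_singleton UN /nbhs_infty[r r0 Hr].
  have n0 : 0 < sqn (num X).
    rewrite sqn_gt0; apply/eqP => n0; have := det1_vec dg (@vec_neq0 R (Some X)).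
    by rewrite /= !mulr1 => /(_ d0); apply.
  have csn : (fun z => sqn (num z)) @ X --> sqn (num X).
    by apply: (cvg_comp _ _ cnum); exact: sqn_continuous.
  have csd : (fun z => sqn (den z)) @ X --> sqn (den X).
    by apply: (cvg_comp _ _ cden); exact: sqn_continuous.
  have h1 : nbhs X [set z | sqn (num X) / 2 < sqn (num z)].
    by move/cvgr_gt: csn; apply; rewrite ltr_pdivrMr//; lra.
  have h2 : nbhs X [set z | sqn (den z) < sqn (num X) / 2 / r].
    by move/cvgr_lt: csd; apply; rewrite d0 sqn0 !divr_gt0.
  have [e e0 He] := (nbhs_sqn X _).1 (filterI h1 h2).
  exists e => // z; rewrite E /toC => /He[k1 k2]; case: eqVneq => dz //.
  apply: Hr; rewrite sqnM sqnV ltr_pdivlMr ?sqn_gt0//.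
  by move: k1 k2; rewrite /= ltr_pdivlMr//; lra.
move=> /nbhs_sqn[r r0 Hr].
have csd : (fun z => sqn (den z)) @ X --> sqn (den X).
  by apply: (cvg_comp _ _ cden); exact: sqn_continuous.
have dX : 0 < sqn (den X) by rewrite sqn_gt0.
have h1 : nbhs X [set z | sqn (den X) / 2 < sqn (den z)].
  by move/cvgr_gt: csd; apply; rewrite ltr_pdivrMr//; lra.
have [e e0 He] := (nbhs_sqn X _).1 h1.
pose e' := Num.min e (r * (sqn (den X) / 2 * sqn (den X))).
exists e'; first by rewrite lt_min e0 /= !mulr_gt0// divr_gt0.
move=> z; rewrite E /toC lt_min => /andP[/He dz zX].
have {}dz : sqn (den X) / 2 < sqn (den z) by [].
have dz0 : 0 < sqn (den z) by apply: lt_trans dz; rewrite divr_gt0.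
have dn : den z != 0 by rewrite -sqn_gt0.
rewrite (negPf dn); apply: Hr.
(* The numerator z - X is exact because the determinant is 1. *)
have -> : num z / den z - num X / den X = (z - X) / (den z * den X).
  have -> : z - X = num z * den X - num X * den z.
    by rewrite -[LHS]mul1r -dg det2E /num /den; ring.
  by field; rewrite dn d0.
rewrite sqnM sqnV sqnM ltr_pdivrMr ?mulr_gt0//; apply: lt_trans zX _.
by rewrite ltr_pM2l// ltr_pM2r.
Qed.

End Conjugation.

(** * Transfer from the normalised group to the given one *)

Unset Implicit Arguments.
Local Close Scope complex_scope.

Theorem theorem7p1 (R : realType) (A B : 'M[Cplx R]_2)
    (l1 l2 : Chat R) (Q1 Q2 : Pt R)
    (hA : \det A = 1) (hB : \det B = 1)
    (G := generated A B)
    (hne : ~ elementary G) (hgf : geometrically_finite G)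
    (hL : core_geodesic A B l1 l2)
    (L := geodesic l1 l2)
    (C := hull (limit_set G))
    (I := L `&` C)
    (hQ : endpoints L I = [set Q1; Q2]) :
  (exists x y : Chat R,
      [/\ leaf (frontier C) x y,
          exists2 Q, Q = Q1 \/ Q = Q2 & orthogonal_at x y l1 l2 Q &
          limit_point (palindrome_axes A B) (x, y)])
  \/
  [/\ forall x y : Chat R, leaf (frontier C) x y -> geodesic x y `&` I = set0,
      exists2 D, complementary_component (frontier C) D & D Q1,
      exists2 D, complementary_component (frontier C) D & D Q2 &
      ~ maximal_pleating (frontier C)].
Proof.
have [l12 [a1 [a2 [b1 [b2 [axA axB perpA perpB _]]]]]] := hL.
have [g [dg gl1 gl2]] := normalising l12.
have dV := det1_inv dg.
pose A' := g * A * g^-1; pose B' := g * B * g^-1.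
have dA : \det A' = 1 by exact: det_conj.
have dB : \det B' = 1 by exact: det_conj.
have perp x y : perpendicular l1 l2 x y ->
    perpendicular (Some 0) None (mobius g x) (mobius g y).
  case=> [[-> e]|[xy [p op]]]; last first.
    right; split; first by move=> /(mobius_inj dg).
    by exists (act g p); have := orthogonal_at_act dg op; rewrite gl1 gl2.
  by left; split=> //; case: e => <-; rewrite ?gl1 ?gl2; [left|right].
have sA : A' 0 0 = A' 1 1.
  exact: (perpendicular_entries dA (axis_ends_conj dg hA axA) (perp _ _ perpA)).
have sB : B' 0 0 = B' 1 1.
  exact: (perpendicular_entries dB (axis_ends_conj dg hB axB) (perp _ _ perpB)).
have ne' : ~ elementary (generated A' B') by move=> /(elementary_conj dg hA hB).
have eK : limit_set (generated A' B') = mobius g @` limit_set G by exact: limit_set_conj.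
have eC : hull (limit_set (generated A' B')) = act g @` C by rewrite eK hull_act.
have eL : geodesic (Some 0) None = act g @` L by rewrite -gl1 -gl2 geodesic_act.
have LH : L `<=` H3 by exact: geodesic_H3.
have CH : C `<=` H3 by exact: hull_H3.
have IH : I `<=` H3 by move=> p [/LH].
have H3Q Q : Q = Q1 \/ Q = Q2 -> H3 Q.
  by move=> QQ; have : [set Q1; Q2] Q by []; rewrite -hQ => -[[/LH]].
have eI : act g @` L `&` act g @` C = act g @` I.
  apply/seteqP; split=> [_ [[p Lp <-] [q Cq e]]|_ [p [Lp Cp] <-]]; last first.
    by split; exists p.
  exists p => //; split=> //.
  by rewrite -(actK dg (LH _ Lp)) -e (actK dg (CH _ Cq)).
have eQ : endpoints (geodesic (Some 0) None)
    (geodesic (Some 0) None `&` hull (limit_set (generated A' B'))) = [set act g Q1; act g Q2].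
  by rewrite eC eL eI endpoints_act// hQ image_setU !image_set1.
have eS : frontier (hull (limit_set (generated A' B'))) = act g @` frontier C.
  by rewrite eC frontier_act.
have SH : frontier C `<=` H3 by exact: frontier_H3.
have back x y : leaf (act g @` frontier C) x y -> leaf (frontier C) (mobius g^-1 x) (mobius g^-1 y).
  by move=> /(leaf_act dV (H3_image dg SH)); rewrite act_imageK.
have Vl1 : mobius g^-1 (Some 0) = l1 by rewrite -gl1 mobiusK.
have Vl2 : mobius g^-1 None = l2 by rewrite -gl2 mobiusK.
have [[X [lf [Q QQ oQ] X0 KX]]|[h1 h2 h3 h4]] := symmetric_dichotomy dA dB sA sB eQ.
  left; exists (mobius g^-1 (Some X)), (mobius g^-1 (Some (- X))); split.
  - by apply: back; rewrite -eS.
  - have := orthogonal_at_act dV oQ; rewrite Vl1 Vl2.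
    case: QQ => ->.
      rewrite actK//; last by apply: H3Q; left.
      by exists Q1; [left|].
    rewrite actK//; last by apply: H3Q; right.
    by exists Q2; [right|].
  (* A limit point requires an element of U other than the pair of ends of the leaf; it is the pair
     from s and - s, distinct because [s <> X] and g^-1 is injective. *)
  - move=> U [[U1 U2] /= [nU1 nU2] US].
    have [e1 e10 He1] := nbhs_mobius dV nU1.
    have [e2 e20 He2] := nbhs_mobius dV nU2.
    have e0 : 0 < Num.min e1 e2 by rewrite lt_min e10.
    have [s [sX nsX pal]] := palindrome_axes_approx dA dB sA sB ne' KX X0 e0.
    exists (mobius g^-1 (Some s), mobius g^-1 (Some (- s))); split.
    + apply/eqP => e; apply: nsX.
      have /(mobius_inj dV) : mobius g^-1 (Some s) = mobius g^-1 (Some X) := congr1 fst e.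
      by case.
    + rewrite -(conjVK2 (@palindrome_axes R) A B dg).
      exact: (palindrome_axes_conj dV dA dB pal).
    + move: sX; rewrite lt_min => /andP[s1 s2].
      apply: (US (_, _)); split=> /=; first exact: He1.
      by apply: He2; rewrite -opprD sqnN.
right; rewrite eS in h1 h2 h3 h4; rewrite eC eL eI in h1.
have compb D Q : H3 Q -> complementary_component (act g @` frontier C) D -> D (act g Q) ->
    exists2 D, complementary_component (frontier C) D & D Q.
  move=> HQ /(complementary_component_act dV (H3_image dg SH)).
  rewrite act_imageK// => cD DQ; exists (act g^-1 @` D) => //.
  by exists (act g Q) => //; rewrite actK.
split.
- move=> x y lf; apply/seteqP; split=> // p [xyp Ip].
  have lf' := leaf_act dg SH lf.
  have : (geodesic (mobius g x) (mobius g y) `&` act g @` I) (act g p).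
    by split; [exact: geodesic_act_sub|exists p].
  by rewrite h1.
- by case: h2 => D cD DQ; apply: (compb D) => //; apply: H3Q; left.
- by case: h3 => D cD DQ; apply: (compb D) => //; apply: H3Q; right.
- by move=> mx; apply: h4; apply: maximal_pleating_act.
Qed.
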